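(* Let $\mathcal G=(\mathcal V,\mathcal E)$ be an infinite, connected, locally finite metric graph with $j:=\sup_{e\in\mathcal E}l_e<\infty$ and $r:=\inf_{e\in\mathcal E}l_e>0$. Let $x_0\in\mathcal V$ be such that there is a sequence $\{x_n\}\subset\mathcal V$ with $d(x_0,x_n)\to+\infty$ and such that for every $R>0$ the ball $B_R=B_R(x_0)$ is finite (consists of finitely many vertices and edges), and assume there is a constant $C_0>0$ with $\sum_{y\sim x}\omega(x,y)\le C_0\,\mu_{\mathcal V}(x)$ for all $x\in\mathcal V$. Put $R_0:=\max\{2j,1\}$. Let $\sigma>1$, $\delta>0$, and for $R\ge R_0$ let $\alpha=\alpha(R)=\delta/R$. Let $h:\mathcal G\times[0,\infty)\to\mathbb R$ be positive and suppose there is a constant $C>0$ such that for every $R\ge R_0$, with $\alpha=\delta/R$, $$\int_R^{2R}\Big\{\sum_{x\in\mathcal V\cap B_R}\mu_{\mathcal V}(x)h^{-\frac1{\sigma-1}}(x,t)e^{-\alpha d(x,x_0)}\Big\}dt\le CR^{\frac\sigma{\sigma-1}},\qquad \int_R^{2R}\Big\{\sum_{e\in\mathcal E}\int_0^{l_e}h_e^{-\frac1{\sigma-1}}(x,t)e^{-\alpha d(x,x_0)}\mathbf 1_{B_R}(x)\,dx\Big\}dt\le CR^{\frac\sigma{\sigma-1}},$$ $$\int_0^{2R}\Big\{\sum_{x\in\mathcal V\cap B_R^c}\mu_{\mathcal V}(x)h^{-\frac1{\sigma-1}}(x,t)e^{-\alpha d(x,x_0)}\Big\}dt\le CR^{\frac\sigma{\sigma-1}},\qquad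 \int_0^{2R}\Big\{\sum_{e\in\mathcal E}\int_0^{l_e}h_e^{-\frac1{\sigma-1}}(x,t)e^{-\alpha d(x,x_0)}\mathbf 1_{B_R^c}(x)\,dx\Big\}dt\le CR^{\frac\sigma{\sigma-1}}.$$ Let $u$ be a very weak solution (of no prescribed sign) of $$u_t\ge\Delta_{\mathcal G}u+h|u|^\sigma\ \text{ on }\mathcal G\times(0,\infty),\qquad u(x,0)=u_0(x),\ x\in\mathcal G,$$ such that $u\in L^1_{\rm loc}([0,\infty);X_\alpha)$ and $u_0\in X_\alpha$ (for $\alpha=\delta/R$, every $R\ge R_0$), and $$\int_{\mathcal G}u_0(x)\,d\mu_{\mathcal G}\ge0.$$ Then $u\equiv0$ on $\mathcal G\times[0,\infty)$; that is, the problem admits no nontrivial such solution.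
   Context: Metric graph: $\mathcal V$ and $\mathcal E$ are countable sets of vertices and edges. Each edge $e$ has a length $l_e\in(0,\infty)$ and is identified with $I_e=(0,l_e)$, its closure with $[0,l_e]$, where $0$ corresponds to the initial vertex $i(e)$ and $l_e$ to the final vertex $j(e)$ (the number $j$ and the map $j(\cdot)$ are different objects); the intervals are glued at the vertices. $e\ni x$ means that the vertex $x$ is an endpoint of $e$; $x\sim y$ means that $x,y$ are joined by an edge. Locally finite: every vertex has finite degree. $d$ is the path metric (infimum of lengths of connecting paths), $B_R(x_0)=\{x\in\mathcal G:d(x,x_0)<R\}$, $B_R^c=\mathcal G\setminus B_R(x_0)$. A function $f$ on $\mathcal G$ is identified with the family $(f_e)_{e\in\mathcal E}$, $f_e:[0,l_e]\to\mathbb R$, with values agreeing at common vertices; $f\in C(\mathcal G)$ if each $f_e$ is continuous. Primes denote derivatives in the space variable. $\mu_{\mathcal V}:\mathcal V\to(0,\infty)$ is a vertex measure, and $\omega:\mathcal V\times\mathcal V\to[0,\infty)$ is symmetric with $\omega(x,y)>0$ iff $x\sim y$. Integrals: $\int_{\mathcal G}f\,d\mu_{\mathcal G}:=\sum_{x\in\mathcal V}\mu_{\mathcal V}(x)f(x)+\sum_{e\in\mathcal E}\int_0^{l_e}f_e(x)\,dx$. Weighted space: $X_\alpha:=L^1_{e^{-\alpha d(x,x_0)}}(\mathcal G)$, the space of functions $f$ on $\mathcal G$ with $\|f\|_{X_\alpha}=\sum_{x\in\mathcal V}\mu_{\mathcal V}(x)e^{-\alpha d(x,x_0)}|f(x)|+\sum_{e\in\mathcal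 E}\int_0^{l_e}|f_e(x)|e^{-\alpha d(x,x_0)}dx<\infty$. Laplacian: $\Delta_{\mathcal V}f(x)=\frac1{\mu_{\mathcal V}(x)}\sum_{y\sim x}\omega(x,y)(f(y)-f(x))$ for $x\in\mathcal V$; $\Delta_{\mathcal E}f=f_e''$ on each $I_e$; $\Delta_{\mathcal G}f$ is understood through $\int_{\mathcal G}g\,\Delta_{\mathcal G}f\,d\mu_{\mathcal G}:=\sum_{x\in\mathcal V}\mu_{\mathcal V}(x)g(x)\Delta_{\mathcal V}f(x)+\sum_{e\in\mathcal E}\int_0^{l_e}g_e f_e''\,dx$. $\mathcal D(\mathcal G)$ is the set of $f\in C(\mathcal G)$ with $f_e\in C^2(I_e)\cap C^1([0,l_e])$ and $f_e''\in L^\infty(I_e)$ for all $e$. The Kirchhoff operator at $x\in\mathcal V$ is $[\mathcal K(f)](x)=\sum_{e\ni x}\frac{df_e(x)}{dn}$, where $\frac{df_e(x)}{dn}=f_e'(x)$ if $j(e)=x$ and $-f_e'(x)$ if $i(e)=x$. Very weak solution of the parabolic problem: $u:\mathcal G\times[0,\infty)\to\mathbb R$ such that (1) for every $x\in\mathcal G$, $u(x,\cdot)\in L^1_{\rm loc}([0,\infty))\cap L^\sigma_{\rm loc}([0,\infty),h(x,\cdot)dt)$; (2) for every $t\ge0$, $u(\cdot,t)\in\mathcal D(\mathcal G)$ and $[\mathcal K(u)](x,t)=0$ for all $x\in\mathcal V$; (3) for every nonnegative $\varphi:\mathcal G\times[0,\infty)\to\mathbb R$ with $\mathrm{supp}\,\varphi\subset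 A\times[0,T]$ for some $T>0$ and compact $A\subset\mathcal G$, and $\varphi(x,\cdot)\in C^1([0,\infty))$ for all $x\in\mathcal G$, $$\int_0^\infty\!\!\int_{\mathcal G}\varphi\,\Delta_{\mathcal G}u\,d\mu_{\mathcal G}dt+\int_0^\infty\!\!\int_{\mathcal G}h|u|^\sigma\varphi\,d\mu_{\mathcal G}dt+\int_0^\infty\!\!\int_{\mathcal G}u\,\varphi_t\,d\mu_{\mathcal G}dt+\int_{\mathcal G}u_0(x)\varphi(x,0)\,d\mu_{\mathcal G}\le0.$$ Here $u_0:\mathcal G\to\mathbb R$ is the given initial datum.
   Formalization: The conclusion ''u ≡ 0 on G×[0,∞)'' is proved as: for almost every t ≥ 0, u(x,t) = 0 for all x in G; the literal claim fails, e.g. for u = 1 at the single time t = 1 and 0 otherwise, with u_0 = 0. *)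

(* Defs.v *)
From HB Require Import structures.
From mathcomp Require Import all_boot all_order all_algebra.
From mathcomp Require Import all_classical all_reals all_analysis.

Set Implicit Arguments.
Unset Strict Implicit.
Unset Printing Implicit Defensive.

Import Order.TTheory GRing.Theory Num.Theory.
Import numFieldNormedType.Exports.

Local Open Scope classical_set_scope.
Local Open Scope ring_scope.

(* Loops and multiple edges are allowed; "countable" includes "finite". *)
Record metricGraph (R : realType) := MetricGraph {
  vertex : countType;
  edge : countType;
  init : edge -> vertex;
  term : edge -> vertex;
  len : edge -> R;
  len_gt0 : forall e, 0 < len e
}.

(* The intervals [0, len e] glued at the vertices: a point is either a vertex
   or a point of one of the open edges. *)
Inductive gpoint (R : realType) (G : metricGraph R) : Type :=
| Vtx of vertex G
| Inn (e : edge G) (s : R) of 0 < s < len e.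

Section Graph.
Context {R : realType} {G : metricGraph R}.
Local Notation V := (vertex G).
Local Notation E := (edge G).

(* The chart of the closed edge e, extended by constants outside [0, len e];
   f_e is f \o edge_pt e. *)
Definition edge_pt (e : E) (s : R) : gpoint G :=
  match @idP (0 < s < len e) with
  | ReflectT se => Inn se
  | ReflectF _ => if s <= 0 then Vtx (init e) else Vtx (term e)
  end.

Definition on_edge (f : gpoint G -> R) (e : E) (s : R) : R := f (edge_pt e s).

Definition joined (x y : V) : Prop :=
  exists e : E, (init e = x /\ term e = y) \/ (init e = y /\ term e = x).

Definition locally_finite : Prop :=
  forall x : V, finite_set [set e : E | init e = x \/ term e = x].

(* A path is a finite chain of points in which two consecutive points lie on a
   common closed edge e, with parameters s and t; such a step has length
   `|s - t|. *)
Inductive path_of_length : gpoint G -> gpoint G -> R -> Prop :=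
| path_nil p : path_of_length p p 0
| path_step (e : E) (s t : R) q (L : R) :
    0 <= s <= len e -> 0 <= t <= len e ->
    path_of_length (edge_pt e t) q L ->
    path_of_length (edge_pt e s) q (`|s - t| + L).

Definition path_connected_graph : Prop :=
  forall p q : gpoint G, exists L, path_of_length p q L.

(* The path metric, with value +oo between different components. *)
Definition gedist (p q : gpoint G) : \bar R :=
  ereal_inf [set L%:E | L in path_of_length p q].

Definition gdist (p q : gpoint G) : R := fine (gedist p q).

Lemma path_cat p q r L M :
  path_of_length p q L -> path_of_length q r M -> path_of_length p r (L + M).
Proof.
move=> pq; elim: pq r M => [{}p r M|e s t {}q {}L se te _ IH r M qr].
  by rewrite add0r.
by rewrite -addrA; apply: path_step => //; exact: IH.
Qed.

Lemma path_sym p q L : path_of_length p q L -> path_of_length q p L.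
Proof.
elim=> [{}p|e s t {}q {}L se te _ IH]; first exact: path_nil.
rewrite addrC; apply: path_cat IH _.
by rewrite distrC -[`|_|]addr0; apply: path_step => //; exact: path_nil.
Qed.

Definition gball (p : gpoint G) (r : R) : set (gpoint G) :=
  [set q | (gedist p q < r%:E)%E].

Lemma gballP p r q :
  gball p r q <-> exists2 L, path_of_length p q L & L < r.
Proof.
split=> [/ereal_inf_lt[_ [L pq <-]]|[L pq Lr]].
  by rewrite lte_fin => Lr; exists L.
by apply: le_lt_trans (_ : (L%:E < _)%E); [apply: ereal_inf_lbound; exists L|].
Qed.

Lemma gball_center p (r : R) : 0 < r -> gball p r p.
Proof. by move=> r0; apply/gballP; exists 0 => //; exact: path_nil. Qed.

Lemma gball_sym p q (r : R) : gball p r q -> gball q r p.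
Proof. by move=> /gballP[L /path_sym qp Lr]; apply/gballP; exists L. Qed.

Lemma gball_triangle p q r (a b : R) :
  gball p a q -> gball q b r -> gball p (a + b) r.
Proof.
move=> /gballP[L pq La] /gballP[M qr Mb]; apply/gballP.
by exists (L + M); [exact: path_cat qr | exact: ltrD].
Qed.

End Graph.

Arguments locally_finite {R} G.
Arguments path_connected_graph {R} G.

Section GraphTopology.
Context {R : realType} (G : metricGraph R).

HB.instance Definition _ := gen_eqMixin (gpoint G).
HB.instance Definition _ := gen_choiceMixin (gpoint G).
HB.instance Definition _ :=
  hasNbhs.Build (gpoint G) (nbhs_ (entourage_ (@gball R G))).
HB.instance Definition _ :=
  Nbhs_isPseudoMetric.Build R (gpoint G) erefl
    gball_center gball_sym gball_triangle erefl.

End GraphTopology.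

Section Calculus.
Context {R : realType}.

(* The derivative of f at s relative to A (one-sided at an endpoint of A). *)
Definition diffquot (f : R -> R) (s y : R) : R := (f y - f s) / (y - s).

Definition derive_in (A : set R) (f : R -> R) (s : R) : R :=
  lim (diffquot f s y @[y --> within A s^']).

Definition C1_in (A : set R) (f : R -> R) : Prop :=
  (forall s, A s -> cvg (diffquot f s y @[y --> within A s^'])) /\
  {within A, continuous (derive_in A f)}.

Definition C2_open (A : set R) (f : R -> R) : Prop :=
  forall s, A s -> [/\ derivable f s 1, derivable (f^`())%classic s 1 &
                       {for s, continuous (f^`(2))%classic}].

End Calculus.

Section Analysis.
Context {R : realType} {G : metricGraph R}.
Local Notation V := (vertex G).
Local Notation E := (edge G).
Local Notation leb := (@lebesgue_measure R).
Variables (mu : V -> R) (omega : V -> V -> R).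

(* The class D(G). *)
Definition classD (f : gpoint G -> R) : Prop :=
  forall e : E,
    [/\ {within `[0, len e], continuous (on_edge f e)},
        C2_open `]0, len e[ (on_edge f e),
        C1_in `[0, len e] (on_edge f e) &
        exists M : R, {ae leb, forall s,
          s \in `]0, len e[ -> `|((on_edge f e)^`(2))%classic s| <= M}].

(* A loop at x contributes both of its ends. *)
Definition kirchhoff (f : gpoint G -> R) (x : V) : R :=
  \sum_(e \in [set e : E | term e = x])
     derive_in `[0, len e] (on_edge f e) (len e)
  - \sum_(e \in [set e : E | init e = x])
     derive_in `[0, len e] (on_edge f e) 0.

Definition laplacian_V (f : V -> R) (x : V) : R :=
  (mu x)^-1 * \sum_(y \in [set y | joined x y]) omega x y * (f y - f x).

Definition laplacian (f : gpoint G -> R) (p : gpoint G) : R :=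
  match p with
  | Vtx x => laplacian_V (fun y => f (Vtx y)) x
  | @Inn _ _ e s _ => ((on_edge f e)^`(2))%classic s
  end.

(* The integral of a nonnegative function over G ... *)
Definition gint_nneg (f : gpoint G -> R) : \bar R :=
  (\esum_(x in [set: V]) (mu x * f (Vtx x))%:E
   + \esum_(e in [set: E]) \int[leb]_(s in `]0%R, len e[) (on_edge f e s)%:E)%E.

(* ... and of a signed one. As for the integrals of the library, the value is
   -oo when the positive and the negative part both have integral +oo. *)
Definition gint (f : gpoint G -> R) : \bar R :=
  (gint_nneg (f^\+)%R - gint_nneg (f^\-)%R)%E.

Definition normX (x0 : V) (alpha : R) (f : gpoint G -> R) : \bar R :=
  gint_nneg (fun p => expR (- alpha * gdist p (Vtx x0)) * `|f p|).

Definition inX (x0 : V) (alpha : R) (f : gpoint G -> R) : Prop :=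
  (forall e : E, measurable_fun `]0, len e[ (on_edge f e)) /\
  (normX x0 alpha f < +oo)%E.

(* Measurability of a function on G x [0, +oo[ with respect to the product of
   mu_G and the Lebesgue measure. *)
Definition st_measurable (f : gpoint G -> R -> R) : Prop :=
  (forall x : V, measurable_fun `[(0 : R), +oo[ (f (Vtx x))) /\
  (forall e : E, measurable_fun (`]0, len e[ `*` `[(0 : R), +oo[)
     (fun z : measurableTypeR R * measurableTypeR R => f (edge_pt e z.1) z.2)).

(* L^1_loc([0, +oo[; X_alpha). *)
Definition L1loc_X (x0 : V) (alpha : R) (u : gpoint G -> R -> R) : Prop :=
  st_measurable u /\
  forall T : R, 0 < T ->
    (\int[leb]_(t in `[0%R, T]) normX x0 alpha (u^~ t) < +oo)%E.

Definition supp (phi : gpoint G -> R -> R) : set (gpoint G * R) :=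
  closure [set z | 0 <= z.2 /\ phi z.1 z.2 <> 0].

Definition test_function (phi : gpoint G -> R -> R) : Prop :=
  [/\ forall p (t : R), 0 <= t -> 0 <= phi p t,
      exists (T : R) (A : set (gpoint G)),
        [/\ 0 < T, compact A & supp phi `<=` A `*` `[0, T]],
      forall p, C1_in `[0, +oo[ (phi p) &
      forall (e : E) (t : R), 0 <= t ->
        measurable_fun `]0, len e[ (on_edge (phi^~ t) e)].

(* The functions are defined on R in time, but only t >= 0 is relevant. Replacing
   u(., t) by, say, a constant for t in a null set preserves all conditions, so
   a very weak solution is only determined for almost every t. *)
Record very_weak_solution (h : gpoint G -> R -> R) (sigma : R)
    (u0 : gpoint G -> R) (u : gpoint G -> R -> R) : Prop := {
  vws_L1loc : forall p (T : R), 0 < T ->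
    leb.-integrable `[0, T] (fun t => (u p t)%:E);
  vws_Lsigmaloc : forall p (T : R), 0 < T ->
    leb.-integrable `[0, T] (fun t => (h p t * `|u p t| `^ sigma)%:E);
  vws_classD : forall t : R, 0 <= t -> classD (u^~ t);
  vws_kirchhoff : forall t : R, 0 <= t -> forall x : V, kirchhoff (u^~ t) x = 0;
  vws_ineq : forall phi, test_function phi ->
    (\int[leb]_(t in `[0%R, +oo[) gint (fun p => phi p t * laplacian (u^~ t) p)%R
     + \int[leb]_(t in `[0%R, +oo[)
         gint (fun p => h p t * `|u p t| `^ sigma * phi p t)%R
     + \int[leb]_(t in `[0%R, +oo[)
         gint (fun p => u p t * derive_in `[0, +oo[ (phi p) t)%R
     + gint (fun p => u0 p * phi p 0)%R <= 0)%E
}.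

End Analysis.

(* Main.v *)
Require Import Defs.
From HB Require Import structures.
From mathcomp Require Import all_boot all_order all_algebra.
From mathcomp Require Import all_classical all_reals all_analysis.
From mathcomp Require Import measurable_realfun.
From mathcomp Require Import ring lra.

Set Implicit Arguments.
Unset Strict Implicit.
Unset Printing Implicit Defensive.

Import Order.TTheory GRing.Theory Num.Theory.
Import numFieldNormedType.Exports.

Local Open Scope classical_set_scope.
Local Open Scope ring_scope.

(** Why the theorem holds.  Test the inequality with a product
    [phi = extend v p * tcut r k t] of a cutoff in space and a cutoff in time.
    Since [phi] is smooth along every edge with zero slope at the vertices, the
    Kirchhoff condition on [u] moves the Laplacian from [u] to [phi], and the
    inequality becomes

      int int h |u|^sigma phi + int u0 phi(., 0)
        <= int int |u| (|Delta phi| + |phi_t|).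

    The spatial cutoff is a truncated exponential: with [alpha = delta / r] and
    [d] the distance to [x0], it is the positive part of
    [exp (- alpha (d - r - J)_+) - kappa] at the vertices, where [J] bounds the
    lengths.  The exponential makes [|Delta phi|] comparable with [phi / r],
    with the factor [1 / r] from [alpha]; subtracting [kappa] makes the support
    compact and costs an additional error [(K / r) min (kappa, C exp (- alpha d))].
    The temporal cutoff is a high power, so that [|phi_t|] is at most
    [(c / r) phi^(1 / sigma)].  Both derivatives vanish on the ball of radius [r]
    up to time [r], so only the complement of that cylinder (the late region)
    contributes.

    By Young's inequality with a parameter [lam] ([young_split]) the right-hand
    side is at most

      lam int int_late h |u|^sigma phi
        + lam^(-1 / (sigma - 1)) (c / r)^(sigma / (sigma - 1))
            int int_late h^(-1 / (sigma - 1)) exp (- alpha d) + error,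

    and the growth hypotheses say exactly that the last integral is
    [O (r^(sigma / (sigma - 1)))]; the powers of [r] cancel and a constant
    [lam^(-1 / (sigma - 1)) D] remains, with [D] independent of [r].  The error
    is made small by the choice of [kappa], by dominated convergence, because
    [u] lies in [L^1_loc (X_alpha)].  The initial term has a nonnegative lower
    limit by Fatou's lemma, since the integral of [u0] is nonnegative.

    With [lam = 1 / 2] the reaction term on the right is absorbed, and [r -> oo]
    gives [int int h |u|^sigma < oo] ([stint_reaction_fin]).  Hence its late part
    tends to 0, and [r -> oo] again, now for an arbitrary [lam], gives
    [int int h |u|^sigma <= lam^(-1 / (sigma - 1)) D].  Letting [lam -> oo], the
    integral is 0 ([stint_reaction0]); as [h] is positive and [u(., t)] is
    continuous, [u(., t) = 0] for almost every [t].

    To have Tonelli's theorem, Fatou's lemma and dominated convergence on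
    [G x [0, +oo[], the sums of [gint_nneg] are realized as the integral of a
    sigma-finite measure on the points of the graph ([gmeasure]). *)

(** * The graph as a measure space *)

Section Charts.
Context {R : realType} {G : metricGraph R}.
Local Notation V := (vertex G).
Local Notation E := (edge G).

Lemma edge_pt_inn (e : E) s (se : 0 < s < len e) : edge_pt e s = Inn se.
Proof.
rewrite /edge_pt; case: {-}_ / idP => [se'|//].
by rewrite (Prop_irrelevance se' se).
Qed.

Lemma edge_pt_le0 (e : E) s : s <= 0 -> edge_pt e s = Vtx (init e).
Proof.
move=> s0; rewrite /edge_pt; case: {-}_ / idP => [se|_]; last by rewrite s0.
by have := se; rewrite ltNge s0.
Qed.

Lemma edge_pt_ge_len (e : E) s : len e <= s -> edge_pt e s = Vtx (term e).
Proof.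
move=> ls; rewrite /edge_pt; case: {-}_ / idP => [se|_].
  by have := se; rewrite [X in _ && X]ltNge ls andbF.
by rewrite leNgt (lt_le_trans (len_gt0 e) ls).
Qed.

End Charts.

(** A copy of [gpoint G] on which a sigma-algebra can be declared without
    touching the topology; the parameter [x0] makes it pointed. *)
Definition gspace (R : realType) (G : metricGraph R) (x0 : vertex G) : Type :=
  gpoint G.

Section BorelGraph.
Context {R : realType} {G : metricGraph R} (x0 : vertex G).
Local Notation V := (vertex G).
Local Notation E := (edge G).
Local Notation T := (gspace x0).

HB.instance Definition _ := gen_eqMixin T.
HB.instance Definition _ := gen_choiceMixin T.
HB.instance Definition _ := isPointed.Build T (Vtx x0).

(** The final sigma-algebra for the charts. Every chart is constant outside its
    edge, so it is measurable on the whole line and singletons of vertices are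
    measurable sets. *)
Definition gmeasurable : set (set T) :=
  [set A | forall e : E, measurable (edge_pt e @^-1` A : set (measurableTypeR R))].

Let gmeasurable0 : gmeasurable set0.
Proof. by move=> e; rewrite preimage_set0. Qed.

Let gmeasurableC A : gmeasurable A -> gmeasurable (~` A).
Proof.
by move=> mA e; rewrite preimage_setC; apply: measurableC; exact: mA.
Qed.

Let gmeasurable_bigcup (F : (set T)^nat) :
  (forall i, gmeasurable (F i)) -> gmeasurable (\bigcup_i F i).
Proof.
move=> mF e; rewrite preimage_bigcup; apply: bigcup_measurable => k _.
exact: mF.
Qed.

HB.instance Definition _ := @isMeasurable.Build default_measure_display T
  gmeasurable gmeasurable0 gmeasurableC gmeasurable_bigcup.

End BorelGraph.

Section BorelGraphTheory.
Context {R : realType} {G : metricGraph R} (x0 : vertex G).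
Local Notation V := (vertex G).
Local Notation E := (edge G).
Local Notation T := (gspace x0).

Lemma gmeasurableP (A : set T) : measurable A <->
  forall e : E, measurable (edge_pt e @^-1` A : set (measurableTypeR R)).
Proof. by []. Qed.

Lemma measurable_edge_pt (e : E) :
  measurable_fun [set: measurableTypeR R] (edge_pt e : _ -> T).
Proof. by move=> _ A mA; rewrite setTI; exact: mA. Qed.

(** A measurable left inverse of all the charts of open edges at once; it
    transports measurability from the edges to the graph. *)
Definition vtx_coord (p : T) : R := if p is Inn _ s _ then s else 0.

Definition in_edge (e : E) : set T :=
  [set p | if p is Inn e' _ _ then e' = e else False].

Lemma edge_ptK (e : E) (p : T) : in_edge e p -> edge_pt e (vtx_coord p) = p.
Proof. by case: p => [x []|e' s se /= <-]; exact: edge_pt_inn. Qed.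

Lemma edge_ptP (e : E) s :
  [\/ s <= 0 /\ edge_pt e s = Vtx (init e),
      len e <= s /\ edge_pt e s = Vtx (term e) |
      exists se : 0 < s < len e, edge_pt e s = Inn se].
Proof.
have [se|/negP] := pselect (0 < s < len e).
  by apply: Or33; exists se; exact: edge_pt_inn.
rewrite negb_and -!leNgt => /orP[s0|ls].
  by apply: Or31; split => //; exact: edge_pt_le0.
by apply: Or32; split => //; exact: edge_pt_ge_len.
Qed.

Lemma in_edge_pt (e e' : E) s :
  in_edge e (edge_pt e' s) <-> 0 < s < len e' /\ e' = e.
Proof.
have [[s0 ->]|[ls ->]|[se ->]]/= := edge_ptP e' s.
- by split => // -[]; rewrite ltNge s0.
- by split => // -[]; rewrite [X in _ && X]ltNge ls andbF.
- by split=> [|[]].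
Qed.

Lemma measurable_in_edge (e : E) : measurable (in_edge e).
Proof.
apply/gmeasurableP => e'; have [<-|ne] := pselect (e' = e).
  rewrite (_ : _ @^-1` _ = `]0, len e'[%classic) //.
  apply/seteqP; split => s /=; rewrite in_edge_pt in_itv /=; first by case.
  by [].
rewrite (_ : _ @^-1` _ = set0) //.
by apply/seteqP; split => s //=; rewrite in_edge_pt => -[].
Qed.

Lemma measurable_vtx (x : V) : measurable ([set Vtx x] : set T).
Proof.
apply/gmeasurableP => e; rewrite (_ : _ @^-1` _ =
    (if init e == x then `]-oo, 0]%classic else set0)
    `|` (if term e == x then `[len e, +oo[%classic else set0)); last first.
  apply/seteqP; split => s /=.
    have [[s0 ->]|[ls ->]|[se ->]]//= := edge_ptP e s; move=> [->]; rewrite eqxx;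
    [left|right].
      by rewrite /= in_itv.
    by rewrite /= in_itv /= ls.
  case; case: eqP => //= <-; rewrite in_itv /= ?andbT => h.
    exact: edge_pt_le0.
  exact: edge_pt_ge_len.
by apply: measurableU; case: ifP => // _; exact: measurable_itv.
Qed.

Lemma measurable_vtx_coord : measurable_fun setT (vtx_coord : T -> measurableTypeR R).
Proof.
move=> _ A mA; rewrite setTI; apply/gmeasurableP => e.
rewrite (_ : _ @^-1` _ =
  ((@id R) \_ `]0, len e[) @^-1` A); last first.
  apply/seteqP; split => s /=; rewrite /patch mem_setE in_itv /=;
  have [[s0 ->]|[ls ->]|[se ->]] /= := edge_ptP e s; rewrite ?se //;
  by rewrite ?(ltNge _ (len e)) ?ls ?andbF // ltNge s0.
rewrite -[X in measurable X]setTI.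
have : measurable_fun [set: measurableTypeR R] ((@id R) \_ `]0, len e[).
    apply/(measurable_restrictT _ (measurable_itv _)).
  exact: (@measurable_id _ (measurableTypeR R)).
by apply.
Qed.

(** The vertices and the open edges, enumerated as a countable measurable
    partition of the graph. *)
Definition cell (k : nat) : set T :=
  match unpickle k : option (V + E) with
  | Some (inl x) => [set Vtx x]
  | Some (inr e) => in_edge e
  | None => set0
  end.

Lemma cell_vtx (x : V) : cell (pickle (inl x : V + E)) = [set Vtx x].
Proof. by rewrite /cell pickleK. Qed.

Lemma cell_edge (e : E) : cell (pickle (inr e : V + E)) = in_edge e.
Proof. by rewrite /cell pickleK. Qed.

Lemma measurable_cell k : measurable (cell k).
Proof.
rewrite /cell; case: unpickle => [[x|e]|] //; first exact: measurable_vtx.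
exact: measurable_in_edge.
Qed.

Lemma bigcup_cell : \bigcup_k cell k = [set: T].
Proof.
apply/seteqP; split => // p _; case: p => [x|e s se].
  by exists (pickle (inl x : V + E)); [by []|rewrite cell_vtx].
by exists (pickle (inr e : V + E)); [by []|rewrite cell_edge].
Qed.

End BorelGraphTheory.

(** Measures are summed along [nat] whereas the sums of [gint_nneg] range over a
    countable type. *)
Lemma nneseries_pickle (R : realType) (I : countType) (a : I -> \bar R) :
  (forall i, 0 <= a i)%E ->
  (\sum_(k <oo) oapp a 0 (@pickle_inv I k) = \esum_(i in [set: I]) a i)%E.
Proof.
move=> a0; rewrite nneseries_esumT; last by move=> k; case: pickle_inv.
transitivity (\esum_(k in pickle @` [set: I]) oapp a 0 (@pickle_inv I k))%E.
  rewrite [RHS]esum_mkcond; apply: eq_esum => k _.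
  case: ifPn => // /negP; rewrite inE => nk.
  case E : (@pickle_inv I k) => [i|//]; case: nk; exists i => //.
  by have := @pickle_invK I k; rewrite E.
rewrite esum_image; last by move=> i j _ _; exact: (pcan_inj pickleK).
by apply: eq_esum => i _; rewrite pickleK_inv.
Qed.

Lemma ge0_integral_mrestr d (U : measurableType d) (R : realType)
    (m : {measure set U -> \bar R}) (D : set U) (mD : measurable D)
    (f : U -> \bar R) :
  measurable_fun setT f -> (forall x, 0 <= f x)%E ->
  (\int[mrestr m mD]_x f x = \int[m]_(x in D) f x)%E.
Proof.
move=> mf f0; rewrite -(setUv D) ge0_integral_setU //=; last 3 first.
- exact: measurableC.
- exact: measurable_funS mf.
- exact/disj_setPCl.
rewrite [X in (_ + X)%E]null_set_integral //; last 3 first.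
- exact: measurableC.
- exact: measurable_funS mf.
- by rewrite /= /mrestr setICl measure0.
rewrite adde0; apply: eq_measure_integral => A mA AD.
by rewrite /= /mrestr setIidl.
Qed.

Section GraphMeasure.
Context {R : realType} {G : metricGraph R} (mu : vertex G -> R).
Hypothesis mu_ge0 : forall x, 0 <= mu x.
Variable (x0 : vertex G).
Local Notation V := (vertex G).
Local Notation E := (edge G).
Local Notation T := (gspace x0).
Local Notation leb := (@lebesgue_measure R).

Definition vtx_mass (k : nat) : {measure set T -> \bar R} :=
  if @pickle_inv V k is Some x then mscale (NngNum (mu_ge0 x)) (\d_ (Vtx x : T))
  else mzero.

Definition arc_length (e : E) : set T -> \bar R :=
  pushforward (mrestr leb (measurable_itv `]0, len e[)) (edge_pt e : R -> T).

HB.instance Definition _ (e : E) := Measure.copy (arc_length e)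
  (measure_function_pushforward__canonical__measure_function_Measure
     (mrestr leb (measurable_itv `]0, len e[)) (@measurable_edge_pt _ _ x0 e)).

Definition edge_length (k : nat) : {measure set T -> \bar R} :=
  if @pickle_inv E k is Some e then arc_length e else mzero.

(** The measure of the graph: a mass [mu x] at every vertex and the Lebesgue
    measure on every open edge. *)
Definition gmeasure : set T -> \bar R :=
  measure_add (mseries vtx_mass 0) (mseries edge_length 0).

HB.instance Definition _ := Measure.copy gmeasure
  (measure_add (mseries vtx_mass 0) (mseries edge_length 0)).

Local Open Scope ereal_scope.

Lemma ge0_integral_gmeasure (f : T -> \bar R) :
  measurable_fun setT f -> (forall p, 0 <= f p) ->
  \int[gmeasure]_p f p = \esum_(x in [set: V]) ((mu x)%:E * f (Vtx x))
    + \esum_(e in [set: E]) \int[leb]_(s in `]0%R, len e[) f (edge_pt e s).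
Proof.
move=> mf f0; rewrite ge0_integral_measure_add // !ge0_integral_measure_series //.
congr (_ + _).
  rewrite -nneseries_pickle; last by move=> x; rewrite mule_ge0 // lee_fin.
  apply: eq_eseriesr => k _; rewrite /vtx_mass; case: pickle_inv => [x|] /=.
    rewrite ge0_integral_mscale //= integral_dirac //= diracT mul1e //.
  by rewrite integral_measure_zero.
rewrite -nneseries_pickle; last by move=> e; exact: integral_ge0.
apply: eq_eseriesr => k _; rewrite /edge_length; case: pickle_inv => [e|] /=.
  rewrite ge0_integral_pushforward //=.
    rewrite preimage_setT ge0_integral_mrestr //.
    exact: measurableT_comp mf (@measurable_edge_pt _ _ x0 e).
  exact: measurable_edge_pt.
by rewrite integral_measure_zero.
Qed.

(** The cells have finite measure: a vertex has mass [mu x], an edge its length.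
    *)
Lemma gmeasure_sigma_finite : sigma_finite setT gmeasure.
Proof.
exists (@cell _ _ x0) => [|k]; first by rewrite bigcup_cell.
split; first exact: measurable_cell.
rewrite -[@cell _ _ x0 k]setIT -integral_indic //; last exact: measurable_cell.
rewrite ge0_integral_gmeasure; last 2 first.
- by apply/measurable_EFinP; apply: measurable_indic; exact: measurable_cell.
- by move=> p; rewrite lee_fin.
rewrite /cell; case: unpickle => [[x|e]|] /=.
- rewrite [X in _ + X]esum1 ?adde0; last first.
    move=> e _; apply: integral0_eq => s /=; rewrite in_itv /= => se.
    by rewrite edge_pt_inn indicE memNset.
  rewrite (esumID [set x]) ?setTI; last first.
    by move=> y _; rewrite mule_ge0 // lee_fin.
  rewrite esum_set1 ?mule_ge0 ?lee_fin // esum1; last first.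
    by move=> y /= yx; rewrite indicE memNset ?mule0 //= => -[].
  by rewrite adde0 indicE mem_set //= mule1 ltry.
- rewrite [X in X + _]esum1 ?add0e; last first.
    by move=> x _; rewrite indicE memNset ?mule0.
  rewrite (esumID [set e]) ?setTI; last by move=> *; exact: integral_ge0.
  rewrite esum_set1; last exact: integral_ge0.
  rewrite esum1 ?adde0; last first.
    move=> e' /= e'e; apply: integral0_eq => s /=; rewrite in_itv /= => se.
    by rewrite indicE memNset //= in_edge_pt => -[].
  apply: (@le_lt_trans _ _ (\int[leb]_(s in `]0%R, len e[) 1)).
    apply: ge0_le_integral => //.
      apply/measurable_EFinP/measurable_funTS.
      apply: (measurableT_comp _ (@measurable_edge_pt _ _ x0 e)).
      by apply: measurable_indic; exact: measurable_in_edge.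
    by move=> s _; rewrite lee_fin indicE lern1; case: (_ \in _).
  by rewrite integral_cst //= mul1e lebesgue_measure_itv /= lte_fin len_gt0 ltry.
- by rewrite !esum1 ?adde0 // => i _; rewrite ?indicE ?in_set0 ?mule0 //;
    apply: integral0_eq => s _; rewrite indicE in_set0.
Qed.

HB.instance Definition _ := @Measure_isSigmaFinite.Build _ T R gmeasure
  gmeasure_sigma_finite.

End GraphMeasure.
Arguments gmeasure {R G mu} mu_ge0 x0.

Section SpaceTime.
Context {R : realType} {G : metricGraph R} (x0 : vertex G).
Local Notation V := (vertex G).
Local Notation E := (edge G).
Local Notation T := (gspace x0).

(** On a single vertex every function is measurable, and on an open edge the
    function is recovered from its chart through [vtx_coord]. *)
Lemma gmeasurable_fun (f : gpoint G -> R) :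
  (forall e : E, measurable_fun `]0, len e[ (on_edge f e)) ->
  measurable_fun [set: T] (f : T -> R).
Proof.
move=> mf; rewrite -bigcup_cell; apply/measurable_fun_bigcup => [|k].
  exact: measurable_cell.
rewrite /cell; case: unpickle => [[x|e]|]; first exact: measurable_fun_set1.
- suff: measurable_fun (in_edge e : set T) (on_edge f e \o @vtx_coord _ _ x0 : T -> R).
    apply: eq_measurable_fun => p; rewrite inE => pe.
    by rewrite -[in RHS](edge_ptK pe).
  apply: (@measurable_comp _ _ _ _ _ _ `]0, len e[) => //.
    by move=> _ [[x []|e' s se] /= <- <-]; rewrite in_itv.
  exact: measurable_funS (@measurable_vtx_coord _ _ x0).
- exact: measurable_fun_set0.
Qed.

Lemma st_measurable_fun (f : gpoint G -> R -> R) : st_measurable f ->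
  measurable_fun ([set: T] `*` `[(0 : R), +oo[)
    (fun z : T * measurableTypeR R => f z.1 z.2).
Proof.
move=> [mfV mfE]; rewrite -bigcup_cell setX_bigcupl.
apply/measurable_fun_bigcup => [k|k].
  by apply: measurableX; [exact: measurable_cell|exact: measurable_itv].
rewrite /cell; case: unpickle => [[x|e]|].
- apply: (eq_measurable_fun (fun z : T * measurableTypeR R => f (Vtx x) z.2)).
    by move=> [p t]; rewrite inE => -[/= -> _].
  apply: (@measurable_comp _ _ _ _ _ _ `[(0 : R), +oo[) => //.
    by move=> _ [[p t] [/= _ t0] <-].
  exact: measurable_funTS measurable_snd.
- apply: (eq_measurable_fun
    ((fun z : measurableTypeR R * measurableTypeR R => f (edge_pt e z.1) z.2)
      \o (fun z : T * measurableTypeR R => (vtx_coord z.1, z.2)))) => [[p t]|].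
    by rewrite inE => -[/= /edge_ptK {2}<- _].
  apply: (@measurable_comp _ _ _ _ _ _ (`]0, len e[ `*` `[(0 : R), +oo[)) => //.
  + exact: measurableX.
  + by move=> _ [[[x|e' s se] t] [//= <- t0] <-]; split; rewrite //= in_itv.
  + apply: measurable_funTS; apply: measurable_fun_pair => /=.
      exact: measurableT_comp (@measurable_vtx_coord _ _ x0) measurable_fst.
    exact: measurable_snd.
- by rewrite set0X; exact: measurable_fun_set0.
Qed.

Context (mu : vertex G -> R) (mu_ge0 : forall x, 0 <= mu x).
Local Notation leb := (@lebesgue_measure R).
Local Notation mG := (gmeasure mu_ge0 x0).

Lemma gint_nnegE (f : gpoint G -> R) :
  measurable_fun [set: T] (f : T -> R) -> (forall p, 0 <= f p) ->
  gint_nneg mu f = (\int[mG]_p (f p)%:E)%E.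
Proof.
by move=> mf f0; rewrite ge0_integral_gmeasure //; exact/measurable_EFinP.
Qed.

Definition stmeasure := (mG \x leb)%E.

HB.instance Definition _ := Measure.on stmeasure.

Section Tonelli.
Variables (I : set R) (f : gpoint G -> R -> R).
Hypotheses (mI : measurable I)
  (mf : measurable_fun ([set: T] `*` I) (fun z : T * measurableTypeR R => f z.1 z.2))
  (f0 : forall p t, I t -> 0 <= f p t).

Let F := (EFin \o (fun z : T * measurableTypeR R => f z.1 z.2)) \_ ([set: T] `*` I).

Let mF : measurable_fun setT F.
Proof.
apply/(measurable_restrictT _ (measurableX measurableT mI)).
exact/measurable_EFinP.
Qed.

Let F0 z : (0 <= F z)%E.
Proof.
rewrite /F /patch; case: ifPn => //; rewrite inE => -[_ /= zI].
by rewrite lee_fin; exact: f0.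
Qed.

Let slice t : I t -> fubini_G mG F t = gint_nneg mu (f^~ t).
Proof.
move=> It; rewrite /fubini_G gint_nnegE; last 2 first.
- have /= mFt := measurableT_comp mF (measurable_pair2 t).
  apply/measurable_EFinP; apply: eq_measurable_fun mFt => p _.
  by rewrite /F /patch /= mem_set.
- by move=> p; exact: f0.
by apply: eq_integral => p _; rewrite /F /patch mem_set.
Qed.

Lemma measurable_gint_nneg : measurable_fun I (fun t => gint_nneg mu (f^~ t)).
Proof.
have := measurable_funTS (D := I) (@measurable_fun_fubini_tonelli_G _ _ _ _ R mG F mF F0).
by apply: eq_measurable_fun => t; rewrite inE; exact: slice.
Qed.

Lemma tonelli_graph :
  (\int[leb]_(t in I) gint_nneg mu (f^~ t) =
   \int[stmeasure]_(z in [set: T] `*` I) (f z.1 z.2)%:E)%E.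
Proof.
transitivity (\int[(mG \x leb)%E]_z F z)%E; last by rewrite [RHS]integral_mkcond.
have -> := @fubini_tonelli2 _ _ _ _ R mG leb F mF F0; rewrite integral_mkcond.
apply: eq_integral => t _; rewrite /patch.
case: ifPn => [|/negP]; rewrite inE => It; first exact/esym/slice.
rewrite /fubini_G integral0_eq // => p _; rewrite /F /patch memNset // => -[_].
exact: It.
Qed.

End Tonelli.

End SpaceTime.
Arguments stmeasure {R G} x0 {mu} mu_ge0.

(** * Calculus on one edge and in time *)

Section OneVariable.
Context {R : realType}.
Implicit Types (f W w : R -> R) (A : set R) (s t a b l : R).
Local Notation leb := (@lebesgue_measure R).

Lemma cvg_diffquot f s l :
  is_derive s 1 f l -> diffquot f s y @[y --> s^'] --> l.
Proof.
move=> df; have [cf <-] := df; rewrite /derive.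
have sub : (fun y => y - s) @ s^' --> (0 : R)^'.
  move=> A [e /= e0 hA]; exists e => //= y ye ys; apply: hA => /=.
    by rewrite /ball_ /= sub0r normrN distrC.
  by rewrite subr_eq0.
have := cvg_comp _ _ sub cf; apply: cvg_trans; apply: near_eq_cvg.
near=> y; rewrite /= /diffquot mulrC; congr (_ * _).
by rewrite [X in f X]addrC [_%:A]mulr1 addrC subrK.
Unshelve. all: by end_near. Qed.

(** Relative derivatives at an end of an interval are limits along a filter,
    which determine their value only if the filter is proper. *)
Lemma proper_within_right A s (d : R) : 0 < d ->
  (forall y, s < y < s + d -> A y) -> ProperFilter (within A s^').
Proof.
move=> d0 hA; apply: Build_ProperFilter_ex => B [e /= e0 hB].
pose y := s + Num.min d e / 2; have m0 : 0 < Num.min d e by rewrite lt_min d0.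
have sy : s < y by rewrite ltrDl divr_gt0.
have mlt : Num.min d e / 2 < Num.min d e by rewrite gtr_pMr // invf_lt1 ?ltr1n.
exists y; apply: hB => /=.
- rewrite /ball_ /= distrC /y addrC addKr gtr0_norm ?divr_gt0 //.
  by rewrite (lt_le_trans mlt) // ge_min lexx orbT.
- by rewrite gt_eqF.
- by apply: hA; rewrite sy ltrD2l (lt_le_trans mlt) // ge_min lexx.
Qed.

Lemma derive_in_derive A f s l : ProperFilter (within A s^') ->
  is_derive s 1 f l ->
  cvg (diffquot f s y @[y --> within A s^']) /\ derive_in A f s = l.
Proof.
move=> pA /cvg_diffquot df.
have h : diffquot f s y @[y --> within A s^'] --> l.
  by apply: cvg_trans df; apply: cvg_app; exact: cvg_within.
by split; [apply/cvg_ex; exists l|exact/cvg_lim].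
Qed.

(** A function that is differentiable on the whole line has its usual derivative
    as relative derivative on any set without isolated points. *)
Lemma C1_in_derive A f (df : R -> R) :
  (forall s, A s -> ProperFilter (within A s^')) ->
  (forall s, is_derive s 1 f (df s)) -> continuous df ->
  C1_in A f /\ (forall s, A s -> derive_in A f s = df s).
Proof.
move=> pA fdf cdf.
have h s : A s -> cvg (diffquot f s y @[y --> within A s^']) /\
                  derive_in A f s = df s.
  by move=> /pA As; exact: derive_in_derive.
split; last by move=> s /h[].
split=> [s /h[]//|].
have e : {in A, df =1 derive_in A f} by move=> s; rewrite inE => /h[_ ->].
by apply: (subspace_eq_continuous e); exact: continuous_subspaceT.
Qed.

(** The fundamental theorem for a function that is differentiable in the open
    interval only, with an integrable derivative: the difference of [W] and the
    indefinite integral of [w] has zero derivative inside and is continuous up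
    to the ends, so the mean value theorem applies. *)
Lemma FTC2_open W w a b : a < b -> {within `[a, b], continuous W} ->
  (forall s, a < s < b -> is_derive s 1 W (w s)) ->
  (forall s, a < s < b -> {for s, continuous w}) ->
  leb.-integrable `]a, b[ (EFin \o w) ->
  (\int[leb]_(s in `]a, b[) w s)%R = W b - W a.
Proof.
move=> ab cW dW cw iw; pose w' := w \_ `]a, b[.
have iw' : leb.-integrable setT (EFin \o w').
  have /integrable_mkcond := iw; rewrite restrict_EFin; apply.
  exact: measurable_itv.
have ic : leb.-integrable `[a, b] (EFin \o w').
  exact: integrableS iw'.
pose F x := (\int[leb]_(t in `[a, x]) w' t)%R.
have cF : {within `[a, b], continuous F} by apply: parameterized_integral_continuous => //; exact: ltW.
have near_ab s : a < s < b -> \forall y \near s, a < y < b.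
  by move=> sab; have := @near_in_itvoo _ a b s; rewrite in_itv/=; apply.
have ww' s : a < s < b -> \forall y \near s, w y = w' y.
  move=> /near_ab; apply: filterS => y yab.
  by rewrite /w' patchE mem_set //= in_itv.
have dF s : s \in `]a, b[ -> is_derive s 1 (W \- F) 0.
  rewrite in_itv /= => sab; have [as_ sb] := andP sab.
  have cw' : {for s, continuous w'}.
    have e := nbhs_singleton (ww' _ sab).
    suff : w' y @[y --> s] --> w s by rewrite e.
    by apply: cvg_trans (cw _ sab); apply: near_eq_cvg; exact: ww'.
  have [dFs Fs] := continuous_FTC1 sb ic as_ cw'.
  have hF : is_derive s 1 F (w s).
    apply: DeriveDef; first exact: dFs.
    by rewrite -derive1E Fs (nbhs_singleton (ww' _ sab)).
  rewrite -(subrr (w s)).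
  exact: is_deriveB (dW _ sab) hF.
have cWF : {within `[a, b], continuous (W \- F)}.
  exact: within_continuousB.
have [c _] := MVT ab dF cWF; rewrite mul0r /= => /eqP; rewrite subr_eq0 => /eqP h.
have Fa : F a = 0 by rewrite /F set_itv1 Rintegral_set1.
have Fb : F b = (\int[leb]_(s in `]a, b[) w s)%R.
  rewrite /F /Rintegral; congr fine.
  rewrite integral_itv_bndoo; last first.
    apply: measurable_funS (measurable_int _ iw') => //.
  by apply: eq_integral => s; rewrite inE /w' => /= sab; rewrite patchE mem_set.
by rewrite -Fb; move: h; rewrite Fa; lra.
Qed.

Lemma bounded_integrable (g : R -> R) a b (M : R) :
  measurable_fun `]a, b[ g ->
  {ae leb, forall s, s \in `]a, b[ -> `|g s| <= M} ->
  leb.-integrable `]a, b[ (EFin \o g).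
Proof.
move=> mg gM; apply/integrableP; split; first exact/measurable_EFinP.
have h := @integral_le_bound _ _ R leb `]a, b[ (EFin \o g) `|M|%:E
  (measurable_itv _).
apply: le_lt_trans (h _ _ _) _.
- exact/measurable_EFinP.
- by rewrite lee_fin.
- have F := ae_filter_ringOfSetsType leb.
  apply: filterS gM => s gs /= sab; rewrite lee_fin (le_trans (gs _)) //.
  exact: ler_norm.
- rewrite /= lebesgue_measure_itv /=.
  by case: ifP => _; rewrite ?mule0 // -EFinD -EFinM ltry.
Qed.

Lemma continuous_open_measurable (g : R -> R) a b :
  (forall s, a < s < b -> {for s, continuous g}) -> measurable_fun `]a, b[ g.
Proof.
move=> cg; apply: open_continuous_measurable_fun; first exact: interval_open.
by move=> s; rewrite inE /= in_itv /=; exact: cg.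
Qed.

End OneVariable.

Section Smoothstep.
Context {R : realType}.
Implicit Types (l a b s : R).

(** The cubic that joins [a] to [b] with horizontal tangents at both ends. Zero
    slopes make the boundary terms of Green's formula consist of derivatives of
    the other function alone, so that its Kirchhoff condition disposes of them.
    *)
Definition smoothstep l a b s : R :=
  a + (b - a) * (3 * (s / l) ^+ 2 - 2 * (s / l) ^+ 3).
Definition dsmoothstep l a b s : R := (b - a) * (6 * (s / l) * (1 - s / l)) / l.
Definition d2smoothstep l a b s : R := (b - a) * (6 - 12 * (s / l)) / l ^+ 2.

Lemma smoothstep0 l a b : smoothstep l a b 0 = a.
Proof. by rewrite /smoothstep; ring. Qed.

Lemma smoothstep1 l a b : 0 < l -> smoothstep l a b l = b.
Proof. by move=> l0; rewrite /smoothstep divff ?gt_eqF //; ring. Qed.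

Lemma dsmoothstep0 l a b : dsmoothstep l a b 0 = 0.
Proof. by rewrite /dsmoothstep; ring. Qed.

Lemma dsmoothstep1 l a b : 0 < l -> dsmoothstep l a b l = 0.
Proof. by move=> l0; rewrite /dsmoothstep divff ?gt_eqF //; ring. Qed.

Lemma is_derive_smoothstep l a b s : 0 < l ->
  is_derive s 1 (smoothstep l a b) (dsmoothstep l a b s).
Proof.
move=> l0; rewrite /smoothstep /dsmoothstep.
apply: is_derive_eq; rewrite /GRing.scale /=; field; exact: lt0r_neq0.
Qed.

Lemma is_derive_dsmoothstep l a b s : 0 < l ->
  is_derive s 1 (dsmoothstep l a b) (d2smoothstep l a b s).
Proof.
move=> l0; rewrite /dsmoothstep /d2smoothstep.
apply: is_derive_eq; rewrite /GRing.scale /=; field; exact: lt0r_neq0.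
Qed.

(** The cubic is a convex combination of its end values. *)
Lemma smoothstep_weight l s : 0 <= s <= l -> 0 < l ->
  0 <= 3 * (s / l) ^+ 2 - 2 * (s / l) ^+ 3 <= 1.
Proof.
move=> /andP[s0 sl] l0.
have x0 : 0 <= s / l by rewrite divr_ge0 // ltW.
have x1 : s / l <= 1 by rewrite ler_pdivrMr // mul1r.
move: (s / l) x0 x1 => x x0 x1.
apply/andP; split.
  rewrite (_ : _ - _ = x ^+ 2 * (3 - 2 * x)); last by ring.
  by rewrite mulr_ge0 ?sqr_ge0 //; lra.
rewrite -subr_ge0 (_ : _ - _ = (1 - x) ^+ 2 * (1 + 2 * x)); last by ring.
by rewrite mulr_ge0 ?sqr_ge0 //; lra.
Qed.

Lemma smoothstep_ge l a b s m : 0 <= s <= l -> 0 < l -> m <= a -> m <= b ->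
  m <= smoothstep l a b s.
Proof.
move=> sl l0 ma mb; have /andP[] := smoothstep_weight sl l0.
by rewrite /smoothstep; move: (_ - _ * _ ^+ 3) => q; nra.
Qed.

Lemma smoothstep_le l a b s m : 0 <= s <= l -> 0 < l -> a <= m -> b <= m ->
  smoothstep l a b s <= m.
Proof.
move=> sl l0 ma mb; have /andP[] := smoothstep_weight sl l0.
by rewrite /smoothstep; move: (_ - _ * _ ^+ 3) => q; nra.
Qed.

Lemma d2smoothstep_le l a b s : 0 <= s <= l -> 0 < l ->
  `|d2smoothstep l a b s| <= 6 / l ^+ 2 * `|b - a|.
Proof.
move=> /andP[s0 sl] l0.
have x0 : 0 <= s / l by rewrite divr_ge0 // ltW.
have x1 : s / l <= 1 by rewrite ler_pdivrMr // mul1r.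
rewrite /d2smoothstep !normrM [`|_^-1|]gtr0_norm ?invr_gt0 ?exprn_gt0 //.
rewrite (_ : 6 / _ * _ = `|b - a| * 6 / l ^+ 2); last by ring.
rewrite ler_pM2r ?invr_gt0 ?exprn_gt0 // ler_wpM2l //.
by rewrite ler_norml; lra.
Qed.

Lemma continuous_smoothstep l a b : 0 < l -> continuous (smoothstep l a b).
Proof.
move=> l0 s; apply: differentiable_continuous.
by apply/derivable1_diffP; have [] := is_derive_smoothstep a b s l0.
Qed.

Lemma continuous_dsmoothstep l a b : 0 < l -> continuous (dsmoothstep l a b).
Proof.
move=> l0 s; apply: differentiable_continuous.
by apply/derivable1_diffP; have [] := is_derive_dsmoothstep a b s l0.
Qed.

Lemma continuous_d2smoothstep l a b : continuous (d2smoothstep l a b).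
Proof.
move=> s; apply: cvgM; last exact: cvg_cst.
apply: cvgM; first exact: cvg_cst.
apply: cvgB; first exact: cvg_cst.
by apply: cvgM; [exact: cvg_cst|apply: cvgM; [exact: cvg_id|exact: cvg_cst]].
Qed.

End Smoothstep.

(** * Integration by parts on one edge *)

Section GreenEdge.
Context {R : realType}.
Local Notation leb := (@lebesgue_measure R).
Implicit Types (f : R -> R) (l a b s : R).

Lemma derive_in_interior f l s : C2_open `]0, l[ f -> 0 < s < l ->
  is_derive s 1 f (derive_in `[0, l] f s).
Proof.
move=> f2 sl; have /andP[s0 sl'] := sl.
have [|dfs _ _] := f2 s; first by rewrite /= in_itv.
have pA : ProperFilter (within `[0, l] s^').
  apply: (@proper_within_right _ _ s (l - s)); first by rewrite subr_gt0.
  by move=> y; rewrite /= in_itv /=; lra.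
have df := derivableP dfs.
by have [_ ->] := derive_in_derive pA df.
Qed.

(** Near an interior point the relative derivative is the ordinary one, so it
    can be differentiated once more. *)
Lemma derive_in_interior2 f l s : C2_open `]0, l[ f -> 0 < s < l ->
  is_derive s 1 (derive_in `[0, l] f) ((f^`(2))%classic s).
Proof.
move=> f2 sl.
have [|_ d2fs _] := f2 s; first by rewrite /= in_itv.
have nr : \forall y \near s, (f^`())%classic y = derive_in `[0, l] f y.
  have : \forall y \near s, 0 < y < l.
    by have := @near_in_itvoo _ 0 l s; rewrite in_itv/=; apply.
  apply: filterS => y /(derive_in_interior f2) dfy.
  by rewrite derive1E derive_val.
apply: DeriveDef.
  exact: near_eq_derivable nr d2fs.
by rewrite -(near_eq_derive _ nr) -derive1E.
Qed.

(** [W = eta f' - eta' f], with [eta] the cubic, is a primitive of [eta f'' - f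
    eta''], and [eta'] vanishes at both ends. *)
Lemma green_edge f l a b : 0 < l ->
  {within `[0, l], continuous f} -> C2_open `]0, l[ f -> C1_in `[0, l] f ->
  (exists M, {ae leb, forall s,
     s \in `]0, l[ -> `|(f^`(2))%classic s| <= M}) ->
  [/\ leb.-integrable `]0, l[
        (fun s => (smoothstep l a b s * (f^`(2))%classic s)%:E),
      leb.-integrable `]0, l[ (fun s => (f s * d2smoothstep l a b s)%:E) &
      (\int[leb]_(s in `]0, l[) (smoothstep l a b s * (f^`(2))%classic s) =
       b * derive_in `[0, l] f l - a * derive_in `[0, l] f 0 +
       \int[leb]_(s in `]0, l[) (f s * d2smoothstep l a b s))%R].
Proof.
move=> l0 cf f2 [_ cdf] [M hM].
have mf2 : measurable_fun `]0, l[ (f^`(2))%classic.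
  apply: continuous_open_measurable => s sl.
  by have [] := f2 s; rewrite /= ?in_itv.
have cont_meas (g : R -> R) : continuous g -> measurable_fun `]0, l[ g.
  by move=> cg; apply: continuous_open_measurable => s _; exact: cg.
have i1 : leb.-integrable `]0, l[
    (EFin \o (fun s => smoothstep l a b s * (f^`(2))%classic s)).
  apply: (@bounded_integrable _ _ _ _ ((`|a| + `|b|) * `|M|)).
    by apply: measurable_funM => //; apply: cont_meas; exact: continuous_smoothstep.
  have F := ae_filter_ringOfSetsType leb.
  apply: filterS hM => s h sl; rewrite normrM ler_pM //.
    have sl' : 0 <= s <= l by move: sl; rewrite in_itv /=; lra.
    rewrite ler_norml; apply/andP; split.
      apply: smoothstep_ge => //; have := ler_norm (- a); have := ler_norm (- b);
      by rewrite !normrN; have := normr_ge0 a; have := normr_ge0 b; lra.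
    apply: smoothstep_le => //; have := ler_norm (a); have := ler_norm (b);
      by have := normr_ge0 a; have := normr_ge0 b; lra.
  exact: le_trans (h sl) (ler_norm _).
have i2 : leb.-integrable `]0, l[
    (EFin \o (fun s => f s * d2smoothstep l a b s)).
  suff : leb.-integrable `[0, l] (EFin \o (fun s => f s * d2smoothstep l a b s)).
    by apply: integrableS => // s; rewrite /= !in_itv /=; lra.
  apply: continuous_compact_integrable; first exact: segment_compact.
  move=> s; apply: (@continuousM _ (subspace `[0, l])); first exact: cf.
  by apply: (continuous_subspaceT (@continuous_d2smoothstep _ l a b)).
split => //.
pose W s := smoothstep l a b s * derive_in `[0, l] f s - dsmoothstep l a b s * f s.
pose w s := smoothstep l a b s * (f^`(2))%classic s - f s * d2smoothstep l a b s.
have iw : leb.-integrable `]0, l[ (EFin \o w).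
  by have := @integrableB _ _ R leb `]0, l[ (measurable_itv _) _ _ i1 i2.
have cW : {within `[0, l], continuous W}.
  apply: within_continuousB => s.
    apply: (@continuousM _ (subspace `[0, l])); last exact: cdf.
    by apply: (continuous_subspaceT (@continuous_smoothstep _ l a b l0)).
  apply: (@continuousM _ (subspace `[0, l])); last exact: cf.
  by apply: (continuous_subspaceT (@continuous_dsmoothstep _ l a b l0)).
have dW s : 0 < s < l -> is_derive s 1 W (w s).
  move=> sl; have h1 := is_derive_smoothstep a b s l0.
  have h2 := is_derive_dsmoothstep a b s l0.
  have h3 := derive_in_interior f2 sl.
  have h4 := derive_in_interior2 f2 sl.
  have h5 := is_deriveB (is_deriveM h1 h4) (is_deriveM h2 h3).
  apply: is_derive_eq h5 _; rewrite /w; move: ((f^`(2))%classic s) => d2.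
  by rewrite /GRing.scale /=; ring.
have cw s : 0 < s < l -> {for s, continuous w}.
  move=> sl; apply: cvgB; apply: cvgM.
  - exact: continuous_smoothstep.
  - by have [|_ _] := f2 s; rewrite /= ?in_itv.
  - have /andP[s0 sl'] := sl.
    have [|d _ _] := f2 s; first by rewrite /= in_itv.
    by apply: differentiable_continuous; apply/derivable1_diffP.
  - exact: continuous_d2smoothstep.
have := FTC2_open l0 cW dW cw iw.
rewrite RintegralB // /W smoothstep0 smoothstep1 // dsmoothstep0 dsmoothstep1 //.
lra.
Qed.

End GreenEdge.

(** * The temporal cutoff *)

Section SquaredPositivePart.
Context {R : realType}.
Implicit Types x y : R.

(** Squaring the positive part makes it differentiable everywhere. *)
Definition sqpos x : R := (Num.max 0 x) ^+ 2.

(** The second order bound that gives the derivative without distinguishing the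
    sign of [x]. *)
Lemma sqpos_taylor x y : `|sqpos y - sqpos x - 2 * Num.max 0 x * (y - x)| <= (y - x) ^+ 2.
Proof.
rewrite /sqpos ler_norml; case: (leP 0 x) => x0; case: (leP 0 y) => y0.
- rewrite (_ : _ - _ - _ = (y - x) ^+ 2); last by ring.
  by rewrite lexx andbT (@le_trans _ _ 0) ?oppr_le0 ?sqr_ge0.
- have p1 := mulr_ge0 x0 x0; have p2 := mulr_ge0 x0 (ltW (_ : 0 < - y)).
  have {}p2 : 0 <= x * - y by apply: p2; rewrite oppr_gt0.
  by have p3 := sqr_ge0 y; have p4 := sqr_ge0 (y - x); apply/andP; split; nra.
- have p1 : 0 <= y * (- x) by rewrite mulr_ge0 // oppr_ge0 ltW.
  by have p3 := sqr_ge0 y; have p4 := sqr_ge0 x; apply/andP; split; nra.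
- by have p4 := sqr_ge0 (y - x); apply/andP; split; nra.
Qed.

Lemma is_derive_sqpos x : is_derive x 1 sqpos (2 * Num.max 0 x).
Proof.
have h : h^-1 *: (sqpos (h *: 1 + x) - sqpos x) @[h --> (0 : R)^'] -->
   2 * Num.max 0 x.
  apply/cvgrPdist_le => e e0; near=> h.
  have h0 : h != 0 by near: h; exact: nbhs_dnbhs_neq.
  have he : `|h| <= e by near: h; exact: dnbhs0_le.
  have := sqpos_taylor x (h + x); rewrite addrK => T.
  rewrite [h *: 1]mulr1 distrC.
  rewrite -(ler_pM2l (_ : 0 < `|h|)) ?normr_gt0 // -normrM mulrBr.
  rewrite [_ *: _]mulrC [h * (_ / _)]mulrC divfK // mulrC.
  by apply: (le_trans T); rewrite -real_normK ?num_real // expr2 ler_pM2l ?normr_gt0.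
apply: DeriveDef; first by apply/cvg_ex; exists (2 * Num.max 0 x).
exact/cvg_lim.
Unshelve. all: by end_near. Qed.

End SquaredPositivePart.

Section TimeCutoff.
Context {R : realType}.
Implicit Types (t r : R) (k : nat).

(** Equal to 1 on [0, r] and to 0 beyond 2 r. Its powers with exponent at least
    2 are continuously differentiable. *)
Definition tbase r t : R := Num.max 0 (1 - sqpos (t / r - 1)).
(** The exponent is even so that the power is also one of [sqpos], and large so
    that the derivative is controlled by a power of [tcut] close to 1. *)
Definition tcut r k t : R := (tbase r t) ^+ (2 * k.+1).
Definition dtcut r k t : R :=
  - (4 * k.+1%:R / r) * tbase r t ^+ (2 * k).+1 * Num.max 0 (t / r - 1).

Lemma tcutE r k : tcut r k = (fun t => sqpos (1 - sqpos (t / r - 1)) ^+ k.+1).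
Proof. by apply/funext => t; rewrite /tcut exprM. Qed.

Lemma is_derive_tcut r k t : is_derive t 1 (tcut r k) (dtcut r k t).
Proof.
have d1 : is_derive t 1 (fun t => t / r - 1) (r^-1).
  by apply: is_derive_eq; rewrite /GRing.scale /=; ring.
have d2 := @is_derive1_comp _ sqpos _ t _ _ (is_derive_sqpos (t / r - 1)) d1.
have d3 := is_deriveB (is_derive_cst (1 : R) t 1) d2.
have d4 := @is_derive1_comp _ sqpos _ t _ _ (is_derive_sqpos _) d3.
have d5 := is_deriveX k.+1 d4.
have -> : tcut r k = (sqpos \o (cst 1 - (sqpos \o (fun t => t / r - 1)))) ^+ k.+1.
  by rewrite tcutE; apply/funext => x; rewrite exprfctE.
apply: is_derive_eq d5 _.
rewrite /GRing.scale /= /dtcut /tbase.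
rewrite (_ : (cst 1 - _) t = 1 - sqpos (t / r - 1)) //.
rewrite {1}/sqpos -exprM exprS; ring.
Qed.

Lemma continuous_tcut r k : continuous (tcut r k).
Proof.
move=> t; apply: differentiable_continuous.
by apply/derivable1_diffP; have [] := is_derive_tcut r k t.
Qed.

Lemma continuous_pos_part (f : R -> R) : continuous f ->
  continuous (fun t => Num.max 0 (f t)).
Proof. by move=> cf t; apply: continuous_max; [exact: cvg_cst|exact: cf]. Qed.

Lemma continuous_dtcut r k : continuous (dtcut r k).
Proof.
have c1 : continuous (fun t : R => Num.max 0 (t / r - 1)).
  apply: continuous_pos_part => t; apply: cvgB; last exact: cvg_cst.
  by apply: cvgM; [exact: cvg_id|exact: cvg_cst].
have c2 : continuous (tbase r).
  apply: continuous_pos_part => t; apply: cvgB; first exact: cvg_cst.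
  by apply: cvgM; exact: c1.
move=> t; apply: cvgM; last exact: c1.
apply: cvgM; first exact: cvg_cst.
have c3 : {for t, continuous ((fun x : R => x ^+ (2 * k).+1) \o tbase r)}.
  by apply: continuous_comp; [exact: c2|exact: exprn_continuous].
exact: c3.
Qed.

Lemma tbase_ge0 r t : 0 <= tbase r t.
Proof. by rewrite /tbase le_max lexx. Qed.

Lemma tbase_le1 r t : tbase r t <= 1.
Proof. by rewrite /tbase ge_max ler01 gerBl sqr_ge0. Qed.

Lemma tcut_ge0 r k t : 0 <= tcut r k t.
Proof. by rewrite exprn_ge0 ?tbase_ge0. Qed.

Lemma tcut_le1 r k t : tcut r k t <= 1.
Proof. by rewrite exprn_ile1 ?tbase_ge0 ?tbase_le1. Qed.

Lemma max0_before r t : 0 < r -> t <= r -> Num.max 0 (t / r - 1) = 0.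
Proof.
by move=> r0 tr; apply/max_idPl; rewrite subr_le0 ler_pdivrMr ?mul1r.
Qed.

Lemma tcut_before r k t : 0 < r -> t <= r -> tcut r k t = 1.
Proof.
move=> r0 tr; rewrite /tcut /tbase /sqpos max0_before // expr0n subr0.
by rewrite (max_idPr ler01) expr1n.
Qed.

Lemma dtcut_before r k t : 0 < r -> t <= r -> dtcut r k t = 0.
Proof. by move=> r0 tr; rewrite /dtcut max0_before ?mulr0. Qed.

Lemma tbase_after r t : 0 < r -> 2 * r <= t -> tbase r t = 0.
Proof.
move=> r0 tr; have h : 1 <= t / r - 1.
  by rewrite lerBrDr ler_pdivlMr // (_ : 1 + 1 = 2).
apply/max_idPl; rewrite subr_le0 /sqpos (max_idPr _) ?(le_trans ler01) //.
by rewrite expr_ge1 // (le_trans ler01).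
Qed.

Lemma tcut_after r k t : 0 < r -> 2 * r <= t -> tcut r k t = 0.
Proof. by move=> r0 tr; rewrite /tcut tbase_after // expr0n. Qed.

Lemma dtcut_after r k t : 0 < r -> 2 * r <= t -> dtcut r k t = 0.
Proof. by move=> r0 tr; rewrite /dtcut tbase_after // expr0n mulr0 mul0r. Qed.

(** Differentiating lowers the exponent of [tbase] by one, from [2 (k + 1)] to
    [2 k + 1]; this costs only a power [p < 1] of [tcut] when [k] is large. *)
Lemma dtcut_le r k (p : R) t : 0 < r -> (2 * k.+1)%:R * p <= (2 * k).+1%:R ->
  `|dtcut r k t| <= 4 * k.+1%:R / r * tcut r k t `^ p.
Proof.
move=> r0 kp; have c0 : 0 <= 4 * k.+1%:R / r by rewrite divr_ge0 ?mulr_ge0 // ltW.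
have [tr|tr] := leP (2 * r) t.
  by rewrite dtcut_after // normr0 mulr_ge0 ?powR_ge0.
have m0 : 0 <= Num.max 0 (t / r - 1) by rewrite le_max lexx.
have m1 : Num.max 0 (t / r - 1) <= 1.
  by rewrite ge_max ler01 /= lerBlDr ler_pdivrMr // (_ : 1 + 1 = 2) // ltW.
have b0 := tbase_ge0 r t.
rewrite /dtcut !mulNr normrN ger0_norm ?mulr_ge0 ?exprn_ge0 ?invr_ge0 ?(ltW r0) //.
rewrite -mulrA ler_wpM2l //.
apply: (@le_trans _ _ (tbase r t ^+ (2 * k).+1)).
  by rewrite ler_piMr // exprn_ge0.
move: b0; rewrite le_eqVlt => /predU1P[<-|b0]; first by rewrite expr0n powR_ge0.
rewrite /tcut -!powR_mulrn ?tbase_ge0 // -powRrM.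
by rewrite ger_powR // b0 tbase_le1.
Qed.

Lemma C1_in_cut (c r : R) k :
  C1_in `[0, +oo[ (fun t => c * tcut r k t) /\
  forall t, 0 <= t -> derive_in `[0, +oo[ (fun t => c * tcut r k t) t = c * dtcut r k t.
Proof.
have [| |t|C1 dE] := @C1_in_derive R `[0, +oo[ (fun t => c * tcut r k t) (fun t => c * dtcut r k t).
- move=> t; rewrite /= in_itv /= andbT => t0.
  apply: (@proper_within_right _ _ t 1) => // y /andP[ty _].
  by rewrite /= in_itv /= andbT (le_trans t0) // ltW.
- by move=> t; have h := is_deriveZ c (is_derive_tcut r k t); exact: h.
- by apply: cvgM; [exact: cvg_cst|exact: continuous_dtcut].
- by split=> // t t0; apply: dE; rewrite /= in_itv /= andbT.
Qed.

End TimeCutoff.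

(** * The path metric *)

Section Metric.
Context {R : realType} {G : metricGraph R}.
Local Notation V := (vertex G).
Local Notation E := (edge G).
Implicit Types (p q z : gpoint G) (r s t L : R).
Hypothesis connected : path_connected_graph G.

Lemma path_length_ge0 p q L : path_of_length p q L -> 0 <= L.
Proof. by elim=> // e s t q' M _ _ _ M0; rewrite addr_ge0. Qed.

Lemma gdistE p q : gedist p q = (gdist p q)%:E.
Proof.
rewrite /gdist fineK //; have [L pL] := connected p q.
rewrite ge0_fin_numE; last first.
  by apply: le_ereal_inf_tmp => _ [M /path_length_ge0 M0 <-]; rewrite lee_fin.
by apply: (@le_lt_trans _ _ L%:E); rewrite ?ltry //; apply: ereal_inf_lbound; exists L.
Qed.

Lemma gdist_le p q L : path_of_length p q L -> gdist p q <= L.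
Proof.
by move=> pL; rewrite -lee_fin -gdistE; apply: ereal_inf_lbound; exists L.
Qed.

Lemma gdistC p q : gdist p q = gdist q p.
Proof.
suff h z z' : gdist z z' <= gdist z' z by apply/eqP; rewrite eq_le !h.
rewrite -lee_fin -[X in (_ <= X)%E]gdistE.
apply: le_ereal_inf_tmp => _ [M /path_sym pM <-].
by rewrite lee_fin gdist_le.
Qed.

Lemma gdist_triangle p q z L : path_of_length p q L -> gdist p z <= L + gdist q z.
Proof.
move=> pL; rewrite -lerBlDl -lee_fin -[X in (_ <= X)%E]gdistE.
apply: le_ereal_inf_tmp => _ [M qM <-]; rewrite lee_fin lerBlDl.
exact: gdist_le (path_cat pL qM).
Qed.

(** The distance to a fixed point is 1-Lipschitz along an edge because a segment
    of the edge is a path. *)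
Lemma gdist_edge (e : E) s t z : 0 <= s <= len e -> 0 <= t <= len e ->
  `|gdist (edge_pt e s) z - gdist (edge_pt e t) z| <= `|s - t|.
Proof.
move=> se te.
have h s' t' : 0 <= s' <= len e -> 0 <= t' <= len e ->
    gdist (edge_pt e s') z <= `|s' - t'| + gdist (edge_pt e t') z.
  move=> se' te'; apply: gdist_triangle; rewrite -[X in path_of_length _ _ X]addr0.
  exact: path_step (path_nil _).
have h1 := h _ _ se te; have h2 := h _ _ te se.
by rewrite ler_norml; move: h2; rewrite distrC; move: h1 => h1 h2; lra.
Qed.

Lemma ball_gdist p q r : ball p r q <-> gdist p q < r.
Proof. by rewrite -lte_fin -gdistE. Qed.

Lemma edge_pt_init (e : E) : edge_pt e 0 = Vtx (init e).
Proof. exact: edge_pt_le0. Qed.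

Lemma edge_pt_term (e : E) : edge_pt e (len e) = Vtx (term e).
Proof. exact: edge_pt_ge_len. Qed.

Lemma gdist_init (e : E) s z : 0 <= s <= len e ->
  `|gdist (edge_pt e s) z - gdist (Vtx (init e)) z| <= len e.
Proof.
move=> se; rewrite -edge_pt_init; apply: le_trans (gdist_edge _ _ _) _ => //.
  by rewrite lexx ltW ?len_gt0.
by case/andP: se => s0 sl; rewrite subr0 ger0_norm.
Qed.

Lemma gdist_term (e : E) s z : 0 <= s <= len e ->
  `|gdist (edge_pt e s) z - gdist (Vtx (term e)) z| <= len e.
Proof.
move=> se; rewrite -edge_pt_term; apply: le_trans (gdist_edge _ _ _) _ => //.
  by rewrite lexx andbT ltW ?len_gt0.
by case/andP: se => s0 sl; rewrite distrC ger0_norm; lra.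
Qed.

Lemma continuous_edge_pt (e : E) : {within `[0, len e], continuous (edge_pt e)}.
Proof.
apply/subspace_continuousP => s; rewrite /= in_itv /= => se.
apply/cvg_ballP => d d0; rewrite !near_withinE; exists d => //= t st.
rewrite in_itv /= => te; apply/gballP; exists (`|s - t| + 0).
  exact: path_step (path_nil _).
by rewrite addr0.
Qed.

Lemma continuous_gdist_edge (e : E) z :
  {within `[0, len e], continuous (fun s => gdist (edge_pt e s) z)}.
Proof.
apply/subspace_continuousP => s; rewrite /= in_itv /= => se.
apply/cvgrPdist_lt => d d0; rewrite !near_withinE; exists d => //= t st.
rewrite in_itv /= => te; apply: le_lt_trans st; exact: gdist_edge.
Qed.

Lemma measurable_gdist (e : E) z :
  measurable_fun `]0, len e[ (on_edge (fun p => gdist p z) e).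
Proof.
apply: continuous_open_measurable => s sl.
have cf : {within `[0, len e], continuous (on_edge (fun p => gdist p z) e)}.
  exact: continuous_gdist_edge.
by apply: (within_continuous_continuous (len_gt0 e) cf); rewrite in_itv.
Qed.

End Metric.

(** * Extension of functions from the vertices to the graph *)

Section EdgeExtension.
Context {R : realType} {G : metricGraph R}.
Local Notation V := (vertex G).
Local Notation E := (edge G).
Implicit Types v : V -> R.

(** A function on the vertices, extended to each edge by the cubic with zero
    slopes. *)
Definition extend v (p : gpoint G) : R :=
  match p with
  | Vtx x => v x
  | @Inn _ _ e s _ => smoothstep (len e) (v (init e)) (v (term e)) s
  end.

(** The Laplacian of [extend v], in closed form. *)
Definition lap_extend mu omega v (p : gpoint G) : R :=
  match p with
  | Vtx x => laplacian_V mu omega v x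
  | @Inn _ _ e s _ => d2smoothstep (len e) (v (init e)) (v (term e)) s
  end.

Lemma on_edge_extend v e s : 0 <= s <= len e ->
  on_edge (extend v) e s = smoothstep (len e) (v (init e)) (v (term e)) s.
Proof.
move=> /andP[s0 sl]; rewrite /on_edge.
have [[s0' ->]|[ls ->]|[se ->]] //= := edge_ptP e s.
  have -> : s = 0 by apply: le_anti; rewrite s0 s0'.
  by rewrite smoothstep0.
have -> : s = len e by apply: le_anti; rewrite sl ls.
by rewrite smoothstep1 ?len_gt0.
Qed.

Lemma extend_ge v m p : (forall x, m <= v x) -> m <= extend v p.
Proof.
move=> mv; case: p => [x|e s /andP[s0 sl]] //=.
by apply: smoothstep_ge; rewrite ?mv ?len_gt0 // (ltW s0) ltW.
Qed.

Lemma extend_le v m p : (forall x, v x <= m) -> extend v p <= m.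
Proof.
move=> mv; case: p => [x|e s /andP[s0 sl]] //=.
by apply: smoothstep_le; rewrite ?mv ?len_gt0 // (ltW s0) ltW.
Qed.

Lemma extendZ v c p : extend (fun x => c * v x) p = c * extend v p.
Proof. by case: p => //= e s _; rewrite /smoothstep; ring. Qed.

Lemma measurable_extend v e : measurable_fun `]0, len e[ (on_edge (extend v) e).
Proof.
apply: (eq_measurable_fun (smoothstep (len e) (v (init e)) (v (term e)))).
  move=> s; rewrite inE /= in_itv /= => /andP[s0 sl].
  by rewrite on_edge_extend // !ltW.
by apply: continuous_open_measurable => s _; apply: continuous_smoothstep;
  exact: len_gt0.
Qed.

Lemma on_edge_lap mu omega v e s : 0 < s < len e ->
  on_edge (lap_extend mu omega v) e s =
  d2smoothstep (len e) (v (init e)) (v (term e)) s.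
Proof. by move=> se; rewrite /on_edge edge_pt_inn. Qed.

Lemma measurable_lap_extend mu omega v e :
  measurable_fun `]0, len e[ (on_edge (lap_extend mu omega v) e).
Proof.
apply: (eq_measurable_fun (d2smoothstep (len e) (v (init e)) (v (term e)))).
  by move=> s; rewrite inE /= in_itv /= => se; rewrite on_edge_lap.
by apply: continuous_open_measurable => s _; exact: continuous_d2smoothstep.
Qed.

End EdgeExtension.

(** * Lower bounds for possibly divergent integrals *)

Section LowerIntegral.
Local Open Scope ereal_scope.
Context d (T : measurableType d) (R : realType) (m : {measure set T -> \bar R}).

(** The integral of a nonnegative function is a supremum over the simple
    functions below it, which is monotone for arbitrary functions. It is used
    for time integrals of [gint], which depend on [t] in an unspecified way. *)
Lemma le_integral_ge0 (D : set T) (f g : T -> \bar R) :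
  (forall x, D x -> 0 <= f x) -> (forall x, D x -> f x <= g x) ->
  \int[m]_(x in D) f x <= \int[m]_(x in D) g x.
Proof.
move=> f0 fg; have g0 x : D x -> 0 <= g x by move=> Dx; rewrite (le_trans (f0 _ Dx)) ?fg.
rewrite !ge0_integralE //; apply: le_ereal_sup => _ [h /= hf <-].
exists h => //= x; apply: le_trans (hf x) _.
rewrite /patch; case: ifPn => //; rewrite inE; exact: fg.
Qed.

(** Whatever the value of the right-hand side, even if it is a difference of two
    infinite integrals, only its negative part matters for a lower bound. *)
Lemma integral_ge_opp (D : set T) (f g : T -> \bar R) :
  (forall x, D x -> 0 <= f x) -> (forall x, D x -> - f x <= g x) ->
  - (\int[m]_(x in D) f x) <= \int[m]_(x in D) g x.
Proof.
move=> f0 fg; rewrite [leRHS]integralE -[leLHS]add0e; apply: leeD.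
  by apply: integral_ge0 => x _; rewrite funeposE le_max lexx orbT.
rewrite leeN2; apply: le_integral_ge0 => x Dx.
  by rewrite funenegE le_max lexx orbT.
by rewrite funenegE ge_max f0 // andbT leeNl fg.
Qed.

End LowerIntegral.

Section LowerGraphIntegral.
Local Open Scope ereal_scope.
Context {R : realType} {G : metricGraph R} (mu : vertex G -> R).
Hypothesis mu_ge0 : forall x, (0 <= mu x)%R.
Implicit Types f g : gpoint G -> R.

Lemma gint_nneg_ge0 f : (forall p, 0 <= f p)%R -> 0 <= gint_nneg mu f.
Proof.
move=> f0; apply: adde_ge0; apply: esum_ge0 => i _.
  by rewrite lee_fin mulr_ge0.
by apply: integral_ge0 => s _; rewrite lee_fin; exact: f0.
Qed.

Lemma le_gint_nneg f g : (forall p, 0 <= f p)%R -> (forall p, f p <= g p)%R ->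
  gint_nneg mu f <= gint_nneg mu g.
Proof.
move=> f0 fg; apply: leeD; apply: le_esum => i _.
  by rewrite lee_fin ler_wpM2l.
by apply: le_integral_ge0 => s _; rewrite lee_fin; [exact: f0|exact: fg].
Qed.

Lemma gint_nneg0 : gint_nneg mu (fun=> 0%R) = 0.
Proof.
rewrite /gint_nneg !esum1 ?adde0 //; last by move=> x _; rewrite mulr0.
by move=> e _; exact: integral0.
Qed.

Lemma gint_ge0E f : (forall p, 0 <= f p)%R -> gint mu f = gint_nneg mu f.
Proof.
move=> f0; have fp : (f^\+)%R = f by apply/funext => p; exact/max_idPl.
have fn : (f^\-)%R = fun=> 0%R.
  by apply/funext => p; apply/max_idPr; rewrite oppr_le0.
by rewrite /gint fp fn gint_nneg0 sube0.
Qed.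

Lemma gint_ge_opp f : - gint_nneg mu (fun p => `|f p|%R) <= gint mu f.
Proof.
rewrite /gint -[leLHS]add0e; apply: leeD; first exact: gint_nneg_ge0.
rewrite leeN2; apply: le_gint_nneg => p; first exact: funrneg_ge0.
by rewrite /funrneg ge_max normr_ge0 andbT -normrN ler_norm.
Qed.

End LowerGraphIntegral.

(** * Green's formula on the graph *)

Section FiniteSums.
Context {R : realType}.

Lemma esum_finite_support (I : choiceType) (S : set I) (a : I -> R) :
  finite_set S -> (forall i, 0 <= a i) -> (forall i, ~ S i -> a i = 0) ->
  (\esum_(i in [set: I]) (a i)%:E = (\sum_(i \in S) a i)%:E)%E.
Proof.
move=> fS a0 aS; rewrite -fsumEFin // -esum_fset //; last first.
  by move=> i _; rewrite lee_fin.
rewrite [RHS]esum_mkcond; apply: eq_esum => i _; case: ifPn => //.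
by move/negP; rewrite inE => /aS ->.
Qed.

End FiniteSums.

Section FiniteIntegral.
Context {R : realType} {G : metricGraph R} (mu : vertex G -> R).
Hypothesis mu_ge0 : forall x, 0 <= mu x.
Local Notation V := (vertex G).
Local Notation E := (edge G).
Local Notation leb := (@lebesgue_measure R).
Variables (SV : set V) (SE : set E).
Hypotheses (fSV : finite_set SV) (fSE : finite_set SE).
Implicit Types f : gpoint G -> R.

Definition supported f := (forall x, ~ SV x -> f (Vtx x) = 0) /\
  (forall e s, ~ SE e -> 0 < s < len e -> on_edge f e s = 0).

Definition edge_integrable f :=
  forall e, leb.-integrable `]0, len e[ (EFin \o on_edge f e).

Definition fin_integral f : R := \sum_(x \in SV) mu x * f (Vtx x) +
  \sum_(e \in SE) (\int[leb]_(s in `]0, len e[) on_edge f e s)%R.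

(** With finitely many vertices and edges carrying [f], the sums over the graph
    are finite sums of real numbers, which are additive without sign conditions.
    *)
Lemma gint_nneg_finite f : supported f -> edge_integrable f ->
  (forall p, 0 <= f p) -> gint_nneg mu f = (fin_integral f)%:E.
Proof.
move=> [fV fE] fi f0; rewrite /gint_nneg.
rewrite (esum_finite_support fSV); last 2 first.
- by move=> x; rewrite mulr_ge0.
- by move=> x /fV ->; rewrite mulr0.
rewrite EFinD; congr (_ + _)%E.
rewrite -(esum_finite_support fSE).
- apply: eq_esum => e _; rewrite /Rintegral fineK //.
  exact: integrable_fin_num (fi e).
- by move=> e; apply: Rintegral_ge0 => s _; exact: f0.
- move=> e fe; rewrite /Rintegral integral0_eq // => s; rewrite /= in_itv /= => se.
  by rewrite fE.
Qed.

Lemma fin_integralD f g : edge_integrable f -> edge_integrable g ->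
  fin_integral (f \+ g) = fin_integral f + fin_integral g.
Proof.
move=> fi gi; rewrite /fin_integral addrACA; congr (_ + _).
  by rewrite -fsbig_split //=; apply: eq_fsbigr => x _; rewrite mulrDr.
rewrite -fsbig_split //=; apply: eq_fsbigr => e _.
by rewrite -RintegralD.
Qed.

Lemma gint_finite f : supported f -> edge_integrable f ->
  gint mu f = (fin_integral f)%:E.
Proof.
move=> [fV fE] fi.
have sp : supported (f^\+)%R.
  split=> [x /fV|e s /fE h /h]; rewrite /on_edge /funrpos => ->; exact: maxxx.
have sn : supported (f^\-)%R.
  by split=> [x /fV|e s /fE h /h]; rewrite /on_edge /funrneg => ->; rewrite oppr0 maxxx.
have ip : edge_integrable (f^\+)%R by move=> e; exact: integrable_funrpos (fi e).
have iN : edge_integrable (f^\-)%R by move=> e; exact: integrable_funrneg (fi e).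
rewrite /gint !gint_nneg_finite // -EFinB; congr EFin.
apply/eqP; rewrite subr_eq -fin_integralD //; apply/eqP; congr fin_integral.
by rewrite -{2}(funrposBneg f) addrfctE opprfctE; apply/funext => p /=; rewrite subrK.
Qed.

End FiniteIntegral.

Section Green.
Context {R : realType} {G : metricGraph R}.
Local Notation V := (vertex G).
Local Notation E := (edge G).
Local Notation leb := (@lebesgue_measure R).
Context (mu : V -> R) (omega : V -> V -> R).
Hypotheses (mu_gt0 : forall x, 0 < mu x)
  (omega_ge0 : forall x y, 0 <= omega x y)
  (omega_sym : forall x y, omega x y = omega y x)
  (omega_adj : forall x y, 0 < omega x y <-> joined x y)
  (G_locally_finite : locally_finite G).

Lemma joined_sym (x y : V) : joined x y -> joined y x.
Proof. by move=> [e [[<- <-]|[<- <-]]]; exists e; [right|left]. Qed.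

Lemma finite_neighbours (x : V) : finite_set [set y | joined x y].
Proof.
apply: (@sub_finite_set _ _ (@init R G @` [set e | init e = x \/ term e = x] `|`
                             @term R G @` [set e | init e = x \/ term e = x])).
  by move=> y [e [[ix <-]|[<- tx]]]; [right|left]; exists e => //=; [left|right].
by rewrite finite_setU; split; apply: finite_image; exact: G_locally_finite.
Qed.

Section FiniteSupport.
Variables (v : V -> R) (S : set V).
Hypotheses (fS : finite_set S) (vS : forall x, ~ S x -> v x = 0).

(** The vertices at which [v] or its Laplacian may be different from 0. *)
Definition nbhd : set V := S `|` \bigcup_(x in S) [set y | joined x y].

Definition edges_at : set E := [set e | S (init e) \/ S (term e)].

Lemma finite_nbhd : finite_set nbhd.
Proof.
rewrite finite_setU; split => //; apply: bigcup_finite => // x _.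
exact: finite_neighbours.
Qed.

Lemma finite_edges_at : finite_set edges_at.
Proof.
apply: (@sub_finite_set _ _ (\bigcup_(x in S) [set e | init e = x \/ term e = x])).
  by move=> e [Sx|Sx]; [exists (init e)|exists (term e)] => //=; [left|right].
by apply: bigcup_finite => // x _; exact: G_locally_finite.
Qed.

Lemma supported_extend f : supported nbhd edges_at (fun p => extend v p * f p).
Proof.
split=> [x nx|e s ne se]; rewrite /on_edge.
  by rewrite /= vS ?mul0r // => Sx; apply: nx; left.
rewrite edge_pt_inn /= !vS; [|by move=> h; apply: ne; right|by move=> h; apply: ne; left].
by rewrite /smoothstep; ring.
Qed.

Lemma supported_lap f :
  supported nbhd edges_at (fun p => f p * lap_extend mu omega v p).
Proof.
split=> [x nx|e s ne se]; rewrite /on_edge.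
  rewrite /= /laplacian_V fsbig1 ?mulr0 // => y /= xy.
  rewrite !vS ?subrr ?mulr0 // => Sy; apply: nx; first by left.
  by right; exists y => //=; exact: joined_sym.
rewrite edge_pt_inn /= !vS; [|by move=> h; apply: ne; right|by move=> h; apply: ne; left].
by rewrite /d2smoothstep; ring.
Qed.

(** The weights being symmetric, the double sum over pairs of vertices is
    symmetric in the two functions. *)
Lemma green_vertices (f : V -> R) :
  \sum_(x \in nbhd) mu x * (v x * laplacian_V mu omega f x) =
  \sum_(x \in nbhd) mu x * (f x * laplacian_V mu omega v x).
Proof.
have omega0 x y : ~ joined x y -> omega x y = 0.
  move=> nxy; apply/eqP; rewrite eq_le omega_ge0 andbT leNgt.
  by apply/negP => /omega_adj.
have fN := finite_nbhd.
have lap_sum (g k : V -> R) x :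
    (forall y, joined x y -> ~ nbhd y -> g x * (k y - k x) = 0) ->
    mu x * (g x * laplacian_V mu omega k x) =
    \sum_(y \in nbhd) omega x y * (g x * k y - g x * k x).
  move=> gk; rewrite /laplacian_V.
  have -> s : mu x * (g x * ((mu x)^-1 * s)) = g x * s.
    by field; rewrite gt_eqF.
  rewrite mulr_fsumr (@fsbig_widen _ _ _ _ _ (nbhd `|` [set y | joined x y])) //=.
  - rewrite [RHS](@fsbig_widen _ _ _ _ _ (nbhd `|` [set y | joined x y])) //=.
      by apply: eq_fsbigr => y _; ring.
    move=> y [/= _ ny]; have [xy|nxy] := pselect (joined x y).
      by rewrite -mulrBr gk ?mulr0.
    by rewrite omega0 ?mul0r.
  - by move=> y [/= _ ny]; rewrite omega0 ?mul0r ?mulr0.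
transitivity (\sum_(x \in nbhd) \sum_(y \in nbhd) omega x y * (v x * f y - v x * f x)).
  apply: eq_fsbigr => x _; apply: lap_sum => y xy ny.
  rewrite vS ?mul0r // => Sx; apply: ny; right; exists x => //.
transitivity (\sum_(x \in nbhd) \sum_(y \in nbhd) omega x y * (f x * v y - f x * v x));
    last first.
  apply: eq_fsbigr => x _; apply/esym/lap_sum => y xy ny.
  rewrite !vS ?subrr ?mulr0 // => Sx; apply: ny; first by right; exists x.
  by left.
have split_sum (g k : V -> R) :
    \sum_(x \in nbhd) \sum_(y \in nbhd) omega x y * (g x * k y - g x * k x) =
    \sum_(x \in nbhd) \sum_(y \in nbhd) omega x y * (g x * k y) +
    \sum_(x \in nbhd) \sum_(y \in nbhd) omega x y * - (g x * k x).
  rewrite -fsbig_split //=; apply: eq_fsbigr => x _.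
  by rewrite -fsbig_split //=; apply: eq_fsbigr => y _; rewrite -mulrDr.
rewrite (split_sum v f) (split_sum f v); congr (_ + _); last first.
  by apply: eq_fsbigr => x _; apply: eq_fsbigr => y _; rewrite [f x * _]mulrC.
transitivity (\sum_(y \in nbhd) \sum_(x \in nbhd) omega x y * (v x * f y)).
  exact: exchange_fsbig.
apply: eq_fsbigr => x _; apply: eq_fsbigr => y _.
by rewrite omega_sym [f x * _]mulrC.
Qed.

(** The boundary terms of the edges, collected at their end vertices. *)
Lemma kirchhoff_sum (f : gpoint G -> R) :
  \sum_(e \in edges_at) (v (term e) * derive_in `[0, len e] (on_edge f e) (len e)
    - v (init e) * derive_in `[0, len e] (on_edge f e) 0) =
  \sum_(x \in S) v x * kirchhoff f x.
Proof.
have fE := finite_edges_at.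
have regroup (k : E -> V) (A : E -> R) : (forall e, S (k e) -> edges_at e) ->
    \sum_(e \in edges_at) v (k e) * A e =
    \sum_(x \in S) v x * \sum_(e \in [set e | k e = x]) A e.
  move=> kS.
  transitivity (\sum_(e \in edges_at) \sum_(x \in S) (if k e == x then v x * A e else 0)).
    apply: eq_fsbigr => e _; have [Sk|nSk] := pselect (S (k e)).
      rewrite (fsbigD1 (k e)) //= eqxx fsbig1 ?addr0 // => x [/= _ /eqP].
      by rewrite eq_sym => /negbTE ->.
    rewrite vS // mul0r fsbig1 // => x Sx; case: eqP => // kx.
    by case: nSk; rewrite kx.
  rewrite exchange_fsbig //=; apply: eq_fsbigr => x; rewrite inE => Sx.
  rewrite mulr_fsumr.
  rewrite [RHS](_ : _ = \sum_(e \in [set e | k e = x]) (if k e == x then v x * A e else 0)).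
    apply/esym/fsbig_widen => [e /= kx|e [/= _ /eqP /negbTE ->] //].
    by apply: kS; rewrite kx.
  by apply: eq_fsbigr => e; rewrite inE /= => /eqP ->.
rewrite /kirchhoff.
transitivity (\sum_(e \in edges_at) v (term e) * derive_in `[0, len e] (on_edge f e) (len e)
    + \sum_(e \in edges_at) v (init e) * - derive_in `[0, len e] (on_edge f e) 0).
  by rewrite -fsbig_split //=; apply: eq_fsbigr => e _; rewrite mulrN.
rewrite !regroup; [|by move=> e ?; left|by move=> e ?; right].
rewrite -fsbig_split //=; apply: eq_fsbigr => x _.
rewrite -mulrDr; congr (_ * (_ + _)); rewrite -[RHS]mulN1r mulr_fsumr.
by apply: eq_fsbigr => e _; rewrite mulN1r.
Qed.

(** Green's formula identifies the right-hand side with the integral of [f *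
    lap_extend v], the boundary terms being killed by the Kirchhoff condition.
    The estimate is stated as a lower bound since this is the form that survives
    integration in time. *)
Lemma green_graph (f : gpoint G -> R) : classD f ->
  (forall x, kirchhoff f x = 0) ->
  (- gint_nneg mu (fun p => `|f p * lap_extend mu omega v p|%R) <=
     gint mu (fun p => extend v p * laplacian mu omega f p)%R)%E.
Proof.
move=> fD fK; have mu_ge0 x := ltW (mu_gt0 x).
have fN := finite_nbhd; have fE := finite_edges_at.
have green e := let: And4 cf f2 f1 fb := fD e in
  @green_edge _ _ _ (v (init e)) (v (term e)) (len_gt0 e) cf f2 f1 fb.
pose F1 p := extend v p * laplacian mu omega f p.
pose F2 p := f p * lap_extend mu omega v p.
have F1E e : {in `]0, len e[%classic, on_edge F1 e =1 (fun s =>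
    smoothstep (len e) (v (init e)) (v (term e)) s * ((on_edge f e)^`(2))%classic s)}.
  by move=> s; rewrite inE /= in_itv /= => se; rewrite /on_edge edge_pt_inn.
have F2E e : {in `]0, len e[%classic, on_edge F2 e =1 (fun s =>
    on_edge f e s * d2smoothstep (len e) (v (init e)) (v (term e)) s)}.
  by move=> s; rewrite inE /= in_itv /= => se; rewrite /on_edge edge_pt_inn.
have i1 : edge_integrable F1.
  move=> e; have [gi _ _] := green e; apply: eq_integrable gi => //.
  by move=> s /F1E /= ->.
have i2 : edge_integrable F2.
  move=> e; have [_ gi _] := green e; apply: eq_integrable gi => //.
  by move=> s /F2E /= ->.
have s1 : supported nbhd edges_at F1 by exact: supported_extend.
have s2 : supported nbhd edges_at F2 by exact: supported_lap.
suff -> : gint mu F1 = gint mu F2 by exact: gint_ge_opp.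
rewrite !(gint_finite mu_ge0 fN fE) //; congr EFin; rewrite /fin_integral.
congr (_ + _); first exact: (green_vertices (fun x => f (Vtx x))).
have -> : \sum_(e \in edges_at) (\int[leb]_(s in `]0, len e[) on_edge F1 e s)%R =
  \sum_(e \in edges_at) ((v (term e) * derive_in `[0, len e] (on_edge f e) (len e)
    - v (init e) * derive_in `[0, len e] (on_edge f e) 0) +
    (\int[leb]_(s in `]0, len e[) on_edge F2 e s)%R).
  apply: eq_fsbigr => e _; have [_ _ ge] := green e.
  transitivity (\int[leb]_(s in `]0, len e[) (smoothstep (len e) (v (init e))
      (v (term e)) s * ((on_edge f e)^`(2))%classic s))%R.
    by apply: eq_Rintegral; exact: F1E.
  by rewrite ge; congr (_ + _); apply: eq_Rintegral => s sl; rewrite F2E.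
rewrite fsbig_split //= kirchhoff_sum fsbig1 ?add0r // => x _.
by rewrite fK mulr0.
Qed.

End FiniteSupport.
End Green.

(** * The spatial cutoff *)

Lemma pos_part_lipschitz (R : realDomainType) (a b : R) :
  `|Num.max 0 b - Num.max 0 a| <= `|b - a|.
Proof.
have h1 := ler_norm (b - a); have h2 := ler_norm (a - b).
rewrite distrC in h2; have h3 := normr_ge0 (b - a).
by rewrite ler_norml; case: (leP 0 a) => a0; case: (leP 0 b) => b0; lra.
Qed.

Lemma norm_fsum_le (R : realDomainType) (I : choiceType) (S : set I)
    (w g : I -> R) (m : R) : finite_set S ->
  (forall i, 0 <= w i) -> (forall i, S i -> `|g i| <= m) ->
  `|\sum_(i \in S) w i * g i| <= (\sum_(i \in S) w i) * m.
Proof.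
move=> fS w0 gm; rewrite !fsbig_finite //= mulr_suml.
apply: le_trans (ler_norm_sum _ _ _) _; rewrite big_seq [leRHS]big_seq.
apply: ler_sum => i; rewrite in_fset_set // inE => Si.
by rewrite normrM ger0_norm // ler_wpM2l // gm.
Qed.

Section Cutoff.
Context {R : realType} {G : metricGraph R}.
Local Notation V := (vertex G).
Local Notation E := (edge G).
Context (mu : V -> R) (omega : V -> V -> R) (x0 : V) (J lmin C0 delta r kappa : R).
Hypotheses (mu_gt0 : forall x, 0 < mu x)
  (omega_ge0 : forall x y, 0 <= omega x y)
  (omega_bound : forall x, \sum_(y \in [set y | joined x y]) omega x y <= C0 * mu x)
  (C0_gt0 : 0 < C0)
  (connected : path_connected_graph G) (G_locally_finite : locally_finite G)
  (lenJ : forall e : E, len e <= J) (len_lmin : forall e : E, lmin <= len e)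
  (J_ge0 : 0 <= J)
  (lmin_gt0 : 0 < lmin) (delta_gt0 : 0 < delta) (r_ge1 : 1 <= r) (r_ge2J : 2 * J <= r)
  (kappa_gt0 : 0 < kappa) (kappa_lt1 : kappa < 1).

Local Notation dist0 := (fun p : gpoint G => gdist p (Vtx x0)).

Definition weight (p : gpoint G) : R := expR (- (delta / r) * dist0 p).

(** The plateau reaches up to [r + J] so that every edge that meets the ball of
    radius [r], and every neighbour of its vertices, lies in it. *)
Definition decay (x : V) : R :=
  expR (- (delta / r) * Num.max 0 (dist0 (Vtx x) - (r + J))).

(** Truncation at level [kappa] turns exponential decay into bounded support. *)
Definition cutoff (x : V) : R := Num.max 0 (decay x - kappa).

Let r_gt0 : 0 < r. Proof. exact: lt_le_trans r_ge1. Qed.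

Let alpha_gt0 : 0 < delta / r. Proof. exact: divr_gt0. Qed.

Let alphaJ : delta / r * J <= delta.
Proof.
rewrite mulrAC ler_pdivrMr // ler_wpM2l ?(ltW delta_gt0) //.
by have := J_ge0; have := r_ge2J; lra.
Qed.

Let alpha_r : delta / r * r = delta.
Proof. by rewrite divfK // gt_eqF. Qed.

Lemma dist0_joined x y : joined x y ->
  `|dist0 (Vtx x) - dist0 (Vtx y)| <= J.
Proof.
have h (e : E) : `|dist0 (Vtx (init e)) - dist0 (Vtx (term e))| <= J.
  apply: le_trans (lenJ e); rewrite -edge_pt_init.
  by apply: gdist_term => //; rewrite lexx ltW ?len_gt0.
by move=> [e [[<- <-]|[<- <-]]]; [|rewrite distrC]; exact: h.
Qed.

(** The exponents differ by at most [delta / r] times [r + 2 J], and [2 J <= r].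
    *)
Lemma decay_le_weight p x : `|dist0 p - dist0 (Vtx x)| <= J ->
  decay x <= expR (3 * delta) * weight p.
Proof.
move=> px; rewrite /decay /weight -expRD ler_expR.
have m1 : dist0 (Vtx x) - (r + J) <= Num.max 0 (dist0 (Vtx x) - (r + J)).
  by rewrite le_max lexx orbT.
have := ler_wpM2l (ltW alpha_gt0) m1.
have h1 : dist0 p - dist0 (Vtx x) <= J by exact: le_trans (ler_norm _) px.
have := ler_wpM2l (ltW alpha_gt0) h1.
rewrite !mulrBr !mulrDr alpha_r !mulNr; move: alphaJ; lra.
Qed.

(** Both signs of [c] follow from the tangent inequality for the exponential at
    0. *)
Lemma expR_sub1 (c : R) : `|expR c - 1| <= `|c| * expR `|c|.
Proof.
have h (t : R) : 0 <= t -> expR t - 1 <= t * expR t.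
  move=> t0; have := expR_ge1Dx (- t); rewrite expRN => h1.
  have := ler_wpM2l (expR_ge0 t) h1; rewrite mulfV ?gt_eqF ?expR_gt0 //; lra.
have [c0|c0] := leP 0 c.
  have e1 : 0 <= expR c - 1 by rewrite subr_ge0 -expR0 ler_expR.
  by rewrite [`|c|]ger0_norm // (ger0_norm e1); exact: h.
have h1 := expR_ge1Dx c.
rewrite ler0_norm; last by rewrite subr_le0 ltW // expR_lt1.
have : 1 <= expR (- c) by rewrite -expR0 ler_expR; lra.
move=> h2; rewrite [`|c|]ltr0_norm //.
have c0' : 0 <= - c by rewrite oppr_ge0 ltW.
by have := ler_wpM2l c0' h2; rewrite mulr1; lra.
Qed.

(** The oscillation of an exponential along an edge is relative to its size;
    this is what makes the Laplacian of the cutoff comparable with the cutoff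
    itself. *)
Lemma decay_lipschitz x y : `|dist0 (Vtx x) - dist0 (Vtx y)| <= J ->
  `|decay y - decay x| <= J * delta * expR delta / r * decay x.
Proof.
move=> xy; set c := - (delta / r) * (Num.max 0 (dist0 (Vtx y) - (r + J))
  - Num.max 0 (dist0 (Vtx x) - (r + J))).
have -> : decay y = expR c * decay x.
  by rewrite /decay -expRD; congr expR; rewrite /c; ring.
have cJ : `|c| <= delta / r * J.
  rewrite /c normrM [X in X * _](_ : _ = delta / r); last first.
    by rewrite normrN gtr0_norm.
  rewrite ler_wpM2l ?(ltW alpha_gt0) //; apply: le_trans xy.
  apply: le_trans (pos_part_lipschitz _ _) _.
  by rewrite distrC (_ : _ - _ - _ = dist0 (Vtx x) - dist0 (Vtx y)) //; ring.
rewrite -{2}[decay x]mul1r -mulrBl normrM [`|decay x|]ger0_norm ?expR_ge0 //.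
rewrite ler_wpM2r ?expR_ge0 //; apply: le_trans (expR_sub1 c) _.
rewrite (_ : J * delta * _ / r = (delta / r * J) * expR delta); last by ring.
by apply: ler_pM; rewrite ?expR_ge0 // ler_expR (le_trans cJ).
Qed.

Lemma cutoff_lipschitz x y : `|cutoff y - cutoff x| <= `|decay y - decay x|.
Proof.
apply: le_trans (pos_part_lipschitz _ _) _.
by rewrite (_ : _ - _ - _ = decay y - decay x) //; ring.
Qed.

(** The quantity [d] is at most [kappa] plus its truncation, and it is also
    below [w]. *)
Lemma decay_split (d w e : R) : d <= w -> 0 <= e -> d - kappa <= e ->
  d <= e + Num.min kappa w.
Proof. by move=> dw e0 de; case: (leP kappa w); lra. Qed.

(** Independent of [r] and [kappa], which is essential in the limit. *)
Definition lip_const : R := J * delta * expR delta * (C0 + 6 / lmin ^+ 2).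

(** The Lipschitz bound of [decay] controls the differences at the vertices, and
    the second derivative of the cubics through the difference of their end
    values; on an edge the smaller of the two end values has to be used, since
    it is the one that bounds [extend cutoff] from below. *)
Lemma lap_cutoff p : `|lap_extend mu omega cutoff p| <=
  lip_const / r * (extend cutoff p + Num.min kappa (expR (3 * delta) * weight p)).
Proof.
set q := J * delta * expR delta.
have q0 : 0 <= q by rewrite !mulr_ge0 ?expR_ge0 // ltW.
have ln0 : 0 < 6 / lmin ^+ 2 by rewrite divr_gt0 ?exprn_gt0.
have w0 p' : 0 <= expR (3 * delta) * weight p' by rewrite mulr_ge0 ?expR_ge0.
have e0 p' : 0 <= extend cutoff p'.
  by apply: extend_ge => x; rewrite /cutoff le_max lexx.
have rhs0 p' : 0 <= extend cutoff p' + Num.min kappa (expR (3 * delta) * weight p').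
  by rewrite addr_ge0 // le_min w0 ltW.
case: p => [x|e s se] /=.
  have dx : decay x <= cutoff x + Num.min kappa (expR (3 * delta) * weight (Vtx x)).
    apply: decay_split; first by apply: decay_le_weight; rewrite subrr normr0.
    - by rewrite /cutoff le_max lexx.
    - by rewrite /cutoff le_max lexx orbT.
  apply: (@le_trans _ _ (C0 * (q / r) * decay x)).
    rewrite /laplacian_V normrM gtr0_norm ?invr_gt0 // ler_pdivrMl //.
    have fN : finite_set [set y | joined x y] by exact: finite_neighbours.
    have ob := omega_bound x.
    apply: le_trans (norm_fsum_le (m := q / r * decay x) fN _ _) _ => //.
      move=> y /= xy.
      by apply: le_trans (cutoff_lipschitz _ _) (decay_lipschitz (dist0_joined xy)).
    rewrite [leRHS](_ : _ = C0 * mu x * (q / r * decay x)); last by ring.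
    by rewrite ler_wpM2r // mulr_ge0 ?expR_ge0 // divr_ge0 // ltW.
  apply: (@le_trans _ _ (C0 * (q / r) * (extend cutoff (Vtx x) + Num.min kappa (expR (3 * delta) * weight (Vtx x))))).
    by rewrite ler_wpM2l // mulr_ge0 ?divr_ge0 // ltW.
  apply: ler_wpM2r; first exact: (rhs0 (Vtx x)).
  rewrite /lip_const -/q (_ : q * _ / r = C0 * (q / r) + (6 / lmin ^+ 2) * (q / r)); last by ring.
  by rewrite lerDl mulr_ge0 ?(ltW ln0) // divr_ge0 // ltW.
have /andP[s0 sl] := se; have sle : 0 <= s <= len e by rewrite !ltW.
set p : gpoint G := Inn se.
have di : decay (init e) <= expR (3 * delta) * weight p.
  apply: decay_le_weight; rewrite /p -edge_pt_inn.
  by apply: le_trans (lenJ e); exact: gdist_init.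
have dt : decay (term e) <= expR (3 * delta) * weight p.
  apply: decay_le_weight; rewrite /p -edge_pt_inn.
  by apply: le_trans (lenJ e); exact: gdist_term.
have ge_c x : decay x - kappa <= cutoff x by rewrite /cutoff le_max lexx orbT.
have xy : joined (init e) (term e) by exists e; left.
have h : `|cutoff (term e) - cutoff (init e)| <= q / r * Num.min (decay (init e)) (decay (term e)).
  rewrite minr_pMr; last by rewrite divr_ge0 // ltW.
  rewrite le_min; apply/andP; split.
    by apply: le_trans (cutoff_lipschitz _ _) (decay_lipschitz (dist0_joined xy)).
  rewrite distrC; apply: le_trans (cutoff_lipschitz _ _) (decay_lipschitz _).
  by rewrite distrC; exact: dist0_joined.
have hm : Num.min (decay (init e)) (decay (term e)) <=
    extend cutoff p + Num.min kappa (expR (3 * delta) * weight p).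
  apply: decay_split; first by rewrite ge_min di.
  - exact: e0.
  - apply: smoothstep_ge; [exact: sle|exact: len_gt0| |];
    apply: le_trans (ge_c _);
    by rewrite lerD2r ge_min lexx ?orbT.
apply: le_trans (d2smoothstep_le _ _ sle (len_gt0 e)) _.
apply: (@le_trans _ _ (6 / lmin ^+ 2 * (q / r * (extend cutoff p + Num.min kappa (expR (3 * delta) * weight p))))).
  apply: ler_pM => //.
  - by rewrite divr_ge0 // exprn_ge0 // ltW // len_gt0.
  - rewrite ler_wpM2l // lef_pV2 ?posrE ?exprn_gt0 ?len_gt0 //.
    by rewrite lerXn2r ?nnegrE ?(ltW lmin_gt0) // ltW // len_gt0.
  - apply: (le_trans h); rewrite ler_wpM2l // divr_ge0 //; exact: ltW.
rewrite mulrA ler_wpM2r // /lip_const -/q.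
rewrite (_ : q * _ / r = C0 * (q / r) + (6 / lmin ^+ 2) * (q / r)); last by ring.
by rewrite lerDr mulr_ge0 ?(ltW C0_gt0) // divr_ge0 // ltW.
Qed.

Lemma decay_before x : dist0 (Vtx x) <= r + J -> decay x = 1.
Proof.
by move=> xr; rewrite /decay (max_idPl _) ?mulr0 ?expR0 // subr_le0.
Qed.

Lemma decay_le1 x : decay x <= 1.
Proof.
rewrite /decay -expR0 ler_expR mulNr oppr_le0 mulr_ge0 ?(ltW alpha_gt0) //.
by rewrite le_max lexx.
Qed.

Lemma cutoff_ge0 x : 0 <= cutoff x.
Proof. by rewrite /cutoff le_max lexx. Qed.

Lemma cutoff_le1 x : cutoff x <= 1.
Proof.
by rewrite /cutoff ge_max ler01 lerBlDr (le_trans (decay_le1 x)) // lerDl ltW.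
Qed.

Lemma cutoff_before x : dist0 (Vtx x) <= r + J -> cutoff x = 1 - kappa.
Proof.
by move=> xr; rewrite /cutoff decay_before // (max_idPr _) // subr_ge0 ltW.
Qed.

Lemma cutoff_le_decay x : cutoff x <= decay x.
Proof. by rewrite /cutoff ge_max expR_ge0 lerBlDr lerDl ltW. Qed.

Lemma extend_cutoff_ge0 p : 0 <= extend cutoff p.
Proof. by apply: extend_ge => x; exact: cutoff_ge0. Qed.

Lemma extend_cutoff_le1 p : extend cutoff p <= 1.
Proof. by apply: extend_le => x; exact: cutoff_le1. Qed.

Lemma extend_cutoff_le p : extend cutoff p <= expR (3 * delta) * weight p.
Proof.
case: p => [x|e s se].
  apply: le_trans (cutoff_le_decay x) (decay_le_weight _).
  by rewrite subrr normr0.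
have /andP[s0 sl] := se; have sle : 0 <= s <= len e by rewrite !ltW.
rewrite -edge_pt_inn; apply: (@le_trans _ _ (smoothstep (len e) (cutoff (init e)) (cutoff (term e)) s)).
  by rewrite edge_pt_inn.
apply: smoothstep_le; [exact: sle|exact: len_gt0| |];
  apply: le_trans (cutoff_le_decay _) (decay_le_weight _).
  by apply: le_trans (lenJ e); exact: gdist_init.
by apply: le_trans (lenJ e); exact: gdist_term.
Qed.

Lemma near_vertices p : dist0 p < r ->
  match p return Prop with
  | Vtx x => dist0 (Vtx x) <= r + J
  | @Inn _ _ e _ _ => dist0 (Vtx (init e)) <= r + J /\ dist0 (Vtx (term e)) <= r + J
  end.
Proof.
case: p => [x|e s se] pr; first by have := J_ge0; lra.
have /andP[s0 sl] := se; have sle : 0 <= s <= len e by rewrite !ltW.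
rewrite -edge_pt_inn in pr; have lJ := lenJ e.
have := gdist_init connected (Vtx x0) sle; have := gdist_term connected (Vtx x0) sle.
by rewrite !ler_norml => /andP[h1 h2] /andP[h3 h4]; split; lra.
Qed.

Lemma extend_cutoff_before p : dist0 p < r -> extend cutoff p = 1 - kappa.
Proof.
move=> /near_vertices; case: p => [x /cutoff_before //|e s se [hi ht]] /=.
by rewrite !cutoff_before // /smoothstep; ring.
Qed.

Lemma lap_cutoff_before p : dist0 p < r -> lap_extend mu omega cutoff p = 0.
Proof.
move=> pr; have := near_vertices pr; case: p pr => [x xr _|e s se _ [hi ht]] /=.
  rewrite /laplacian_V fsbig1 ?mulr0 // => y /= xy.
  have := dist0_joined xy; rewrite ler_norml => /andP[h1 h2].
  rewrite !cutoff_before ?subrr ?mulr0 //; have := J_ge0; lra.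
by rewrite !cutoff_before // /d2smoothstep; ring.
Qed.

(** Beyond this distance the exponential is below [kappa]. *)
Definition reach : R := r + J + (r / delta) * (- ln kappa) + 1.

Lemma cutoff_support x : reach <= dist0 (Vtx x) -> cutoff x = 0.
Proof.
move=> xr; apply/max_idPl; rewrite subr_le0 -[leRHS]lnK ?posrE // /decay ler_expR.
have h : r / delta * - ln kappa <= Num.max 0 (dist0 (Vtx x) - (r + J)).
  by rewrite le_max; apply/orP; right; move: xr; rewrite /reach; lra.
rewrite mulNr lerNl; apply: le_trans (ler_wpM2l (ltW alpha_gt0) h).
by rewrite mulrA (_ : delta / r * (r / delta) = 1) ?mul1r //; field; rewrite !gt_eqF.
Qed.

Lemma extend_cutoff_support p : reach + J <= dist0 p -> extend cutoff p = 0.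
Proof.
case: p => [x|e s se] pr.
  by apply: cutoff_support; have := J_ge0; lra.
have /andP[s0 sl] := se; have sle : 0 <= s <= len e by rewrite !ltW.
rewrite -edge_pt_inn in pr; have lJ := lenJ e.
have := gdist_init connected (Vtx x0) sle; have := gdist_term connected (Vtx x0) sle.
rewrite !ler_norml /= => /andP[h1 h2] /andP[h3 h4].
by rewrite !cutoff_support ?/smoothstep; [ring|lra|lra].
Qed.

Lemma reach_gt0 : 0 < reach.
Proof.
rewrite /reach; have : ln kappa <= 0 by rewrite -ln1 ler_ln ?posrE // ltW.
move=> k0; have : 0 <= r / delta * - ln kappa.
  by rewrite mulr_ge0 ?oppr_ge0 // divr_ge0 // ltW.
by have := J_ge0; have := r_gt0; lra.
Qed.

Hypothesis balls_finite : forall r : R, 0 < r ->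
   finite_set [set x : V | ball (Vtx x0) r (Vtx x)] /\
   finite_set [set e : E | exists2 s : R, s \in `]0, len e[ &
                                  ball (Vtx x0) r (edge_pt e s)].

Lemma finite_cutoff_support : finite_set [set x | cutoff x != 0].
Proof.
apply: sub_finite_set (balls_finite reach_gt0).1 => x /= cx.
apply/(ball_gdist connected); rewrite gdistC // ltNge.
by apply: contra cx => /cutoff_support ->.
Qed.

(** A closed ball lies in a finite union of vertices and closed edges, each of
    them compact. *)
Lemma compact_closure_ball (rho : R) : 0 < rho ->
  compact (closure (ball (Vtx x0 : gpoint G) rho)).
Proof.
move=> rho0; have rho1 : 0 < rho + 1 by rewrite addr_gt0.
have [fV fE] := balls_finite rho1.
pose K : set (gpoint G) :=
  \bigcup_(x in [set x : V | ball (Vtx x0) (rho + 1) (Vtx x)]) [set Vtx x] `|`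
  \bigcup_(e in [set e : E | exists2 s : R, s \in `]0, len e[ &
      ball (Vtx x0) (rho + 1) (edge_pt e s)]) (edge_pt e @` `[0, len e]).
apply: (@subclosed_compact _ _ K).
- exact: closed_closure.
- apply: compactU.
    rewrite -fsbig_setU // fsbig_finite //; apply: bigsetU_compact => x _.
    exact: compact_set1.
  rewrite -fsbig_setU // fsbig_finite //; apply: bigsetU_compact => e _.
  apply: continuous_compact; last exact: segment_compact.
  exact: continuous_edge_pt.
- move=> p cp; have [q [xq pq]] := cp _ (nbhsx_ballx p 1 ltr01).
  have xp : ball (Vtx x0) (rho + 1) p.
    by apply: ball_triangle xq _; exact: ball_sym.
  case: p cp pq xp => [x|e s se] _ _ xp; [left; by exists x|right].
  exists e; first by exists s; rewrite ?in_itv // edge_pt_inn.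
  have /andP[s0 sl] := se.
  by exists s; rewrite ?edge_pt_inn //= in_itv /= !ltW.
Qed.

Lemma cutoff_test_function k :
  test_function (fun p t => extend cutoff p * tcut r k t).
Proof.
split.
- by move=> p t _; rewrite mulr_ge0 ?extend_cutoff_ge0 ?tcut_ge0.
- exists (2 * r), (closure (ball (Vtx x0 : gpoint G) (reach + J))); split.
  + by rewrite mulr_gt0.
  + by apply: compact_closure_ball; have := reach_gt0; have := J_ge0; lra.
  + set A := closure _.
    have -> : A `*` `[0, 2 * r] = fst @^-1` A `&` snd @^-1` `[0, 2 * r] by [].
    have cAT : closed (fst @^-1` A `&` snd @^-1` `[0, 2 * r] : set (gpoint G * R)).
      apply: closedI; apply: preimage_closed.
      * by move=> z _; exact: cvg_fst.
      * exact: closed_closure.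
      * by move=> z _; exact: cvg_snd.
      * exact: itv_closed.
    rewrite [X in _ `<=` X](closure_id _).1 //; apply: closureS.
    move=> [p t] /= [t0 pt0]; split.
      apply: subset_closure; apply/(ball_gdist connected); rewrite gdistC // ltNge.
      by apply/negP => /extend_cutoff_support pe; apply: pt0; rewrite pe mul0r.
    rewrite in_itv /= t0 leNgt; apply/negP => rt; apply: pt0.
    by rewrite tcut_after ?mulr0 // ltW.
- by move=> p; exact: (C1_in_cut (extend cutoff p) r k).1.
- move=> e t t0; apply: measurable_funM => //; exact: measurable_extend.
Qed.

(** All that the later estimates use about the spatial cutoff; the constants [K]
    and [C] are those that have to be uniform in [r] and [kappa]. *)
Record cutoff_spec (K C : R) (v : V -> R) : Prop := {
  cut_support : finite_set [set x | v x != 0];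
  cut_ge0 : forall p, 0 <= extend v p;
  cut_le1 : forall p, extend v p <= 1;
  cut_le : forall p, extend v p <= C * weight p;
  cut_lap : forall p, `|lap_extend mu omega v p| <=
    K / r * (extend v p + Num.min kappa (C * weight p));
  cut_in : forall p, dist0 p < r -> extend v p = 1 - kappa;
  cut_lap_in : forall p, dist0 p < r -> lap_extend mu omega v p = 0;
  cut_test : forall k, test_function (fun p t => extend v p * tcut r k t)
}.

Lemma cutoffP : cutoff_spec lip_const (expR (3 * delta)) cutoff.
Proof.
split.
- exact: finite_cutoff_support.
- exact: extend_cutoff_ge0.
- exact: extend_cutoff_le1.
- exact: extend_cutoff_le.
- exact: lap_cutoff.
- exact: extend_cutoff_before.
- exact: lap_cutoff_before.
- exact: cutoff_test_function.
Qed.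

End Cutoff.

(** * Young's inequality *)

Section Young.
Context {R : realType}.
Implicit Types (a b c h w lam sigma : R).

(** If [c <= lam h z^(sigma - 1)] with [z = a w^(1 / sigma)], the product is
    below the first term; otherwise [z] is bounded in terms of [c / (lam h)],
    and the product is below the second. *)
Lemma young_split a b c h w lam sigma : 1 < sigma -> 0 < lam -> 0 < h ->
  0 <= a -> 0 <= c -> 0 <= w -> b <= c * w `^ sigma^-1 ->
  a * b <= lam * (h * a `^ sigma * w) +
    lam `^ (- (sigma - 1)^-1) * (c `^ (sigma / (sigma - 1)) * h `^ (- (sigma - 1)^-1)).
Proof.
move=> s1 l0 h0 a0 c0 w0 bc; have s0 : 0 < sigma by exact: lt_trans s1.
have sm : 0 < sigma - 1 by rewrite subr_gt0.
pose z := a * w `^ sigma^-1.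
have z0 : 0 <= z by rewrite mulr_ge0 ?powR_ge0.
have zs : z `^ sigma = a `^ sigma * w.
  by rewrite powRM ?powR_ge0 // -powRrM mulVf ?gt_eqF // powRr1.
apply: (@le_trans _ _ (c * z)).
  by rewrite /z mulrCA ler_wpM2l.
have lh0 : 0 < lam * h by exact: mulr_gt0.
set q := (sigma - 1)^-1; have q0 : 0 < q by rewrite invr_gt0.
have -> : lam * (h * a `^ sigma * w) = lam * h * z `^ sigma by rewrite zs; ring.
have -> : lam `^ (- q) * (c `^ (sigma / (sigma - 1)) * h `^ (- q)) =
    c `^ (sigma / (sigma - 1)) * (lam * h) `^ (- q).
  by rewrite powRM ?ltW //; ring.
have [cz|cz] := leP c (lam * h * z `^ (sigma - 1)).
  rewrite (@le_trans _ _ (lam * h * z `^ sigma)) //; last first.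
    by rewrite lerDl mulr_ge0 ?powR_ge0.
  rewrite -(mulr_powRB1 z0 s0).
  rewrite (_ : lam * h * (z * _) = lam * h * z `^ (sigma - 1) * z); last by ring.
  exact: ler_wpM2r.
have cp : 0 < c by apply: le_lt_trans cz; rewrite mulr_ge0 ?powR_ge0 ?ltW.
have zq : z <= (c / (lam * h)) `^ q.
  rewrite -[leLHS]powRr1 // -(mulfV (lt0r_neq0 sm)) powRrM.
  apply: ge0_ler_powR; rewrite ?nnegrE ?powR_ge0 ?(ltW q0) //.
    by rewrite divr_ge0 // ltW.
  by rewrite ler_pdivlMr // mulrC ltW.
apply: le_trans (ler_wpM2l c0 zq) _.
have -> : sigma / (sigma - 1) = 1 + q by rewrite /q; field; rewrite gt_eqF.
rewrite powRM ?invr_ge0 ?(ltW lh0) // mulrA.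
have qq : 1 + q - 1 = q by ring.
rewrite -[X in c * c `^ X]qq mulr_powRB1 //; last by rewrite addr_gt0.
rewrite -powR_inv1 ?(ltW lh0) // -powRrM mulN1r.
by rewrite lerDr mulr_ge0 ?powR_ge0 // ltW.
Qed.

End Young.

(** * The integral over space-time *)

Section SpaceTimeIntegral.
Context {R : realType} {G : metricGraph R} (mu : vertex G -> R).
Hypothesis mu_ge0 : forall x, 0 <= mu x.
Variable x0 : vertex G.
Local Notation V := (vertex G).
Local Notation E := (edge G).
Local Notation T := (gspace x0).
Local Notation leb := (@lebesgue_measure R).
Local Notation P := (stmeasure x0 mu_ge0).
Local Notation future := ([set: T] `*` `[(0 : R), +oo[).
Implicit Types f g : gpoint G -> R -> R.

Definition stfun f (z : T * measurableTypeR R) : R := f z.1 z.2.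
Definition st_integral f : \bar R := (\int[P]_(z in future) (stfun f z)%:E)%E.
Local Notation stint := st_integral.
Definition stmeas f := measurable_fun future (stfun f).

Lemma measurable_future : measurable future.
Proof. by apply: measurableX => //; exact: measurable_itv. Qed.

Lemma stintE f : stmeas f -> (forall p t, 0 <= t -> 0 <= f p t) ->
  stint f = (\int[leb]_(t in `[0%R, +oo[) gint_nneg mu (f^~ t))%E.
Proof.
move=> mf f0; rewrite (@tonelli_graph _ _ x0 _ mu_ge0) //.
by move=> p t; rewrite /= in_itv /= andbT; exact: f0.
Qed.

Lemma stint_ge0 f : (forall p t, 0 <= t -> 0 <= f p t) -> (0 <= stint f)%E.
Proof.
move=> f0; apply: integral_ge0 => -[p t] [_] /=; rewrite in_itv /= andbT => t0.
by rewrite lee_fin; exact: f0.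
Qed.

Lemma le_stint f g : (forall p t, 0 <= t -> 0 <= f p t) ->
  (forall p t, 0 <= t -> f p t <= g p t) -> (stint f <= stint g)%E.
Proof.
move=> f0 fg; apply: le_integral_ge0 => -[p t] [_] /=; rewrite in_itv /= andbT => t0;
  rewrite lee_fin; [exact: f0|exact: fg].
Qed.

Lemma stintD f g : stmeas f -> stmeas g -> (forall p t, 0 <= t -> 0 <= f p t) ->
  (forall p t, 0 <= t -> 0 <= g p t) ->
  stint (fun p t => f p t + g p t) = (stint f + stint g)%E.
Proof.
move=> mf mg f0 g0; rewrite /st_integral -ge0_integralD //; first exact: measurable_future.
- by move=> [p t] [_] /=; rewrite in_itv /= andbT lee_fin; exact: f0.
- exact/measurable_EFinP.
- by move=> [p t] [_] /=; rewrite in_itv /= andbT lee_fin; exact: g0.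
- exact/measurable_EFinP.
Qed.

Lemma stintZ (c : R) f : 0 <= c -> stmeas f -> (forall p t, 0 <= t -> 0 <= f p t) ->
  stint (fun p t => c * f p t) = (c%:E * stint f)%E.
Proof.
move=> c0 mf f0; rewrite /st_integral -ge0_integralZl_EFin //; first exact: measurable_future.
- by move=> [p t] [_] /=; rewrite in_itv /= andbT lee_fin; exact: f0.
- exact/measurable_EFinP.
Qed.

Lemma stmeas_st f : st_measurable f -> stmeas f.
Proof. exact: st_measurable_fun. Qed.

Lemma stmeasD f g : stmeas f -> stmeas g -> stmeas (fun p t => f p t + g p t).
Proof. exact: measurable_funD. Qed.

Lemma stmeasM f g : stmeas f -> stmeas g -> stmeas (fun p t => f p t * g p t).
Proof. exact: measurable_funM. Qed.

Lemma stmeas_comp (k : R -> R) f : measurable_fun setT k -> stmeas f ->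
  stmeas (fun p t => k (f p t)).
Proof. exact: measurableT_comp. Qed.

Lemma stmeas_space (g : gpoint G -> R) :
  (forall e : E, measurable_fun `]0, len e[ (on_edge g e)) ->
  stmeas (fun p _ => g p).
Proof.
move=> mg; apply: measurable_funTS.
exact: measurableT_comp (gmeasurable_fun mg) measurable_fst.
Qed.

Lemma stmeas_time (k : R -> R) : measurable_fun `[(0 : R), +oo[ k -> stmeas (fun _ t => k t).
Proof.
move=> mk; apply: (@measurable_comp _ _ _ _ _ _ `[(0 : R), +oo[) => //.
  by move=> _ [[p t] [/= _ t0] <-].
exact: measurable_funTS measurable_snd.
Qed.

Lemma stmeas_cst (c : R) : stmeas (fun _ _ => c).
Proof. exact: measurable_cst. Qed.

Lemma stint_restrict f (I : set R) : I `<=` `[0, +oo[ ->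
  (\int[leb]_(t in I) gint_nneg mu (f^~ t) =
   \int[leb]_(t in `[0%R, +oo[) gint_nneg mu (fun p => f p t * \1_I t)%R)%E.
Proof.
move=> I0; rewrite integral_mkcond [RHS]integral_mkcond; apply: eq_integral => t _.
rewrite /patch indicE; case: (boolP (t \in I)) => It.
  rewrite mem_set; last by apply: I0; move: It; rewrite inE.
  by congr gint_nneg; apply/funext => p; rewrite mulr1.
case: ifP => // _; rewrite [X in gint_nneg _ X](_ : _ = fun=> 0) ?gint_nneg0 //.
by apply/funext => p; rewrite mulr0.
Qed.

Lemma stint_on f (I : set R) : measurable I -> I `<=` `[0, +oo[ -> stmeas f ->
  (forall p t, 0 <= t -> 0 <= f p t) ->
  (\int[leb]_(t in I) gint_nneg mu (f^~ t))%E = stint (fun p t => f p t * \1_I t).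
Proof.
move=> mI I0 mf f0; rewrite stint_restrict // stintE //.
- apply: stmeasM => //; apply: stmeas_time; apply: measurable_funTS.
  exact: measurable_indic.
- by move=> p t t0; rewrite mulr_ge0 ?f0.
Qed.

Definition is_vertex (p : gpoint G) : R := if p is Vtx _ then 1 else 0.

Lemma stmeas_is_vertex : stmeas (fun p _ => is_vertex p).
Proof.
apply: stmeas_space => e; apply: (eq_measurable_fun (cst 0 : R -> R)) => [s|]; last exact: measurable_cst.
by rewrite inE /= in_itv /= => se; rewrite /on_edge edge_pt_inn.
Qed.

(** The two sums of [gint_nneg] can be integrated in time separately, as
    integrals of the restrictions of [f] to the vertices and to the open edges. *)
Lemma stint_on_split f (I : set R) : measurable I -> I `<=` `[0, +oo[ -> stmeas f ->
  (forall p t, 0 <= t -> 0 <= f p t) ->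
  stint (fun p t => f p t * \1_I t) =
    (\int[leb]_(t in I) (\esum_(x in [set: V]) (mu x * f (Vtx x) t)%:E) +
     \int[leb]_(t in I) (\esum_(e in [set: E])
       \int[leb]_(s in `]0%R, len e[) (f (edge_pt e s) t)%:E))%E.
Proof.
move=> mI I0 mf f0.
have mv := stmeas_is_vertex.
pose f1 p t := f p t * is_vertex p; pose f2 p t := f p t * (1 + - 1 * is_vertex p).
have v0 p : 0 <= is_vertex p by case: p.
have v1 p : 0 <= 1 + - 1 * is_vertex p by case: p => [x|e s se] /=; lra.
have m1 : stmeas f1 by exact: stmeasM.
have m2 : stmeas f2.
  by apply: stmeasM => //; apply: stmeasD; [|apply: stmeasM mv]; exact: stmeas_cst.
have p1 p t : 0 <= t -> 0 <= f1 p t by move=> t0; rewrite mulr_ge0 ?f0.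
have p2 p t : 0 <= t -> 0 <= f2 p t by move=> t0; rewrite mulr_ge0 ?f0.
have mt : stmeas (fun _ t => \1_I t).
  by apply: stmeas_time; apply: measurable_funTS; exact: measurable_indic.
transitivity (stint (fun p t => f1 p t * \1_I t)%R + stint (fun p t => f2 p t * \1_I t)%R)%E.
  rewrite -stintD.
  - congr st_integral; apply/funext => p; apply/funext => t; rewrite /f1 /f2; ring.
  - exact: stmeasM.
  - exact: stmeasM.
  - by move=> p t t0; rewrite mulr_ge0 ?p1.
  - by move=> p t t0; rewrite mulr_ge0 ?p2.
rewrite -!stint_on //; congr (_ + _)%E; apply: eq_integral => t _; rewrite /gint_nneg.
- rewrite [X in (_ + X)%E]esum1 ?adde0; first by apply: eq_esum => x _; rewrite /f1 mulr1.
  move=> e _; apply: integral0_eq => s /=; rewrite in_itv /= => se.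
  by rewrite /on_edge edge_pt_inn /f1 mulr0.
- rewrite [X in (X + _)%E]esum1 ?add0e; last by move=> x _; rewrite /f2 mulr1 subrr !mulr0.
  apply: eq_esum => e _; apply: eq_integral => s; rewrite inE /= in_itv /= => se.
  by rewrite /on_edge edge_pt_inn /f2 mulr0 addr0 mulr1.
Qed.

End SpaceTimeIntegral.

(** * The estimate for one test function *)

(** [A] and [B] stand for the reaction and the initial terms, [T1] and [T3] for
    the terms with the Laplacian and with the time derivative. *)
Lemma absorb_lower_bounds {R : realType} (A B N1 N3 T1 T3 : \bar R) :
  (- N1 <= T1 -> - N3 <= T3 -> N1 < +oo -> N3 < +oo -> 0 <= N1 -> 0 <= N3 -> 0 <= A ->
   T1 + A + T3 + B <= 0 -> A + B <= N1 + N3)%E.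
Proof.
case: N1 => [a1| |] //; case: N3 => [a3| |] // h1 h3 _ _ _ _ A0 hs.
have {hs h1 h3} : (- a1%:E + A + - a3%:E + B <= 0)%E.
  by apply: le_trans hs; rewrite leeD // leeD // leeD.
case: A A0 => [a| |] //; case: B => [b| |] //= _; rewrite ?lee_fin ?leNye //.
by lra.
Qed.

Section Estimate.
Context {R : realType} {G : metricGraph R}.
Local Notation V := (vertex G).
Local Notation E := (edge G).
Local Notation leb := (@lebesgue_measure R).
Context (mu : V -> R) (omega : V -> V -> R) (x0 : V).
Hypotheses (mu_gt0 : forall x, 0 < mu x)
  (omega_ge0 : forall x y, 0 <= omega x y)
  (omega_sym : forall x y, omega x y = omega y x)
  (omega_adj : forall x y, 0 < omega x y <-> joined x y)
  (connected : path_connected_graph G) (G_locally_finite : locally_finite G).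
Variables (sigma delta : R).
Hypothesis sigma_gt1 : 1 < sigma.
Variable h : gpoint G -> R -> R.
Hypotheses (h_gt0 : forall p (t : R), 0 <= t -> 0 < h p t)
  (h_measurable : st_measurable h).
Variables (u0 : gpoint G -> R) (u : gpoint G -> R -> R).
Hypothesis u_solution : very_weak_solution mu omega h sigma u0 u.
Variables (K Cw r kappa : R) (k : nat) (v : V -> R).
Hypotheses (K_ge0 : 0 <= K) (Cw_ge0 : 0 <= Cw) (r_gt0 : 0 < r) (kappa_gt0 : 0 < kappa).
Hypothesis spec : cutoff_spec mu omega x0 delta r kappa K Cw v.
Hypothesis uX : L1loc_X mu x0 (delta / r) u.

Let mu_ge0 x : 0 <= mu x := ltW (mu_gt0 x).
Local Notation stint := (st_integral mu_ge0 x0).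
Local Notation stmeas := (@stmeas R G x0).
Local Notation ph := (extend v).
Local Notation eta := (tcut r k).
Local Notation deta := (dtcut r k).
Local Notation L := (lap_extend mu omega v).
Local Notation w := (weight x0 delta r).

Lemma weight_ge0 p : 0 <= w p. Proof. exact: expR_ge0. Qed.

Lemma measurable_weight e : measurable_fun `]0, len e[ (on_edge w e).
Proof.
apply: (measurableT_comp (@measurable_expR R)); apply: measurable_funM => //.
exact: measurable_gdist.
Qed.

Lemma stmeas_u : stmeas u.
Proof. by apply: stmeas_st; case: uX. Qed.

Lemma stmeas_norm_u : stmeas (fun p t => `|u p t|).
Proof. by apply: (stmeas_comp (k := fun x : R => `|x|)) stmeas_u; exact: normr_measurable. Qed.

Lemma stmeas_indic (I : set R) : measurable I -> stmeas (fun _ t => \1_I t).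
Proof.
by move=> mI; apply: stmeas_time; apply: measurable_funTS; exact: measurable_indic.
Qed.

(** This is the hypothesis that [u] lies in [L^1_loc (X_alpha)]. *)
Lemma stint_weight_u_fin (tau : R) : 0 < tau ->
  (stint (fun p t => w p * `|u p t| * \1_`[0, tau] t)%R < +oo)%E.
Proof.
move=> tau0; have [_ /(_ _ tau0)] := uX; rewrite /normX.
rewrite (@stint_on _ _ _ mu_ge0 x0 (fun p t => w p * `|u p t|)) //.
- by move=> t; rewrite /= !in_itv /= andbT => /andP[].
- by apply: stmeasM stmeas_norm_u; apply: stmeas_space; exact: measurable_weight.
- by move=> p t _; rewrite mulr_ge0 ?weight_ge0.
Qed.

Definition reaction p t : R := h p t * `|u p t| `^ sigma.

(** The integrand left on the right-hand side after moving all derivatives to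
    the test function. *)
Definition defect p t : R := `|u p t| * (eta t * `|L p| + ph p * `|deta t|).

Lemma stmeas_h_pow (q : R) : stmeas (fun p t => h p t `^ q).
Proof. by apply: (stmeas_comp (k := fun x : R => x `^ q)) (stmeas_st h_measurable); exact: measurable_powR. Qed.

Lemma stmeas_reaction : stmeas reaction.
Proof.
apply: stmeasM; first exact: stmeas_st.
by apply: (stmeas_comp (k := fun x : R => x `^ sigma)) stmeas_norm_u; exact: measurable_powR.
Qed.

Lemma reaction_ge0 p t : 0 <= t -> 0 <= reaction p t.
Proof. by move=> t0; rewrite mulr_ge0 ?powR_ge0 // ltW ?h_gt0. Qed.

Lemma stmeas_ph : stmeas (fun p _ => ph p).
Proof. by apply: stmeas_space => e; exact: measurable_extend. Qed.

Lemma stmeas_L : stmeas (fun p _ => L p).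
Proof. by apply: stmeas_space => e; exact: measurable_lap_extend. Qed.

Lemma stmeas_eta : stmeas (fun _ t => eta t).
Proof.
apply: stmeas_time; apply: measurable_funTS; apply: continuous_measurable_fun.
exact: continuous_tcut.
Qed.

Lemma stmeas_deta : stmeas (fun _ t => deta t).
Proof.
apply: stmeas_time; apply: measurable_funTS; apply: continuous_measurable_fun.
exact: continuous_dtcut.
Qed.

Lemma stmeas_normL : stmeas (fun p t => `|u p t| * (eta t * `|L p|)).
Proof.
apply: stmeasM stmeas_norm_u _; apply: stmeasM stmeas_eta _.
by apply: (stmeas_comp (k := fun x : R => `|x|)) stmeas_L; exact: normr_measurable.
Qed.

Lemma stmeas_normdeta : stmeas (fun p t => `|u p t| * (ph p * `|deta t|)).
Proof.
apply: stmeasM stmeas_norm_u _; apply: stmeasM stmeas_ph _.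
by apply: (stmeas_comp (k := fun x : R => `|x|)) stmeas_deta; exact: normr_measurable.
Qed.

Lemma indic_before (t tau : R) : 0 <= t -> t <= tau -> \1_(`[0, tau]%classic) t = 1 :> R.
Proof. by move=> t0 tt; rewrite indicE mem_set //= in_itv /= t0. Qed.

(** The cutoff and its Laplacian are at most a multiple of the weight, and the
    temporal factors live on [0, 2 r]. *)
Lemma defect_fin : (stint (fun p t => `|u p t| * (eta t * `|L p|))%R < +oo)%E /\
  (stint (fun p t => `|u p t| * (ph p * `|deta t|))%R < +oo)%E.
Proof.
have m1 : stmeas (fun p t => w p * `|u p t| * \1_`[0, 2 * r] t).
  apply: stmeasM; last by apply: stmeas_indic; exact: measurable_itv.
  by apply: stmeasM stmeas_norm_u; apply: stmeas_space; exact: measurable_weight.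
have p1 p t : 0 <= t -> 0 <= w p * `|u p t| * \1_`[0, 2 * r] t.
  by move=> _; rewrite !mulr_ge0 ?weight_ge0.
have bound (f : gpoint G -> R -> R) (c : R) : 0 <= c ->
    (forall p t, 0 <= t -> 0 <= f p t) ->
    (forall p t, 0 <= t -> f p t <= c * (w p * `|u p t| * \1_`[0, 2 * r] t)) ->
    (stint f < +oo)%E.
  move=> c0 f0 fc; apply: le_lt_trans (le_stint mu_ge0 x0 f0 fc) _.
  rewrite stintZ //; apply: lte_mul_pinfty => //; apply: stint_weight_u_fin.
  by rewrite mulr_gt0.
have e0 t : 0 <= eta t by exact: tcut_ge0.
split.
  apply: (@bound _ (K / r * (Cw + Cw))).
  - by rewrite mulr_ge0 ?addr_ge0 // divr_ge0 // ltW.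
  - by move=> p t _; rewrite !mulr_ge0.
  - move=> p t t0; have [tr|tr] := leP t (2 * r); last first.
      rewrite tcut_after // ?(ltW tr) // mul0r mulr0; apply: mulr_ge0 (p1 _ _ t0).
      by rewrite mulr_ge0 ?addr_ge0 // divr_ge0 // ltW.
    rewrite indic_before // mulr1.
    have : `|L p| <= K / r * (Cw + Cw) * w p.
      apply: le_trans (cut_lap spec p) _.
      rewrite -[leRHS]mulrA ler_wpM2l ?divr_ge0 // ?(ltW r_gt0) // mulrDl lerD ?(cut_le spec) //.
      by rewrite ge_min lexx orbT.
    move=> hL; rewrite mulrA [leRHS]mulrC ler_wpM2l // -[leRHS]mul1r.
    by apply: ler_pM => //; exact: tcut_le1.
apply: (@bound _ (4 * k.+1%:R / r * Cw)).
- by rewrite mulr_ge0 // divr_ge0 ?mulr_ge0 // ltW.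
- by move=> p t _; rewrite !mulr_ge0 ?(cut_ge0 spec).
- move=> p t t0; have [tr|tr] := leP t (2 * r); last first.
    rewrite dtcut_after // ?(ltW tr) // normr0 !mulr0; apply: mulr_ge0 (p1 _ _ t0).
    by rewrite mulr_ge0 // divr_ge0 // ltW.
  rewrite indic_before // mulr1.
  have : `|deta t| <= 4 * k.+1%:R / r.
    by apply: le_trans (@dtcut_le _ r k 0 t r_gt0 _) _; rewrite ?mulr0 // powRr0 mulr1.
  move=> hd; rewrite mulrA [leRHS]mulrC ler_wpM2l // [leRHS](_ : _ = Cw * w p * (4 * k.+1%:R / r)); last by ring.
  by apply: ler_pM; rewrite ?(cut_ge0 spec) ?(cut_le spec).
Qed.

Lemma lap_extendZ (c : R) p :
  lap_extend mu omega (fun x => c * v x) p = c * L p.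
Proof.
case: p => [x|e s _] /=; last by rewrite /d2smoothstep; ring.
rewrite /laplacian_V mulrCA; congr (_ * _); rewrite mulr_fsumr.
by apply: eq_fsbigr => y _; ring.
Qed.

Let eta_ge0 t : 0 <= eta t. Proof. exact: tcut_ge0. Qed.

Let ph_ge0 p : 0 <= ph p. Proof. exact: (cut_ge0 spec). Qed.

Lemma reaction_cut_ge0 p t : 0 <= t -> 0 <= reaction p t * (ph p * eta t).
Proof. by move=> t0; rewrite mulr_ge0 ?reaction_ge0 // mulr_ge0. Qed.

Lemma stmeas_reaction_cut : stmeas (fun p t => reaction p t * (ph p * eta t)).
Proof. exact: stmeasM stmeas_reaction (stmeasM stmeas_ph stmeas_eta). Qed.

(** Green's formula at each time, for the vertex function [eta t * v]. *)
Lemma laplacian_term_ge :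
  (- stint (fun p t => `|u p t| * (eta t * `|L p|))%R <=
   \int[leb]_(t in `[0%R, +oo[)
     gint mu (fun p => ph p * eta t * laplacian mu omega (u^~ t) p)%R)%E.
Proof.
rewrite stintE; [|exact: stmeas_normL|by move=> p t _; rewrite !mulr_ge0].
apply: integral_ge_opp => t; rewrite /= in_itv /= andbT => t0.
  by apply: gint_nneg_ge0 => // p; rewrite !mulr_ge0.
have fS : finite_set [set x | v x != 0] by exact: (cut_support spec).
have vS x : ~ [set x | v x != 0] x -> eta t * v x = 0.
  by move=> /negP; rewrite negbK => /eqP ->; rewrite mulr0.
have := green_graph mu_gt0 omega_ge0 omega_sym omega_adj G_locally_finite fS vS
  (vws_classD u_solution t0) (vws_kirchhoff u_solution t0).
rewrite (_ : (fun p => `|_|) = (fun p => `|u p t| * (eta t * `|L p|))); last first.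
  by apply/funext => p; rewrite lap_extendZ !normrM (ger0_norm (eta_ge0 t)).
move=> /le_trans; apply.
rewrite (_ : (fun p => _) = (fun p => ph p * eta t * laplacian mu omega (u^~ t) p)) //.
by apply/funext => p; rewrite extendZ [eta t * _]mulrC.
Qed.

Lemma reaction_termE :
  (\int[leb]_(t in `[0%R, +oo[)
     gint mu (fun p => h p t * `|u p t| `^ sigma * (ph p * eta t))%R =
   stint (fun p t => reaction p t * (ph p * eta t))%R)%E.
Proof.
rewrite stintE; [|exact: stmeas_reaction_cut|exact: reaction_cut_ge0].
apply: eq_integral => t; rewrite inE /= in_itv /= andbT => t0.
by rewrite gint_ge0E // => p; exact: reaction_cut_ge0.
Qed.

Lemma time_term_ge :
  (- stint (fun p t => `|u p t| * (ph p * `|deta t|))%R <=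
   \int[leb]_(t in `[0%R, +oo[)
     gint mu (fun p => u p t * derive_in `[0, +oo[ (fun t => ph p * eta t) t)%R)%E.
Proof.
rewrite stintE; [|exact: stmeas_normdeta|by move=> p t _; rewrite !mulr_ge0].
apply: integral_ge_opp => t; rewrite /= in_itv /= andbT => t0.
  by apply: gint_nneg_ge0 => // p; rewrite !mulr_ge0.
apply: le_trans (gint_ge_opp mu_ge0 _).
rewrite leeN2; apply: le_gint_nneg => // p.
by rewrite (C1_in_cut (ph p) r k).2 // !normrM (ger0_norm (ph_ge0 p)).
Qed.

Lemma stint_defectE : stint defect =
  (stint (fun p t => `|u p t| * (eta t * `|L p|))%R +
   stint (fun p t => `|u p t| * (ph p * `|deta t|))%R)%E.
Proof.
rewrite -stintD; [|exact: stmeas_normL|exact: stmeas_normdeta|..].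
- by congr (st_integral _ _ _); apply/funext => p; apply/funext => t; rewrite /defect mulrDr.
- by move=> p t _; rewrite !mulr_ge0.
- by move=> p t _; rewrite !mulr_ge0.
Qed.

Lemma stint_defect_fin : (stint defect < +oo)%E.
Proof. by rewrite stint_defectE lte_add_pinfty ?defect_fin.1 ?defect_fin.2. Qed.

(** Both parts of the defect are finite, so they can be moved across the
    inequality although the terms of the very weak formulation may be infinite.
    *)
Lemma integral_inequality :
  (stint (fun p t => reaction p t * (ph p * eta t))%R + gint mu (fun p => u0 p * ph p)%R
   <= stint defect)%E.
Proof.
rewrite stint_defectE.
have A0 : (0 <= stint (fun p t => reaction p t * (ph p * eta t))%R)%E.
  exact: stint_ge0 reaction_cut_ge0.
have n1 : (0 <= stint (fun p t => `|u p t| * (eta t * `|L p|))%R)%E.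
  by apply: stint_ge0 => p t _; rewrite !mulr_ge0.
have n3 : (0 <= stint (fun p t => `|u p t| * (ph p * `|deta t|))%R)%E.
  by apply: stint_ge0 => p t _; rewrite !mulr_ge0.
apply: (absorb_lower_bounds laplacian_term_ge time_term_ge defect_fin.1 defect_fin.2 n1 n3 A0).
have u0E : gint mu (fun p => u0 p * (ph p * eta 0)) = gint mu (fun p => u0 p * ph p).
  by congr gint; apply/funext => p; rewrite tcut_before ?(ltW r_gt0) // mulr1.
apply: le_trans (vws_ineq u_solution (cut_test spec k)).
by apply: leeD; [apply: leeD => //; apply: leeD => //; rewrite reaction_termE|rewrite u0E].
Qed.

Local Notation q := ((sigma - 1)^-1).
Local Notation B := (ball (Vtx x0 : gpoint G) r).

(** The indicator of the complement of the cylinder on which the test function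
    is constant. *)
Definition late p t : R := 1 - \1_B p * \1_(`]-oo, r] : set R) t.

Lemma late_ge0 p t : 0 <= late p t.
Proof. by rewrite /late !indicE; do 2 case: (_ \in _); rewrite /=; lra. Qed.

Lemma late_le1 p t : late p t <= 1.
Proof. by rewrite /late !indicE; do 2 case: (_ \in _); rewrite /=; lra. Qed.

Lemma measurable_indic_ball e : measurable_fun `]0, len e[ (on_edge (\1_B : gpoint G -> R) e).
Proof.
have mB : measurable_fun setT (\1_(`]-oo, r[ : set R) : R -> R).
  by apply: measurable_indic; exact: measurable_itv.
pose f := (\1_(`]-oo, r[ : set R) : R -> R) \o on_edge (fun p => gdist p (Vtx x0)) e.
apply: (eq_measurable_fun f) => [s _|]; last first.
  by apply: measurableT_comp mB _; exact: measurable_gdist.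
rewrite /f /on_edge /= !indicE.
have gB := @ball_gdist R G connected (Vtx x0) (edge_pt e s) r.
have [pB|pB] := pselect (ball (Vtx x0 : gpoint G) r (edge_pt e s)).
  by rewrite !mem_set //= in_itv /= gdistC //; exact/gB.
rewrite !memNset //= in_itv /= gdistC // => ?; exact/pB/gB.
Qed.

(** The density that the growth hypotheses control; it comes from the second
    term of Young's inequality. *)
Definition growth_mass p t : R := h p t `^ (- q) * w p * (late p t * \1_`[0, 2 * r] t).

(** The error made by truncating the exponential at level [kappa]. *)
Definition kappa_mass p t : R := `|u p t| * Num.min kappa (Cw * w p) * \1_`[0, 2 * r] t.

Hypothesis k_large : (2 * k.+1)%:R * sigma^-1 <= (2 * k).+1%:R.

(** On the cylinder both derivatives of the test function vanish, and after time
    [2 r] both temporal factors do. Elsewhere the bounds on the two derivatives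
    give [|u| phi (c / r) eta^(1 / sigma)] and the truncation error, and Young's
    inequality splits the former. *)
Lemma defect_le (lam : R) p t : 0 < lam -> 0 <= t ->
  defect p t <= lam * (reaction p t * (ph p * eta t) * late p t) +
    lam `^ (- q) * (((K + 4 * k.+1%:R) / r) `^ (sigma / (sigma - 1)) * Cw) * growth_mass p t +
    K / r * kappa_mass p t.
Proof.
move=> l0 t0; have s0 : 0 < sigma by exact: lt_trans sigma_gt1.
have Kr : 0 <= K / r by rewrite divr_ge0 // ltW.
have mn : 0 <= Num.min kappa (Cw * w p).
  by rewrite le_min (ltW kappa_gt0) mulr_ge0 ?weight_ge0.
have q1 : 0 <= lam * (reaction p t * (ph p * eta t) * late p t).
  by rewrite mulr_ge0 ?(ltW l0) // mulr_ge0 ?late_ge0 ?reaction_cut_ge0.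
have q2 : 0 <= lam `^ (- q) * (((K + 4 * k.+1%:R) / r) `^ (sigma / (sigma - 1)) * Cw) *
    growth_mass p t.
  by rewrite !mulr_ge0 ?powR_ge0 ?weight_ge0 ?late_ge0.
have q3 : 0 <= K / r * kappa_mass p t by rewrite mulr_ge0 // !mulr_ge0.
have pos := addr_ge0 (addr_ge0 q1 q2) q3.
have [tr|tr] := leP t (2 * r); last first.
  apply: le_trans pos; rewrite /defect dtcut_after ?tcut_after ?(ltW tr) //.
  by rewrite mul0r normr0 mulr0 add0r mulr0.
have [[pr tr']|far] := pselect (gdist p (Vtx x0) < r /\ t <= r).
  apply: le_trans pos; rewrite /defect (cut_lap_in spec pr) dtcut_before //.
  by rewrite normr0 mulr0 mulr0 add0r mulr0.
have lateE : late p t = 1.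
  rewrite /late !indicE; case: (boolP (p \in _)); last by rewrite mul0r subr0.
  rewrite inE => /(ball_gdist connected); rewrite gdistC // => pB.
  case: (boolP (t \in _)); last by rewrite mulr0 subr0.
  by rewrite inE /= in_itv /= => tr'; case: far.
rewrite lateE mulr1 /growth_mass /kappa_mass lateE indic_before // !mulr1.
set c := (K + 4 * k.+1%:R) / r; have c0 : 0 <= c.
  by rewrite divr_ge0 ?addr_ge0 ?mulr_ge0 // ltW.
set z := eta t `^ sigma^-1; have z0 : 0 <= z by exact: powR_ge0.
(* The Laplacian only produces a factor eta, which is below eta^(1 / sigma) as
   eta <= 1. *)
have ez : eta t <= z.
  have [->//|e0] := eqVneq (eta t) 0; rewrite -{1}[eta t]powRr1 //.
  apply: ger_powR; first by rewrite tcut_le1 lt_neqAle eq_sym e0 eta_ge0.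
  by rewrite invf_le1 // ltW.
have hd : `|deta t| <= 4 * k.+1%:R / r * z by exact: dtcut_le.
have hL := cut_lap spec p.
have step : eta t * `|L p| + ph p * `|deta t| <=
    ph p * (c * z) + K / r * Num.min kappa (Cw * w p).
  have -> : ph p * (c * z) + K / r * Num.min kappa (Cw * w p) =
    (z * (K / r * ph p) + 1 * (K / r * Num.min kappa (Cw * w p))) + ph p * (4 * k.+1%:R / r * z).
    by rewrite /c; field; rewrite gt_eqF.
  rewrite lerD ?ler_wpM2l //; apply: le_trans (ler_wpM2l (eta_ge0 t) hL) _.
  rewrite mulrDr mulrDr lerD ?ler_wpM2r ?mulr_ge0 //.
  - by rewrite invr_ge0 ltW.
  - by rewrite invr_ge0 ltW.
  - exact: tcut_le1.
apply: le_trans (ler_wpM2l (normr_ge0 _) step) _.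
rewrite mulrDr lerD //; last by rewrite mulrCA mulrC.
have := @young_split R `|u p t| (c * z) c (h p t) (eta t) lam sigma sigma_gt1 l0 (h_gt0 p t0)
  (normr_ge0 _) c0 (eta_ge0 t) (lexx _).
move=> /(ler_wpM2l (ph_ge0 p)) y; rewrite mulrCA; apply: le_trans y _.
rewrite mulrDr lerD //; first by rewrite /reaction le_eqVlt; apply/orP; left; apply/eqP; ring.
rewrite [leRHS](_ : _ = Cw * w p * (lam `^ (- q) * (c `^ (sigma / (sigma - 1)) * h p t `^ (- q)))).
  by rewrite ler_wpM2r ?mulr_ge0 ?powR_ge0 // (cut_le spec).
by ring.
Qed.

Lemma stmeas_weight : stmeas (fun p _ => w p).
Proof. by apply: stmeas_space => e; exact: measurable_weight. Qed.

Lemma stmeas_ball : stmeas (fun p _ => \1_B p).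
Proof. by apply: stmeas_space => e; exact: measurable_indic_ball. Qed.

Lemma stmeas_late : stmeas late.
Proof.
apply: stmeasD; first exact: stmeas_cst.
apply: (stmeas_comp (k := fun x : R => - x)); first exact: oppr_measurable.
by apply: stmeasM stmeas_ball _; apply: stmeas_indic; exact: measurable_itv.
Qed.

Lemma stmeas_growth_mass : stmeas growth_mass.
Proof.
apply: stmeasM; first exact: stmeasM (stmeas_h_pow _) stmeas_weight.
by apply: stmeasM stmeas_late _; apply: stmeas_indic; exact: measurable_itv.
Qed.

Lemma growth_mass_ge0 p t : 0 <= growth_mass p t.
Proof. by rewrite !mulr_ge0 ?powR_ge0 ?weight_ge0 ?late_ge0. Qed.

Lemma stmeas_kappa_mass : stmeas kappa_mass.
Proof.
apply: stmeasM; last by apply: stmeas_indic; exact: measurable_itv.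
apply: stmeasM stmeas_norm_u _.
apply: (@stmeas_comp _ _ _ (fun x => Num.min kappa (Cw * x)) (fun p _ => w p)).
  by apply: measurable_minr => //; exact: measurable_funM.
exact: stmeas_weight.
Qed.

Lemma kappa_mass_ge0 p t : 0 <= kappa_mass p t.
Proof.
by rewrite !mulr_ge0 // le_min (ltW kappa_gt0) mulr_ge0 ?weight_ge0.
Qed.

Definition late_mass p t : R := reaction p t * (ph p * eta t) * late p t.

Lemma stmeas_late_mass : stmeas late_mass.
Proof. exact: stmeasM stmeas_reaction_cut stmeas_late. Qed.

Lemma late_mass_ge0 p t : 0 <= t -> 0 <= late_mass p t.
Proof. by move=> t0; rewrite mulr_ge0 ?late_ge0 ?reaction_cut_ge0. Qed.

(** Multiplied by the bound [4 C r^(sigma / (sigma - 1))] on the growth mass, it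
    no longer depends on [r]. *)
Definition young_const (lam : R) : R :=
  lam `^ (- q) * (((K + 4 * k.+1%:R) / r) `^ (sigma / (sigma - 1)) * Cw).

Lemma young_const_ge0 lam : 0 <= young_const lam.
Proof. by rewrite !mulr_ge0 ?powR_ge0. Qed.

Lemma stint_defect_le (lam : R) : 0 < lam ->
  (stint defect <= lam%:E * stint late_mass + (young_const lam)%:E * stint growth_mass +
    (K / r)%:E * stint kappa_mass)%E.
Proof.
move=> l0; have Kr : 0 <= K / r by rewrite divr_ge0 // ltW.
pose f1 p t := lam * late_mass p t.
pose f2 p t := young_const lam * growth_mass p t.
pose f3 p t := K / r * kappa_mass p t.
have m1 : stmeas f1 by apply: stmeasM stmeas_late_mass; exact: stmeas_cst.
have m2 : stmeas f2 by apply: stmeasM stmeas_growth_mass; exact: stmeas_cst.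
have m3 : stmeas f3 by apply: stmeasM stmeas_kappa_mass; exact: stmeas_cst.
have p1 p t : 0 <= t -> 0 <= f1 p t.
  by move=> t0; rewrite mulr_ge0 ?late_mass_ge0 // ltW.
have p2 p t : 0 <= t -> 0 <= f2 p t.
  by move=> t0; apply: mulr_ge0; [exact: young_const_ge0|exact: growth_mass_ge0].
have p3 p t : 0 <= t -> 0 <= f3 p t.
  by move=> t0; apply: mulr_ge0 => //; exact: kappa_mass_ge0.
have <- : stint f1 = (lam%:E * stint late_mass)%E.
  by rewrite -stintZ ?(ltW l0) //; [exact: stmeas_late_mass|exact: late_mass_ge0].
have <- : stint f2 = ((young_const lam)%:E * stint growth_mass)%E.
  rewrite -stintZ ?young_const_ge0 //; first exact: stmeas_growth_mass.
  by move=> p t _; exact: growth_mass_ge0.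
have <- : stint f3 = ((K / r)%:E * stint kappa_mass)%E.
  rewrite -stintZ //; first exact: stmeas_kappa_mass.
  by move=> p t _; exact: kappa_mass_ge0.
rewrite -!stintD //; last 2 first.
- exact: stmeasD.
- by move=> p t t0; rewrite addr_ge0 ?p1 ?p2.
apply: le_stint => p t t0; last exact: defect_le.
by rewrite mulr_ge0 // addr_ge0 // mulr_ge0.
Qed.

Definition growth_weight p t : R := h p t `^ (- q) * w p.

Hypothesis (C : R).
Local Notation bd := ((C * r `^ (sigma / (sigma - 1)))%:E).
Hypotheses
  (growth_Vin : (\int[leb]_(t in `[r, (2 * r)%R])
     (\esum_(x in [set x | B (Vtx x)]) (mu x * growth_weight (Vtx x) t)%:E) <= bd)%E)
  (growth_Ein : (\int[leb]_(t in `[r, (2 * r)%R])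
     (\esum_(e in [set: E]) \int[leb]_(s in `]0%R, len e[)
        (growth_weight (edge_pt e s) t * \1_B (edge_pt e s))%:E) <= bd)%E)
  (growth_Vout : (\int[leb]_(t in `[0%R, (2 * r)%R])
     (\esum_(x in [set x | (~` B) (Vtx x)]) (mu x * growth_weight (Vtx x) t)%:E) <= bd)%E)
  (growth_Eout : (\int[leb]_(t in `[0%R, (2 * r)%R])
     (\esum_(e in [set: E]) \int[leb]_(s in `]0%R, len e[)
        (growth_weight (edge_pt e s) t * \1_(~` B) (edge_pt e s))%:E) <= bd)%E).

(** The late region before time [2 r] is covered by the ball during [r, 2 r] and
    the complement of the ball during [0, 2 r]; each of the two, on vertices and
    on edges, is one of the four growth hypotheses. *)
Lemma stint_growth_mass : (stint growth_mass <= bd + bd + (bd + bd))%E.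
Proof.
have mW : stmeas growth_weight by exact: stmeasM (stmeas_h_pow _) stmeas_weight.
have W0 p t : 0 <= growth_weight p t by rewrite mulr_ge0 ?powR_ge0 ?weight_ge0.
have i0 : `[r, 2 * r]%classic `<=` `[0, +oo[%classic.
  by move=> t; rewrite /= !in_itv /= andbT => /andP[rt _]; rewrite (le_trans _ rt) // ltW.
have j0 : `[0, 2 * r]%classic `<=` `[0, +oo[%classic.
  by move=> t; rewrite /= !in_itv /= andbT => /andP[].
have mC : stmeas (fun p _ => \1_(~` B) p).
  rewrite (_ : (fun p _ => _) = (fun p _ => 1 + - 1 * \1_B p)).
    by apply: stmeasD; [|apply: stmeasM stmeas_ball]; exact: stmeas_cst.
  apply/funext => p; apply/funext => t; rewrite !indicE in_setC.
  by case: (_ \in _) => /=; ring.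
pose f1 p t := growth_weight p t * \1_B p; pose f2 p t := growth_weight p t * \1_(~` B) p.
have m1 : stmeas f1 by exact: stmeasM stmeas_ball.
have m2 : stmeas f2 by exact: stmeasM mC.
have p1 p t : 0 <= t -> 0 <= f1 p t by move=> _; rewrite mulr_ge0.
have p2 p t : 0 <= t -> 0 <= f2 p t by move=> _; rewrite mulr_ge0.
have e1 (A : set (gpoint G)) t : \esum_(x in [set x | A (Vtx x)]) (mu x * growth_weight (Vtx x) t)%:E =
   \esum_(x in [set: V]) (mu x * (growth_weight (Vtx x) t * \1_A (Vtx x)))%:E.
  rewrite esum_mkcond; apply: eq_esum => x _; rewrite indicE.
  have [Ax|Ax] := pselect (A (Vtx x)); first by rewrite !mem_set // mulr1.
  by rewrite !memNset // !mulr0.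
have : (stint (fun p t => f1 p t * \1_`[r, 2 * r] t)%R +
        stint (fun p t => f2 p t * \1_`[0, 2 * r] t)%R <= bd + bd + (bd + bd))%E.
  rewrite (stint_on_split mu_ge0 (measurable_itv `[r, 2 * r]) i0 m1 p1).
  rewrite (stint_on_split mu_ge0 (measurable_itv `[0, 2 * r]) j0 m2 p2).
  apply: leeD; apply: leeD.
  - apply: le_trans growth_Vin; rewrite le_eqVlt; apply/orP; left; apply/eqP.
    by apply: eq_integral => t _; rewrite e1.
  - exact: growth_Ein.
  - apply: le_trans growth_Vout; rewrite le_eqVlt; apply/orP; left; apply/eqP.
    by apply: eq_integral => t _; rewrite e1.
  - exact: growth_Eout.
apply: le_trans; rewrite -stintD; last 4 first.
- by apply: stmeasM m1 _; apply: stmeas_indic; exact: measurable_itv.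
- by apply: stmeasM m2 _; apply: stmeas_indic; exact: measurable_itv.
- by move=> p t t0; rewrite mulr_ge0 ?p1.
- by move=> p t t0; rewrite mulr_ge0 ?p2.
apply: le_stint => p t t0; first exact: growth_mass_ge0.
rewrite /growth_mass -/(growth_weight p t) /f1 /f2.
move: (growth_weight p t) (W0 p t) => W W1; rewrite -!mulrA -mulrDr ler_wpM2l {W W1}//.
rewrite /late !indicE in_setC; case: (p \in _) => /=; last by rewrite !mul0r add0r mul1r subr0 mul1r.
rewrite mul1r mul0r addr0 mul1r.
have [tr|tr] := leP t (2 * r); last first.
  rewrite [X in _ * (nat_of_bool X)%:R <= _]memNset ?mulr0 //= in_itv /= => /andP[_].
  by rewrite leNgt tr.
have [rt|rt] := leP r t.
  rewrite [X in _ <= (nat_of_bool X)%:R]mem_set; last by rewrite /= in_itv /= rt tr.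
  by do 2 case: (_ \in _) => /=; lra.
rewrite [X in 1 - (nat_of_bool X)%:R]mem_set; first by rewrite subrr mul0r.
by rewrite /= in_itv /= ltW.
Qed.

End Estimate.

(** * Limit theorems on space-time *)

Section Limits.
Local Open Scope ereal_scope.
Context d (T : measurableType d) (R : realType) (m : {measure set T -> \bar R}).
Variables (D : set T) (mD : measurable D).
Variables (f_ : (T -> \bar R)^nat) (f : T -> \bar R).
Hypotheses (mf : forall n, measurable_fun D (f_ n))
  (f0 : forall n x, D x -> 0 <= f_ n x)
  (ff : forall x, D x -> f_ n x @[n --> \oo] --> f x).

(** Fatou's lemma in the form of an eventual lower bound, which combines better
    with inequalities between extended reals than lower limits do. *)
Lemma fatou_lt (c : \bar R) : c < \int[m]_(x in D) f x ->
  exists N, forall n, (N <= n)%N -> c < \int[m]_(x in D) f_ n x.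
Proof.
have -> : \int[m]_(x in D) f x = \int[m]_(x in D) limn_einf (f_^~ x).
  apply: eq_integral => x; rewrite inE => /ff fx.
  by rewrite is_cvg_limn_einfE; [apply/esym/cvg_lim|apply/cvg_ex; exists (f x)].
move=> /lt_le_trans/(_ (fatou m mD mf f0)).
rewrite limn_einf_lim (cvg_lim _ (@cvg_einfs_sup _ _)) // => /ereal_sup_gt[_ [N _ <-] cN].
exists N => n Nn; apply: lt_le_trans cN _.
by apply: ereal_inf_lbound; exists n.
Qed.

(** Dominated convergence in the form of an eventual upper bound. *)
Lemma dominated_lt (g : T -> \bar R) (c : \bar R) :
  measurable_fun D f -> measurable_fun D g ->
  (forall n x, D x -> f_ n x <= g x) -> \int[m]_(x in D) g x < +oo ->
  \int[m]_(x in D) f x < c ->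
  exists N, forall n, (N <= n)%N -> \int[m]_(x in D) f_ n x < c.
Proof.
move=> mf' mg fg gfin fc.
have ig : m.-integrable D g.
  apply/integrableP; split => //; rewrite (eq_integral g) // => x; rewrite inE => Dx.
  by rewrite gee0_abs // (le_trans (f0 0 Dx)) ?fg.
have [_ _ cv] := @dominated_convergence _ _ _ m D mD f_ f g mf mf' (aeW _ ff) ig
  (aeW _ (fun x => fun n Dx => eq_ind_r (fun z => z <= g x) (fg n x Dx) (gee0_abs (f0 n Dx)))).
have [N _ NP] := cv _ (open_ereal_lt' fc).
by exists N => n Nn; exact: NP.
Qed.

End Limits.

Section StintLimits.
Context {R : realType} {G : metricGraph R} (mu : vertex G -> R).
Hypothesis mu_ge0 : forall x, 0 <= mu x.
Variable x0 : vertex G.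
Local Notation stint := (st_integral mu_ge0 x0).
Local Notation stmeas := (@stmeas R G x0).
Local Notation leb := (@lebesgue_measure R).
Variables (f_ : nat -> gpoint G -> R -> R) (f : gpoint G -> R -> R).
Hypotheses (mf : forall n, stmeas (f_ n))
  (f0 : forall n p t, 0 <= t -> 0 <= f_ n p t)
  (ff : forall p t, 0 <= t -> f_ n p t @[n --> \oo] --> f p t).

Let mf_ n : measurable_fun ([set: gspace x0] `*` `[(0 : R), +oo[)
  (EFin \o @stfun R G x0 (f_ n)).
Proof. by apply/measurable_EFinP; exact: mf. Qed.

Let f_0 n z : ([set: gspace x0] `*` `[(0 : R), +oo[) z -> (0 <= (EFin \o @stfun R G x0 (f_ n)) z)%E.
Proof. by case: z => p t [_] /=; rewrite in_itv /= andbT lee_fin; exact: f0. Qed.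

Let f_f z : ([set: gspace x0] `*` `[(0 : R), +oo[) z ->
  (EFin \o @stfun R G x0 (f_ n)) z @[n --> \oo] --> (EFin \o stfun f) z.
Proof.
case: z => p t [_] /=; rewrite in_itv /= andbT => t0.
by apply: cvg_EFin; [exact: nearW|exact: ff].
Qed.

Lemma stint_fatou (c : \bar R) : (c < stint f)%E ->
  exists N, forall n, (N <= n)%N -> (c < stint (f_ n))%E.
Proof. exact: (@fatou_lt _ _ R (stmeasure x0 mu_ge0) _ (@measurable_future R G x0) _ _ mf_ f_0 f_f c). Qed.

Lemma stint_dominated (g : gpoint G -> R -> R) (c : \bar R) : stmeas f -> stmeas g ->
  (forall n p t, 0 <= t -> f_ n p t <= g p t) -> (stint g < +oo)%E -> (stint f < c)%E ->
  exists N, forall n, (N <= n)%N -> (stint (f_ n) < c)%E.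
Proof.
move=> mf' mg fg gfin fc.
apply: (@dominated_lt _ _ R (stmeasure x0 mu_ge0) _ (@measurable_future R G x0) _ _ mf_ f_0 f_f
  (EFin \o @stfun R G x0 g) c) => //.
- exact/measurable_EFinP.
- exact/measurable_EFinP.
- by move=> n [p t] [_] /=; rewrite in_itv /= andbT lee_fin; exact: fg.
Qed.

End StintLimits.

Section ExtendedSums.
Context {R : realType}.
Local Open Scope ereal_scope.

(** A term bounded below moves to the other side, even when the remaining
    quantities are infinite. *)
Lemma le_of_sum_ge (A T X : \bar R) (e : R) :
  0 <= A -> 0 <= X -> (- e)%:E <= T -> A + T <= X -> A <= X + e%:E.
Proof.
case: A T X => [a| |] // [t| |] // [x| |] //= _ _; rewrite ?leey // ?lee_fin.
by lra.
Qed.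

Lemma absorb_half (A S : \bar R) (c : R) : 0 <= A -> A < +oo -> S <= A ->
  A <= (2^-1)%:E * S + c%:E -> A <= (2 * c)%:E.
Proof.
case: A => [a| |] //; case: S => [s| |] // _ _; rewrite ?leye_eq ?lee_fin //.
- by lra.
- by move=> _; rewrite mulrNy gtr0_sg ?invr_gt0 // mul1e.
Qed.

End ExtendedSums.

(** * Passage to the limit *)

Section Sequence.
Context {R : realType} {G : metricGraph R}.
Local Notation V := (vertex G).
Local Notation E := (edge G).
Local Notation leb := (@lebesgue_measure R).
Context (mu : V -> R) (omega : V -> V -> R) (x0 : V).
Hypotheses (mu_gt0 : forall x, 0 < mu x)
  (omega_ge0 : forall x y, 0 <= omega x y)
  (omega_sym : forall x y, omega x y = omega y x)
  (omega_adj : forall x y, 0 < omega x y <-> joined x y)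
  (connected : path_connected_graph G) (G_locally_finite : locally_finite G).
Variables (sigma delta : R).
Hypothesis sigma_gt1 : 1 < sigma.
Variable h : gpoint G -> R -> R.
Hypotheses (h_gt0 : forall p (t : R), 0 <= t -> 0 < h p t)
  (h_measurable : st_measurable h).
Variables (u0 : gpoint G -> R) (u : gpoint G -> R -> R).
Hypothesis u_solution : very_weak_solution mu omega h sigma u0 u.
Hypothesis u0_measurable : forall e, measurable_fun `]0, len e[ (on_edge u0 e).
Hypothesis u0_int_ge0 : (0 <= gint mu u0)%E.
Variables (K Cw C : R) (k : nat).
Hypotheses (K_ge0 : 0 <= K) (Cw_ge0 : 0 <= Cw) (C_ge0 : 0 <= C).
Hypothesis k_large : (2 * k.+1)%:R * sigma^-1 <= (2 * k).+1%:R.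
Variables (r_ kappa_ : nat -> R) (v_ : nat -> V -> R).
Hypotheses (r_gt0 : forall n, 0 < r_ n) (r_ge : forall n, n.+1%:R <= r_ n).
Hypotheses (kappa_gt0 : forall n, 0 < kappa_ n) (kappa_le : forall n, kappa_ n <= n.+1%:R^-1).
Hypothesis spec : forall n, cutoff_spec mu omega x0 delta (r_ n) (kappa_ n) K Cw (v_ n).
Hypothesis uX : forall n, L1loc_X mu x0 (delta / r_ n) u.

Let mu_ge0 x : 0 <= mu x := ltW (mu_gt0 x).
Local Notation stint := (st_integral (fun x => ltW (mu_gt0 x)) x0).
Local Notation stmeas := (@stmeas R G x0).
Local Notation reaction := (reaction sigma h u).
Local Notation q := ((sigma - 1)^-1).

Hypothesis growth : forall n,
  (stint (growth_mass x0 sigma delta h (r_ n)) <=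
     (4 * (C * r_ n `^ (sigma / (sigma - 1))))%:E)%E.
Hypothesis kappa_small : forall n,
  ((K / r_ n)%:E * stint (kappa_mass x0 delta u Cw (r_ n) (kappa_ n)) <= (n.+1%:R^-1)%:E)%E.

Local Notation A n := (stint (fun p t => reaction p t * (extend (v_ n) p * tcut (r_ n) k t))%R).
Local Notation S n := (stint (late_mass x0 sigma h u (r_ n) k (v_ n))).
Local Notation T n := (gint mu (fun p => u0 p * extend (v_ n) p)%R).

Lemma tail_small (e : R) : 0 < e -> exists N, forall n, (N <= n)%N -> n.+1%:R^-1 < e.
Proof.
move=> e0; have [N _ NP] := @near_infty_natSinv_lt R (PosNum e0).
by exists N => n Nn; exact: NP.
Qed.

Lemma kappa_cvg0 : kappa_ n @[n --> \oo] --> (0 : R).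
Proof.
apply: (@squeeze_cvgr _ _ _ _ (cst 0) (@harmonic R)); last 2 first.
- exact: cvg_cst.
- exact: cvg_harmonic.
by apply: nearW => n; rewrite (ltW (kappa_gt0 n)) kappa_le.
Qed.

Lemma eventually_far (M : R) : exists N, forall n, (N <= n)%N -> M < r_ n.
Proof.
have MN := archi_boundP (normr_ge0 M); exists (Num.bound `|M|) => n Nn.
apply: le_lt_trans (ler_norm M) _; apply: lt_le_trans MN _; apply: le_trans (r_ge n).
by rewrite ler_nat (leq_trans Nn).
Qed.

Lemma cutoff_cvg1 p : extend (v_ n) p @[n --> \oo] --> (1 : R).
Proof.
have [N NP] := eventually_far (gdist p (Vtx x0)).
have : (1 - kappa_ n) @[n --> \oo] --> (1 - 0 : R).
  by apply: cvgB; [exact: cvg_cst|exact: kappa_cvg0].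
rewrite subr0; apply: cvg_trans; apply: near_eq_cvg.
by exists N => // n /= Nn; rewrite (cut_in (spec n)) ?NP.
Qed.

Lemma reaction_cut_cvg p t : reaction p t * (extend (v_ n) p * tcut (r_ n) k t)
  @[n --> \oo] --> reaction p t.
Proof.
have [N NP] := eventually_far t.
have : reaction p t * extend (v_ n) p @[n --> \oo] --> reaction p t * 1.
  by apply: cvgMr; exact: cutoff_cvg1.
rewrite mulr1; apply: cvg_trans; apply: near_eq_cvg.
by exists N => // n /= Nn; rewrite tcut_before ?mulr1 // ltW // NP.
Qed.

Lemma reaction_late_cvg p t : reaction p t * late x0 (r_ n) p t @[n --> \oo] --> (0 : R).
Proof.
have [N NP] := eventually_far (Num.max t (gdist p (Vtx x0))).
have : (0 : R) @[n --> \oo] --> (0 : R) by exact: cvg_cst.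
apply: cvg_trans; apply: near_eq_cvg.
exists N => // n /= /NP; rewrite gt_max => /andP[tr pr].
rewrite /late !indicE !mem_set ?mulr1 ?subrr ?mulr0 //.
  by rewrite /= in_itv /= ltW.
by apply/(ball_gdist connected); rewrite gdistC.
Qed.

(** Since [gint mu u0] is nonnegative, the negative part of [u0] has a finite
    integral, at most that of the positive part. The cutoff only decreases the
    former, and by Fatou's lemma the latter is recovered in the limit. *)
Lemma initial_term (e : R) : 0 < e -> exists N, forall n, (N <= n)%N -> ((- e)%:E <= T n)%E.
Proof.
move=> e0; move: u0_int_ge0; rewrite /gint.
have np : (0 <= gint_nneg mu (u0^\-)%R)%E by apply: gint_nneg_ge0 => // p; exact: funrneg_ge0.
have ppos n p : 0 <= extend (v_ n) p by exact: (cut_ge0 (spec n)).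
have mp : forall e, measurable_fun `]0, len e[ (on_edge (u0^\+)%R e).
  by move=> e1; apply: measurable_funrpos; exact: u0_measurable.
have posE n : ((fun p => u0 p * extend (v_ n) p)^\+)%R = fun p => (u0^\+)%R p * extend (v_ n) p.
  by apply/funext => p; rewrite /funrpos maxr_pMl // mul0r.
have negE n : ((fun p => u0 p * extend (v_ n) p)^\-)%R = fun p => (u0^\-)%R p * extend (v_ n) p.
  by apply/funext => p; rewrite /funrneg maxr_pMl // mul0r mulNr.
have ng n : (gint_nneg mu (fun p => (u0^\-)%R p * extend (v_ n) p)%R <= gint_nneg mu (u0^\-)%R)%E.
  apply: le_gint_nneg => // p; first by rewrite mulr_ge0 // funrneg_ge0.
  by rewrite -[leRHS]mulr1 ler_wpM2l ?funrneg_ge0 // (cut_le1 (spec n)).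
case: (gint_nneg mu (u0^\-)%R) np ng => [b| |] // np ng; last by rewrite addeNy.
move=> Pb; have bP : ((b - e)%:E < gint_nneg mu (u0^\+)%R)%E.
  apply: (@lt_le_trans _ _ b%:E); first by rewrite lte_fin ltrBlDr ltrDl.
  by move: Pb; rewrite leeBrDr // add0e.
have mf n : forall e, measurable_fun `]0, len e[ (on_edge (fun p => (u0^\+)%R p * extend (v_ n) p) e).
  by move=> e1; apply: measurable_funM; [exact: mp|exact: measurable_extend].
have f0 n p : 0 <= (u0^\+)%R p * extend (v_ n) p by rewrite mulr_ge0 ?funrpos_ge0.
move: bP; rewrite (@gint_nnegE _ _ x0 mu mu_ge0 _ (gmeasurable_fun mp) (funrpos_ge0 u0)).
move=> /(@fatou_lt _ _ R (gmeasure mu_ge0 x0) setT measurableT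
  (fun n p => ((u0^\+)%R p * extend (v_ n) p)%:E)).
case.
- by move=> n; apply/measurable_EFinP; exact: gmeasurable_fun.
- by move=> n p _; rewrite lee_fin.
- move=> p _; apply: cvg_EFin; first exact: nearW.
  by rewrite -[X in _ --> X]mulr1; apply: cvgMr; exact: cutoff_cvg1.
move=> N NP; exists N => n /NP; rewrite posE negE -gint_nnegE //; last exact: gmeasurable_fun.
move: (ng n); have := @gint_nneg_ge0 _ _ mu mu_ge0 (fun p => (u0^\-)%R p * extend (v_ n) p).
case: (gint_nneg mu (fun p => (u0^\-)%R p * extend (v_ n) p)) => [c| |] //; last first.
  move=> /(_ (fun p => mulr_ge0 (funrneg_ge0 _ _) (ppos n p))) //.
move=> _; case: (gint_nneg mu _) => [a| |] //=; rewrite ?lee_fin ?lte_fin ?leey //.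
by lra.
Qed.

(** The constant [D] that remains in the limit. *)
Definition limit_const : R := (K + 4 * k.+1%:R) `^ (sigma / (sigma - 1)) * Cw * (4 * C).

Lemma limit_const_ge0 : 0 <= limit_const.
Proof. by rewrite !mulr_ge0 ?powR_ge0. Qed.

Lemma young_growth n (lam : R) :
  young_const sigma K Cw (r_ n) k lam * (4 * (C * r_ n `^ (sigma / (sigma - 1)))) =
  lam `^ (- q) * limit_const.
Proof.
have rn := r_gt0 n; have r0 := ltW rn.
rewrite /young_const /limit_const powRM ?invr_ge0 ?addr_ge0 ?mulr_ge0 //.
set s := sigma / _; have rr : (r_ n)^-1 `^ s * r_ n `^ s = 1.
  by rewrite -powRM ?invr_ge0 // mulVf ?gt_eqF // powR1.
rewrite [LHS](_ : _ = lam `^ (- q) * ((K + 4 * k.+1%:R) `^ s * Cw * (4 * C)) *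
  ((r_ n)^-1 `^ s * r_ n `^ s)); last by ring.
by rewrite rr mulr1.
Qed.

Let A_ge0 n : (0 <= A n)%E.
Proof.
apply: stint_ge0 => p t t0.
by rewrite mulr_ge0 ?reaction_ge0 // mulr_ge0 ?tcut_ge0 // (cut_ge0 (spec n)).
Qed.

Let S_ge0 n : (0 <= S n)%E.
Proof. by apply: stint_ge0 => p t t0; exact: (late_mass_ge0 _ h_gt0 _ _ (spec n)). Qed.

(** The integral inequality combined with Young's inequality: all terms other
    than the late reaction and the constant are eventually smaller than [e]. *)
Lemma reaction_bound (lam e : R) : 0 < lam -> 0 < e -> exists N, forall n, (N <= n)%N ->
  (A n <= lam%:E * S n + (lam `^ (- q) * limit_const + e)%:E)%E.
Proof.
move=> l0 e0; have e20 : 0 < e / 2 by rewrite divr_gt0.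
have [N1 N1P] := initial_term e20; have [N2 N2P] := tail_small e20.
exists (maxn N1 N2) => n; rewrite geq_max => /andP[/N1P T1 /N2P n2].
have lS : (0 <= lam%:E * S n)%E by rewrite mule_ge0 // lee_fin ltW.
have c0 : 0 <= lam `^ (- q) * limit_const by rewrite mulr_ge0 ?powR_ge0 ?limit_const_ge0.
rewrite [(_ + e)%R](_ : _ = lam `^ (- q) * limit_const + e / 2 + e / 2); last by field.
rewrite EFinD addeA; apply: (le_of_sum_ge (A_ge0 n) _ T1).
  by rewrite adde_ge0 // lee_fin addr_ge0 // ltW.
apply: le_trans (integral_inequality mu_gt0 omega_ge0 omega_sym omega_adj connected
  G_locally_finite h_gt0 h_measurable u_solution k K_ge0 Cw_ge0 (r_gt0 n) (spec n) (uX n)) _.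
apply: le_trans (stint_defect_le mu_gt0 connected sigma_gt1 h_gt0 h_measurable K_ge0 Cw_ge0
  (r_gt0 n) (kappa_gt0 n) (spec n) (uX n) k_large l0) _.
rewrite EFinD addeA; apply: leeD; last first.
  by apply: le_trans (kappa_small n) _; rewrite lee_fin ltW.
apply: leeD => //; rewrite -(young_growth n) EFinM; apply: lee_wpmul2l (growth n).
by rewrite lee_fin young_const_ge0.
Qed.

(** Needed to absorb the late reaction term into the left-hand side. *)
Lemma A_fin : exists N, forall n, (N <= n)%N -> (A n < +oo)%E.
Proof.
have [N NP] := initial_term ltr01; exists N => n /NP T1.
have := integral_inequality mu_gt0 omega_ge0 omega_sym omega_adj connected
  G_locally_finite h_gt0 h_measurable u_solution k K_ge0 Cw_ge0 (r_gt0 n) (spec n) (uX n).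
have := stint_defect_fin mu_gt0 connected k K_ge0 Cw_ge0 (r_gt0 n) (spec n) (uX n).
set X := stint _ => Xfin AX.
have X0 : (0 <= X)%E.
  by apply: stint_ge0 => p t _; rewrite mulr_ge0 // addr_ge0 // mulr_ge0 ?tcut_ge0 // (cut_ge0 (spec n)).
apply: le_lt_trans (le_of_sum_ge (A_ge0 n) X0 T1 AX) _.
by rewrite lte_add_pinfty ?ltry.
Qed.

Lemma stmeas_A n : stmeas (fun p t => reaction p t * (extend (v_ n) p * tcut (r_ n) k t)).
Proof. exact: (stmeas_reaction_cut sigma h_measurable k (v_ n) (uX n)). Qed.

(** By Fatou's lemma, as the test functions converge to 1. *)
Lemma stint_reaction_le (c : R) :
  (exists N, forall n, (N <= n)%N -> (A n <= c%:E)%E) -> (stint reaction <= c%:E)%E.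
Proof.
move=> [N NP]; rewrite leNgt; apply/negP.
move=> /(stint_fatou (f_ := fun n p t => reaction p t * (extend (v_ n) p * tcut (r_ n) k t))) [].
- exact: stmeas_A.
- move=> n p t t0.
  by rewrite mulr_ge0 ?reaction_ge0 // mulr_ge0 ?tcut_ge0 // (cut_ge0 (spec n)).
- by move=> p t _; exact: reaction_cut_cvg.
- move=> M MP; have := MP _ (leq_maxr N M); rewrite ltNge => /negP; apply.
  exact: NP (leq_maxl N M).
Qed.

(** With [lam = 1 / 2] the late reaction is at most half of the left-hand side.
    *)
Lemma stint_reaction_fin : (stint reaction < +oo)%E.
Proof.
have h20 : 0 < 2^-1 :> R by rewrite invr_gt0.
have [N1 N1P] := reaction_bound h20 ltr01; have [N2 N2P] := A_fin.
apply: le_lt_trans (stint_reaction_le _) (ltry _).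
exists (maxn N1 N2) => n; rewrite geq_max => /andP[/N1P An /N2P Afin].
apply: absorb_half (A_ge0 n) Afin _ An.
apply: le_stint => p t t0; first exact: (late_mass_ge0 _ h_gt0 _ _ (spec n)).
rewrite /late_mass -[leRHS]mulr1 ler_wpM2l ?late_le1 //.
by rewrite mulr_ge0 ?reaction_ge0 // mulr_ge0 ?tcut_ge0 // (cut_ge0 (spec n)).
Qed.

(** The late regions escape to infinity, and the reaction is integrable. *)
Lemma late_mass_small (e : R) : 0 < e -> exists N, forall n, (N <= n)%N -> (S n < e%:E)%E.
Proof.
move=> e0; have mr : stmeas reaction by exact: (stmeas_reaction sigma h_measurable (uX 0)).
pose f n p t := reaction p t * late x0 (r_ n) p t.
have fl n p t : 0 <= t -> f n p t <= reaction p t.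
  by move=> t0; rewrite -[leRHS]mulr1 ler_wpM2l ?late_le1 ?reaction_ge0.
have f0 n p t : 0 <= t -> 0 <= f n p t.
  by move=> t0; rewrite mulr_ge0 ?late_ge0 ?reaction_ge0.
have mf n : stmeas (f n) by apply: stmeasM => //; exact: stmeas_late.
have z : (stint (fun _ _ => 0%R) < e%:E)%E by rewrite /st_integral integral0 lte_fin.
have [N NP] := @stint_dominated _ _ _ mu_ge0 x0 f (fun _ _ => 0) mf f0
  (fun p t _ => reaction_late_cvg p t) reaction e%:E (@stmeas_cst _ _ x0 0) mr fl
  stint_reaction_fin z.
exists N => n /NP; apply: le_lt_trans; apply: le_stint => p t t0.
  exact: (late_mass_ge0 _ h_gt0 _ _ (spec n)).
rewrite /late_mass /f ler_wpM2r ?late_ge0 // -[leRHS]mulr1 ler_wpM2l ?reaction_ge0 //.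
by rewrite mulr_ile1 ?tcut_ge0 ?tcut_le1 ?(cut_ge0 (spec n)) ?(cut_le1 (spec n)).
Qed.

(** Once the late reaction tends to 0, the factor [lam] in front of it is
    harmless and can be taken as large as the constant requires. *)
Lemma stint_reaction0 : stint reaction = 0%E.
Proof.
apply/eqP; rewrite eq_le; apply/andP; split; last first.
  by apply: stint_ge0 => p t; exact: reaction_ge0.
apply/lee_addgt0Pr => e e0; rewrite add0e; apply: stint_reaction_le.
have D0 : 0 < limit_const + 1 by rewrite ltr_wpDl ?limit_const_ge0.
(* lam is chosen so that lam^(-1 / (sigma - 1)) = 1 / x, which makes the
   constant at most e / 3. *)
pose x := 3 * (limit_const + 1) / e.
have x0' : 0 < x by rewrite divr_gt0 ?mulr_gt0.
pose lam := x `^ (sigma - 1); have l0 : 0 < lam by exact: powR_gt0.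
have lq : lam `^ (- q) * limit_const <= e / 3.
  rewrite -powRrM mulrN mulfV; last by rewrite gt_eqF // subr_gt0.
  rewrite powR_inv1 ?(ltW x0') //.
  rewrite (_ : x^-1 * _ = e / 3 * (limit_const / (limit_const + 1))); last first.
    by rewrite /x; field; rewrite !gt_eqF.
  rewrite -[leRHS]mulr1 ler_wpM2l ?divr_ge0 ?(ltW e0) // ler_pdivrMr // mul1r.
  by rewrite lerDl.
have e30 : 0 < e / 3 by rewrite divr_gt0.
have [N1 N1P] := reaction_bound l0 e30.
(* The remaining two thirds of e are for the late reaction and the vanishing
   errors. *)
have [N2 N2P] := late_mass_small (divr_gt0 e30 l0).
exists (maxn N1 N2) => n; rewrite geq_max => /andP[/N1P An /N2P Sn].
apply: le_trans An _; rewrite [in leRHS](_ : e = e / 3 + (e / 3 + e / 3)); last by field.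
rewrite [leRHS]EFinD; apply: leeD; last by rewrite lee_fin lerD2r.
rewrite [leRHS](_ : _ = lam%:E * (e / 3 / lam)%:E)%E; last first.
  by rewrite -EFinM mulrCA mulfV ?mulr1 // gt_eqF.
by apply: lee_wpmul2l (ltW Sn); rewrite lee_fin ltW.
Qed.

End Sequence.

(** * From a vanishing integral to a vanishing function *)

Section Vanishing.
Context {R : realType} {G : metricGraph R} (mu : vertex G -> R).
Hypothesis mu_gt0 : forall x, 0 < mu x.
Variable x0 : vertex G.
Local Notation V := (vertex G).
Local Notation E := (edge G).
Local Notation leb := (@lebesgue_measure R).
Let mu_ge0 x : 0 <= mu x := ltW (mu_gt0 x).

(** By Tonelli's theorem the integral over the graph is a measurable function of
    time with zero integral. *)
Lemma stint0_ae (f : gpoint G -> R -> R) : stmeas x0 f ->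
  (forall p t, 0 <= t -> 0 <= f p t) -> st_integral mu_ge0 x0 f = 0%E ->
  {ae leb, forall t, 0 <= t -> gint_nneg mu (f^~ t) = 0%E}.
Proof.
move=> mf f0; rewrite stintE // => f_int0.
have g0 t : `[(0 : R), +oo[%classic t -> (0 <= gint_nneg mu (f^~ t))%E.
  by rewrite /= in_itv /= andbT => t0; apply: gint_nneg_ge0 => // p; exact: f0.
have /(ae_eq_integral_abs leb (measurable_itv `[(0 : R), +oo[)) : 
  measurable_fun `[(0 : R), +oo[ (fun t => gint_nneg mu (f^~ t)).
  have nonneg p t : `[(0 : R), +oo[%classic t -> 0 <= f p t.
    by rewrite /= in_itv /= andbT; exact: f0.
  exact: (measurable_gint_nneg mu_ge0 (measurable_itv `[(0 : R), +oo[) mf nonneg).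
case=> + _; move=> /(_ _)/wrap[].
  by rewrite -f_int0; apply: eq_integral => t; rewrite inE => /g0 ?; rewrite gee0_abs.
apply: filterS => t ft t0.
by rewrite ft //= in_itv /= t0.
Qed.

Lemma gint_nneg0_vertex (f : gpoint G -> R) x : (forall p, 0 <= f p) ->
  gint_nneg mu f = 0%E -> f (Vtx x) = 0.
Proof.
move=> f0 /eqP; rewrite padde_eq0; last 2 first.
- by apply: esum_ge0 => y _; rewrite lee_fin mulr_ge0.
- by apply: esum_ge0 => e _; apply: integral_ge0 => s _; rewrite lee_fin; exact: f0.
move=> /andP[/eqP V0 _]; have : ((mu x * f (Vtx x))%:E <= 0)%E.
  rewrite -V0; apply: le_trans (esum_ge _); last first.
    exists [set x] => //; split=> //; exact: finite_set1.
  by rewrite fsbig_set1.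
rewrite lee_fin pmulr_rle0 // => fx; apply/eqP; rewrite eq_le fx; exact: f0.
Qed.

Lemma gint_nneg0_edge (f : gpoint G -> R) e : (forall p, 0 <= f p) ->
  measurable_fun `]0, len e[ (on_edge f e) ->
  gint_nneg mu f = 0%E -> {ae leb, forall s, 0 < s < len e -> on_edge f e s = 0}.
Proof.
move=> f0 mf /eqP; rewrite padde_eq0; last 2 first.
- by apply: esum_ge0 => y _; rewrite lee_fin mulr_ge0.
- by apply: esum_ge0 => e' _; apply: integral_ge0 => s _; rewrite lee_fin; exact: f0.
move=> /andP[_ /eqP E0].
have i0 : (\int[leb]_(s in `]0%R, len e[) (on_edge f e s)%:E = 0)%E.
  apply/eqP; rewrite eq_le integral_ge0 ?andbT; last first.
    by move=> s _; rewrite lee_fin; exact: f0.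
  rewrite -E0; apply: le_trans (esum_ge _); last first.
    exists [set e] => //; split=> //; exact: finite_set1.
  by rewrite fsbig_set1.
have /(ae_eq_integral_abs leb (measurable_itv `]0, len e[)) [+ _] :
  measurable_fun `]0, len e[ (EFin \o on_edge f e) by exact/measurable_EFinP.
move=> /(_ _)/wrap[].
  by rewrite -i0; apply: eq_integral => s _; rewrite gee0_abs // lee_fin; exact: f0.
apply: filterS => s fs sl.
by have := fs _; rewrite /= in_itv /= => /(_ sl) [].
Qed.

(** A neighbourhood of a point at which the function is not 0 has positive
    measure. *)
Lemma ae0_continuous (f : R -> R) (l : R) :
  {ae leb, forall s, 0 < s < l -> f s = 0} ->
  (forall s, 0 < s < l -> {for s, continuous f}) -> forall s, 0 < s < l -> f s = 0.
Proof.
move=> [N [mN N0 fN]] cf s sl; apply/eqP; apply: contraT => fs.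
have near_fs : \forall y \near s, f y != 0 by exact: cvgr_neq0 (cf s sl) fs.
have near_l : \forall y \near s, 0 < y < l.
  by apply: (near_in_itvoo (a := 0) (b := l)); rewrite in_itv.
have [d /= d0 dN] : \forall y \near s, N y.
  near=> y; apply: fN => /= y0; have : f y != 0 by near: y.
  by rewrite y0 ?eqxx //; near: y.
have : (leb (ball s d) <= leb N)%E.
  by rewrite le_measure ?inE //; exact: measurable_ball.
by rewrite N0 lebesgue_measure_ball ?(ltW d0) // lee_fin leNgt mulr2n addr_gt0.
Unshelve. all: by end_near.
Qed.

End Vanishing.

(** * Choice of the truncation level, and the theorem *)

Section KappaChoice.
Context {R : realType} {G : metricGraph R} (mu : vertex G -> R).
Hypothesis mu_gt0 : forall x, 0 < mu x.
Variable x0 : vertex G.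
Hypothesis connected : path_connected_graph G.
Variables (delta K Cw r : R) (u : gpoint G -> R -> R).
Hypotheses (K_ge0 : 0 <= K) (Cw_ge0 : 0 <= Cw) (r_gt0 : 0 < r).
Hypothesis uX : L1loc_X mu x0 (delta / r) u.
Local Notation stint := (st_integral (fun x => ltW (mu_gt0 x)) x0).
Local Notation w := (weight x0 delta r).

(** As [kappa] tends to 0 the truncation error tends to 0 pointwise, dominated
    by the weighted [|u|]. *)
Lemma kappa_exists (e : R) : 0 < e -> exists kappa, [/\ 0 < kappa, kappa < 1, kappa <= e &
  ((K / r)%:E * stint (kappa_mass x0 delta u Cw r kappa) <= e%:E)%E].
Proof.
move=> e0; have Kr : 0 <= K / r by rewrite divr_ge0 // ltW.
pose ka m : R := m.+2%:R^-1; have ka0 m : 0 < ka m by rewrite invr_gt0.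
pose g p t := Cw * (w p * `|u p t| * \1_`[0, 2 * r] t).
have mu' := stmeas_norm_u uX.
have mi : stmeas x0 (fun p t => w p * `|u p t| * \1_`[0, 2 * r] t).
  apply: stmeasM; last by apply: stmeas_indic; exact: measurable_itv.
  by apply: stmeasM mu'; exact: stmeas_weight.
have mg : stmeas x0 g by apply: stmeasM mi; exact: stmeas_cst.
have gfin : (stint g < +oo)%E.
  rewrite stintZ //; last by move=> p t _; rewrite !mulr_ge0 ?weight_ge0.
  by apply: lte_mul_pinfty => //; apply: stint_weight_u_fin; rewrite ?mulr_gt0.
have c0 : (stint (fun _ _ => 0%R) < (e / (K / r + 1))%:E)%E.
  by rewrite /st_integral integral0 lte_fin divr_gt0 // ltr_wpDl.
have [||p t t0||N NP] := @stint_dominated _ _ _ (fun x => ltW (mu_gt0 x)) x0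
  (fun m => kappa_mass x0 delta u Cw r (ka m)) (fun _ _ => 0) _ _ _ g _ (@stmeas_cst _ _ x0 0) mg _ gfin c0.
- by move=> m; exact: (stmeas_kappa_mass connected Cw (ka m) uX).
- by move=> m p t _; exact: kappa_mass_ge0.
- apply: (@squeeze_cvgr _ _ _ _ (cst 0) (fun m => `|u p t| * ka m)).
  + apply: nearW => m; rewrite kappa_mass_ge0 //= /kappa_mass -mulrA ler_wpM2l //.
    rewrite -[leRHS]mulr1 ler_pM ?indic_ge0 // ?ge_min ?lexx //.
    by rewrite le_min (ltW (ka0 m)) mulr_ge0 ?weight_ge0.
  + exact: cvg_cst.
  + rewrite -[X in _ --> X](mulr0 `|u p t|); apply: cvgMr.
    have := @cvg_harmonic R; rewrite -(cvg_shiftS (@harmonic R)); exact.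
- move=> m p t _; rewrite /kappa_mass /g mulrA ler_wpM2r ?indic_ge0 //.
  by rewrite mulrA mulrC ler_wpM2r // ge_min lexx orbT.
have [M MP] := tail_small e0.
exists (ka (maxn N M)); split=> //.
- by rewrite invf_lt1 // ltr1n.
- apply/ltW; apply: le_lt_trans (MP _ (leq_maxr N M)).
  by rewrite lef_pV2 ?posrE // ler_nat.
apply: le_trans (lee_wpmul2l _ (ltW (NP _ (leq_maxl N M)))) _; first by rewrite lee_fin.
rewrite -EFinM lee_fin mulrCA -[leRHS]mulr1 ler_wpM2l ?(ltW e0) //.
by rewrite ler_pdivrMr ?mul1r ?lerDl // ltr_wpDl.
Qed.

End KappaChoice.

Lemma stmeas_slice {R : realType} {G : metricGraph R} (x0 : vertex G)
    (f : gpoint G -> R -> R) t e : stmeas x0 f -> 0 <= t ->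
  measurable_fun `]0, len e[ (on_edge (f^~ t) e).
Proof.
move=> mf t0; apply: measurable_funTS.
apply: (@measurable_comp _ _ _ _ _ _ ([set: gspace x0] `*` `[(0 : R), +oo[) (@stfun R G x0 f) setT
  (fun s => (edge_pt e s : gspace x0, t)) (@measurable_future R G x0)) => //.
  by move=> _ [s _ <-]; split => //=; rewrite in_itv /= t0.
by apply: measurable_fun_pair => //; exact: measurable_edge_pt.
Qed.

(** The condition amounts to [1 <= (sigma - 1) (2 k + 1)]. *)
Lemma exists_cutoff_power {R : realType} (sigma : R) : 1 < sigma ->
  exists k, (2 * k.+1)%:R * sigma^-1 <= (2 * k).+1%:R :> R.
Proof.
move=> s1; have s0 : 0 < sigma by exact: lt_trans s1.
have sm : 0 < sigma - 1 by rewrite subr_gt0.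
exists (Num.bound (sigma - 1)^-1); set k := Num.bound _.
have : (sigma - 1)^-1 < k%:R by apply: archi_boundP; rewrite invr_ge0 ltW.
rewrite -[_^-1]mul1r ltr_pdivrMr // => hk.
rewrite ler_pdivrMr // -[k.+1]addn1 -[(2 * k).+1]addn1 !natrD !natrM !natrD.
have k0 : 0 <= k%:R :> R by [].
nra.
Qed.

Theorem theorem2p6 (R : realType) (G : metricGraph R)
  (mu : vertex G -> R) (omega : vertex G -> vertex G -> R)
  (mu_gt0 : forall x, 0 < mu x)
  (omega_ge0 : forall x y, 0 <= omega x y)
  (omega_sym : forall x y, omega x y = omega y x)
  (omega_adj : forall x y, 0 < omega x y <-> joined x y)
  (G_infinite : infinite_set [set: vertex G])
  (G_connected : path_connected_graph G)
  (G_locally_finite : locally_finite G)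
  (len_bounded : has_ubound (range (@len R G)))
  (len_inf_gt0 : 0 < inf (range (@len R G)))
  (x0 : vertex G)
  (x0_far : exists x_ : nat -> vertex G,
     gdist (Vtx x0) (Vtx (x_ n)) @[n --> \oo] --> +oo)
  (balls_finite : forall r : R, 0 < r ->
     finite_set [set x : vertex G | ball (Vtx x0) r (Vtx x)] /\
     finite_set [set e : edge G | exists2 s : R, s \in `]0, len e[ &
                                  ball (Vtx x0) r (edge_pt e s)])
  (omega_bound : exists2 C0 : R, 0 < C0 & forall x,
     \sum_(y \in [set y | joined x y]) omega x y <= C0 * mu x)
  (R0 : R) (R0E : R0 = Num.max (2 * sup (range (@len R G))) 1)
  (sigma delta : R) (sigma_gt1 : 1 < sigma) (delta_gt0 : 0 < delta)
  (h : gpoint G -> R -> R)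
  (h_gt0 : forall p (t : R), 0 <= t -> 0 < h p t)
  (h_measurable : st_measurable h)
  (h_growth : exists2 C : R, 0 < C & forall r : R, R0 <= r ->
     let B : set (gpoint G) := ball (Vtx x0) r in
     let w p t := h p t `^ (- (sigma - 1)^-1)
                  * expR (- (delta / r) * gdist p (Vtx x0)) in
     let bound := (C * r `^ (sigma / (sigma - 1)))%:E in
     [/\ (\int[@lebesgue_measure R]_(t in `[r, (2 * r)%R])
            (\esum_(x in [set x | B (Vtx x)]) (mu x * w (Vtx x) t)%:E)
          <= bound)%E,
         (\int[@lebesgue_measure R]_(t in `[r, (2 * r)%R])
            (\esum_(e in [set: edge G])
              \int[@lebesgue_measure R]_(s in `]0%R, len e[)
                (w (edge_pt e s) t * \1_B (edge_pt e s))%:E)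
          <= bound)%E,
         (\int[@lebesgue_measure R]_(t in `[0%R, (2 * r)%R])
            (\esum_(x in [set x | (~` B) (Vtx x)]) (mu x * w (Vtx x) t)%:E)
          <= bound)%E &
         (\int[@lebesgue_measure R]_(t in `[0%R, (2 * r)%R])
            (\esum_(e in [set: edge G])
              \int[@lebesgue_measure R]_(s in `]0%R, len e[)
                (w (edge_pt e s) t * \1_(~` B) (edge_pt e s))%:E)
          <= bound)%E])
  (u0 : gpoint G -> R) (u : gpoint G -> R -> R)
  (u_solution : very_weak_solution mu omega h sigma u0 u)
  (u_L1loc_X : forall r : R, R0 <= r -> L1loc_X mu x0 (delta / r) u)
  (u0_X : forall r : R, R0 <= r -> inX mu x0 (delta / r) u0)
  (u0_int_ge0 : (0 <= gint mu u0)%E) :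
  {ae @lebesgue_measure R, forall t : R, 0 <= t -> forall p, u p t = 0}.
Proof.
have [C0 C0_gt0 C0P] := omega_bound.
have [C C_gt0 CP] := h_growth.
set J := sup (range (@len R G)) in R0E.
set lmin := inf (range (@len R G)) in len_inf_gt0.
(* Without edges the infimum of the lengths would be inf set0 = 0. *)
have [e1 _] : exists e1 : edge G, True.
  apply: contrapT => noe; move: len_inf_gt0; rewrite /lmin.
  rewrite (_ : range _ = set0) ?inf0 ?ltxx //.
  by rewrite -subset0 => y [e _ _]; apply: noe; exists e.
have lenJ (e : edge G) : len e <= J.
  by apply: ub_le_sup => //; exists e.
have J_ge0 : 0 <= J by rewrite (le_trans (ltW (len_gt0 e1))).
have len_lmin (e : edge G) : lmin <= len e.
  apply: ge_inf; last by exists e.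
  by exists 0 => _ [e' _ <-]; exact: ltW (len_gt0 e').
have [k k_large] := exists_cutoff_power sigma_gt1.
(* Besides the growth hypotheses, r >= R0 gives 1 <= r and 2 J <= r. *)
pose r_ n := Num.max R0 n.+1%:R.
have R0r n : R0 <= r_ n by rewrite le_max lexx.
have r_ge n : n.+1%:R <= r_ n by rewrite le_max lexx orbT.
have r_ge1 n : 1 <= r_ n by apply: le_trans (R0r n); rewrite R0E le_max lexx orbT.
have r_geJ n : 2 * J <= r_ n by apply: le_trans (R0r n); rewrite R0E le_max lexx.
have r_gt0 n : 0 < r_ n by exact: lt_le_trans (r_ge1 n).
pose K := lip_const J lmin C0 delta; pose Cw := expR (3 * delta).
have K_ge0 : 0 <= K.
  rewrite /K /lip_const !mulr_ge0 ?expR_ge0 ?(ltW delta_gt0) // addr_ge0 ?(ltW C0_gt0) //.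
  by rewrite divr_ge0 // exprn_ge0 // ltW.
have Cw_ge0 : 0 <= Cw by exact: expR_ge0.
have uX n := u_L1loc_X _ (R0r n).
have /choice[kappa_ kappaP] : forall n, exists kappa, [/\ 0 < kappa, kappa < 1, kappa <= n.+1%:R^-1 &
    ((K / r_ n)%:E * st_integral (fun x => ltW (mu_gt0 x)) x0 (kappa_mass x0 delta u Cw (r_ n) kappa)
       <= (n.+1%:R^-1)%:E)%E].
  by move=> n; apply: kappa_exists => //; rewrite invr_gt0.
pose v_ n := cutoff x0 J delta (r_ n) (kappa_ n).
have spec n : cutoff_spec mu omega x0 delta (r_ n) (kappa_ n) K Cw (v_ n).
  have [ka0 ka1 _ _] := kappaP n.
  by apply: cutoffP => //; rewrite ka0.
have growth n : (st_integral (fun x => ltW (mu_gt0 x)) x0 (growth_mass x0 sigma delta h (r_ n)) <=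
     (4 * (C * r_ n `^ (sigma / (sigma - 1))))%:E)%E.
  have [Vi Ei Vo Eo] := CP _ (R0r n).
  apply: le_trans (stint_growth_mass mu_gt0 G_connected h_measurable (r_gt0 n) Vi Ei Vo Eo) _.
  by rewrite -!EFinD lee_fin; lra.
have z : st_integral (fun x => ltW (mu_gt0 x)) x0 (reaction sigma h u) = 0%E.
  apply: (@stint_reaction0 _ _ mu omega x0 mu_gt0 omega_ge0 omega_sym omega_adj G_connected
    G_locally_finite sigma delta sigma_gt1 h h_gt0 h_measurable u0 u u_solution _ u0_int_ge0
    K Cw C k K_ge0 Cw_ge0 (ltW C_gt0) k_large r_ kappa_ v_ r_gt0 r_ge _ _ spec uX growth).
  - exact: (u0_X _ (R0r 0)).1.
  - by move=> n; have [] := kappaP n.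
  - by move=> n; have [] := kappaP n.
  - by move=> n; have [] := kappaP n.
have mr : stmeas x0 (reaction sigma h u) by exact: (stmeas_reaction sigma h_measurable (uX 0)).
have r0 p t : 0 <= t -> 0 <= reaction sigma h u p t by exact: reaction_ge0.
have [N [mN N0 NP]] := stint0_ae mr r0 z; exists N; split=> // t /= nt.
apply: NP => /= zt; apply: nt => t0; have gz := zt t0.
have ru p : reaction sigma h u p t = 0 -> u p t = 0.
  move=> /eqP; rewrite mulf_eq0 gt_eqF ?h_gt0 //= powR_eq0 normr_eq0 => /andP[/eqP].
  by [].
have rt0 p : 0 <= reaction sigma h u p t by exact: r0.
case=> [x|e s sl]; first exact: ru (gint_nneg0_vertex mu_gt0 x rt0 gz).
rewrite -edge_pt_inn; apply: (@ae0_continuous _ (on_edge (u^~ t) e) (len e)) => //.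
- have [M [mM M0 MP]] := gint_nneg0_edge mu_gt0 rt0 (@stmeas_slice _ _ _ _ _ e mr t0) gz.
  by exists M; split=> // s1 /= ns; apply: MP => /= s1z; apply: ns => s1l; exact: ru (s1z s1l).
- move=> s' s'l; have [_ C2 _ _] := vws_classD u_solution t0 e.
  apply: differentiable_continuous; apply/derivable1_diffP.
  by have [] // := C2 s'; rewrite /= in_itv.
Qed.
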